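(* Let $k\in\mathbb N_0$, $f_0\in C^k[0,1]$, $K\in C^{2k}([0,1],[0,1])$, and let $\epsilon_n$ be a sequence with $\epsilon_n\to0$ and $n\epsilon_n^2\to\infty$. Let $p\in\{2,\infty\}$. Suppose that: (A) there exists $C_{k,\phi}>0$ such that $\|\phi_i^{(k)}\|_\infty\le C_{k,\phi}\,i^k$ for all $i\in\mathbb N$; (B) there exists $L_{k,\phi}>0$ such that $|\phi_i^{(k)}(x)-\phi_i^{(k)}(x')|\le L_{k,\phi}\,i^{k+1}|x-x'|$ for all $i\in\mathbb N$ and all $x,x'\in[0,1]$; (C) the regularization parameter $\lambda=\lambda_n>0$ is chosen such that $\tilde\kappa^2=o(\sqrt{n/\log n})$, $\tilde\kappa_k^2=O(n\epsilon_n^2/\log n)$ and $\hat\kappa_{k+1}^2=O(n)$; (D) $\|\hat f_n^{(k)}-f_0^{(k)}\|_p\lesssim\epsilon_n$ with $\mathbb P_0^{(n)}$-probability tending to $1$. Then $\epsilon_n$ is a posterior contraction rate of $\Pi_{n,k}(\cdot\mid\mathbb D_n)$ at $f_0^{(k)}$, i.e., for any $M_n\to\infty$, $$\Pi_{n,k}\left(\|f^{(k)}-f_0^{(k)}\|_p>M_n\epsilon_n\,\big|\,\mathbb D_n\right)\to0\quad\text{in }\mathbb P_0^{(n)}\text{-probability}.$$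
   Context: Model: $\mathbb D_n=\{(X_i,Y_i)\}_{i=1}^n$ are i.i.d. with $X_i\sim\mathbb P_X$ on $[0,1]$ (with density $p_X$ with respect to Lebesgue measure) and $Y_i=f_0(X_i)+\varepsilon_i$, $\varepsilon_i\sim N(0,\sigma^2)$ independent of $X_i$; $\mathbb P_0^{(n)}$ denotes the law of $\mathbb D_n$. Write $X=(X_1,\dots,X_n)^T$, $Y=(Y_1,\dots,Y_n)^T$. $\|\cdot\|_\infty$ is the supremum norm and $\|f\|_2=(\int f^2\,d\mathbb P_X)^{1/2}$. $a_n\lesssim b_n$ means $a_n\le Cb_n$ for a constant $C>0$ not depending on $n$. $\mathbb N_0=\mathbb N\cup\{0\}$, $f^{(0)}=f$. Kernel: $K:[0,1]\times[0,1]\to\mathbb R$ is a continuous, symmetric, positive definite kernel; $K\in C^{2k}([0,1],[0,1])$ means $\partial_x^j\partial_{x'}^jK(x,x')$ exists and is continuous for $0\le j\le k$. Its Mercer decomposition is $K(x,x')=\sum_{i\ge1}\mu_i\phi_i(x)\phi_i(x')$ with eigenvalues $\mu_1\ge\mu_2\ge\cdots>0$, $\mu_i\downarrow0$, and eigenfunctions $\{\phi_i\}$ forming an orthonormal basis of $L^2_{p_X}[0,1]$. Posterior: under the prior $f\sim\mathrm{GP}(0,\sigma^2(n\lambda)^{-1}K)$, $\lambda>0$, the posterior $\Pi_{n,k}(\cdot\mid\mathbb D_n)$ of $f^{(k)}$ is $\mathrm{GP}(\hat f_n^{(k)},\tilde V_n^k)$, where $$\hat f_n^{(k)}(x)=K_{k0}(x,X)[K(X,X)+n\lambda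 I_n]^{-1}Y,$$ $$\tilde V_n^k(x,x')=\sigma^2(n\lambda)^{-1}\{K_{kk}(x,x')-K_{k0}(x,X)[K(X,X)+n\lambda I_n]^{-1}K_{0k}(X,x')\},$$ with $K(X,X)=(K(X_i,X_j))_{i,j}$, $K_{k0}(x,X)=(\partial_x^kK(x,X_i))_{i=1}^n$ (row vector), $K_{0k}(X,x')=(\partial_{x'}^kK(X_i,x'))_{i=1}^n$ (column vector), $K_{kk}(x,x')=\partial_x^k\partial_{x'}^kK(x,x')$. Effective dimensions: for $0\le m\le k$, $\tilde\kappa_m^2=\sup_{x\in[0,1]}\sum_{i\ge1}\frac{\mu_i}{\lambda+\mu_i}\phi_i^{(m)}(x)^2$, $\tilde\kappa^2=\tilde\kappa_0^2$; and $\hat\kappa_m^2=\sum_{i\ge1}\frac{i^{2m}\mu_i}{\lambda+\mu_i}$ (used here with $m=k+1$). These depend on $\lambda$. *)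

(* Defs.v *)
From HB Require Import structures.
From mathcomp Require Import all_boot all_order all_algebra.
From mathcomp Require Import all_classical all_reals all_analysis.
Set Implicit Arguments.
Unset Strict Implicit.
Unset Printing Implicit Defensive.
Import Order.TTheory GRing.Theory Num.Theory.
Import numFieldNormedType.Exports.
Local Open Scope classical_set_scope.
Local Open Scope ring_scope.

(* Functions on [0, 1] are represented by functions on R of which only the
   values on [0, 1] matter; in particular derivatives are taken relative to
   [0, 1], hence are one-sided at 0 and 1.  Sequences indexed by i >= 1 in the
   mathematical text (eigenvalues, eigenfunctions) are indexed from 0: the
   entry i stands for the (i+1)-st eigenvalue or eigenfunction. *)

Section Derivatives.
Context {R : realType}.

Definition diff_quotient (f : R -> R) (x y : R) : R := (f y - f x) / (y - x).

Definition derivable01 (f : R -> R) (x : R) : Prop :=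
  cvg (diff_quotient f x @ within `[0, 1] x^').

Definition deriv01 (f : R -> R) (x : R) : R :=
  lim (diff_quotient f x @ within `[0, 1] x^').

Definition nderiv01 (k : nat) (f : R -> R) : R -> R := iter k deriv01 f.

Definition Ck01 (k : nat) (f : R -> R) : Prop :=
  (forall j, (j < k)%N ->
     forall x, x \in `[0, 1] -> derivable01 (nderiv01 j f) x) /\
  {within `[0, 1], continuous (nderiv01 k f)}.

(* the a-th derivative in the first argument of the b-th derivative in the
   second argument *)
Definition kderiv (a b : nat) (K : R -> R -> R) (x x' : R) : R :=
  nderiv01 a (fun s => nderiv01 b (K s) x') x.

Definition kernel_C2k (k : nat) (K : R -> R -> R) : Prop :=
  forall j, (j <= k)%N ->
  [/\ forall i x x', (i < j)%N -> x \in `[0, 1] -> x' \in `[0, 1] ->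
        derivable01 (nderiv01 i (K x)) x',
      forall i x x', (i < j)%N -> x \in `[0, 1] -> x' \in `[0, 1] ->
        derivable01 (nderiv01 i (fun s => nderiv01 j (K s) x')) x
    & {within `[0, 1] `*` `[0, 1],
        continuous (fun z : R * R => kderiv j j K z.1 z.2)}].

End Derivatives.

Section Kernel.
Context {R : realType}.

Definition symmetric_kernel (K : R -> R -> R) : Prop :=
  forall x x', x \in `[0, 1] -> x' \in `[0, 1] -> K x x' = K x' x.

(* Kernel convention: quadratic forms are nonnegative, not necessarily
   positive. *)
Definition positive_definite_kernel (K : R -> R -> R) : Prop :=
  forall (N : nat) (t a : 'I_N -> R), (forall i, t i \in `[0, 1]) ->
    0 <= \sum_(i < N) \sum_(j < N) a i * a j * K (t i) (t j).

Definition continuous_kernel (K : R -> R -> R) : Prop :=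
  {within `[0, 1] `*` `[0, 1], continuous (fun z : R * R => K z.1 z.2)}.

Definition has_density01 (PX : probability R R) (pX : R -> R) : Prop :=
  [/\ measurable_fun (`[0, 1] : set R) pX,
      forall x, x \in `[0, 1] -> 0 <= pX x
    & forall A : set R, measurable A ->
        PX A = (\int[lebesgue_measure]_(x in A `&` `[0%R, 1%R]) (pX x)%:E)%E].

(* For p = +oo this is the genuine supremum norm, not the essential supremum
   norm that Lnorm computes. *)
Definition norm01 (PX : probability R R) (p : \bar R) (g : R -> R) : \bar R :=
  if p == +oo%E then ereal_sup [set (`|g x|)%:E | x in `[0, 1]]
  else 'N[PX]_p[EFin \o (g \_ `[0%R, 1%R])]%E.

Record mercer_decomposition (PX : probability R R) (K : R -> R -> R)
    (mu : nat -> R) (phi : nat -> R -> R) : Prop := {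
  mercer_gt0 : forall i, 0 < mu i;
  mercer_noninc : forall i, mu i.+1 <= mu i;
  mercer_cvg0 : mu @ \oo --> (0 : R);
  mercer_continuous : forall i, {within `[0, 1], continuous (phi i)};
  mercer_eigen : forall i x, x \in `[0, 1] ->
    \int[PX]_(y in `[0, 1]) (K x y * phi i y) = mu i * phi i x;
  mercer_orthonormal : forall i j,
    \int[PX]_(y in `[0, 1]) (phi i y * phi j y) = (i == j)%:R;
  mercer_basis : forall h : R -> R, measurable_fun (`[0, 1] : set R) h ->
    (norm01 PX 2%:E h < +oo)%E ->
    (fun N => norm01 PX 2%:E (fun x => h x -
       \sum_(i < N) (\int[PX]_(y in `[0, 1]) (h y * phi i y)) * phi i x))
      @ \oo --> 0%E;
  mercer_expansion : forall x x', x \in `[0, 1] -> x' \in `[0, 1] ->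
    (fun N => \sum_(i < N) mu i * phi i x * phi i x') @ \oo --> K x x' }.

Definition kappa_tilde2 (mu : nat -> R) (phi : nat -> R -> R) (lambda : R)
    (m : nat) : \bar R :=
  ereal_sup [set (\sum_(0 <= i <oo)
      (mu i / (lambda + mu i) * nderiv01 m (phi i) x ^+ 2)%:E)%E
    | x in `[0, 1]].

Definition kappa_hat2 (mu : nat -> R) (lambda : R) (m : nat) : \bar R :=
  (\sum_(0 <= i <oo) (i.+1%:R ^+ (2 * m) * mu i / (lambda + mu i))%:E)%E.

(* Landau symbols for a nonnegative, possibly infinite sequence a and a real
   sequence b. *)
Definition ebigO (a : nat -> \bar R) (b : nat -> R) : Prop :=
  exists2 C : R, 0 < C & \forall n \near \oo, (a n <= (C * b n)%:E)%E.

Definition elittleo (a : nat -> \bar R) (b : nat -> R) : Prop :=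
  forall c : R, 0 < c -> \forall n \near \oo, (a n <= (c * b n)%:E)%E.

End Kernel.

Section PathSpace.
Variable R : realType.

Definition C01 := continuousType (subspace `[0 : R, 1]) R.

HB.instance Definition _ := Choice.on C01.
HB.instance Definition _ :=
  isPointed.Build C01 (cst (0 : R) : continuousType (subspace `[0 : R, 1]) R).

Definition cylinder : set (set C01) :=
  [set B | exists x : R, exists A : set R,
    [/\ x \in `[0, 1], measurable A & B = [set g : C01 | A (g x)]]].

(* The sigma-algebra generated by the evaluations at the points of [0, 1],
   that is, the Borel sigma-algebra of the supremum norm. *)
Definition path_space := g_sigma_algebraType cylinder.

(* normal_prob takes a standard deviation and is not a Dirac mass when it is
   0. *)
Definition gauss_law (m v : R) (A : set R) : \bar R :=
  if 0 < v then normal_prob m (Num.sqrt v) A else \d_m A.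

Definition is_GP_law (Q : set path_space -> \bar R)
    (m : R -> R) (V : R -> R -> R) : Prop :=
  forall (N : nat) (t a : 'I_N -> R), (forall i, t i \in `[0, 1]) ->
  forall A : set R, measurable A ->
    Q [set g : path_space | A (\sum_(i < N) a i * (g : C01) (t i))] =
    gauss_law (\sum_(i < N) a i * m (t i))
      (\sum_(i < N) \sum_(j < N) a i * a j * V (t i) (t j)) A.

End PathSpace.

Section Posterior.
Context {R : realType}.
Variables (K : R -> R -> R) (sigma lambda : R) (k n : nat).
Variable D : n.-tuple (R * R).

Definition dataX (i : 'I_n) : R := (tnth D i).1.
Definition dataY : 'cV[R]_n := \col_i (tnth D i).2.

Definition gram_reg : 'M[R]_n :=
  \matrix_(i, j) K (dataX i) (dataX j) + (n%:R * lambda)%:M.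

Definition K_k0 (x : R) : 'rV[R]_n := \row_i kderiv k 0 K x (dataX i).
Definition K_0k (x' : R) : 'cV[R]_n := \col_i kderiv 0 k K (dataX i) x'.

Definition post_mean (x : R) : R :=
  (K_k0 x *m invmx gram_reg *m dataY) ord0 ord0.

Definition post_cov (x x' : R) : R :=
  sigma ^+ 2 / (n%:R * lambda) *
  (kderiv k k K x x' - (K_k0 x *m invmx gram_reg *m K_0k x') ord0 ord0).

End Posterior.

Section Model.
Context {R : realType}.

Definition mutually_independent d d' (T : measurableType d)
    (T' : measurableType d') (P : probability T R) (I : finType)
    (Z : I -> {RV P >-> T'}) : Prop :=
  forall (J : {set I}) (A : I -> set T'), (forall i, measurable (A i)) ->
    P (\bigcap_(i in [set i | i \in J]) (Z i @^-1` A i)) =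
    (\prod_(i in J) P (Z i @^-1` A i))%E.

(* Joint independence of all the covariates and all the errors amounts to
   independence of the pairs (X_i, e_i) together with independence of X_i and
   e_i for each i; together with the marginal laws it makes the observations
   (X_i, f0 X_i + e_i) i.i.d. *)
Record regression_design (PX : probability R R) (sigma : R) (n : nat)
    d (T : measurableType d) (P : probability T R)
    (X e : 'I_n -> {RV P >-> R}) : Prop := {
  design_in01 : forall i w, X i w \in `[0, 1];
  design_law : forall i (A : set R), measurable A ->
    distribution P (X i) A = PX A;
  noise_law : forall i (A : set R), measurable A ->
    distribution P (e i) A = normal_prob 0 sigma A;
  design_noise_indep : mutually_independent
    (fun j : 'I_n + 'I_n => match j with inl i => X i | inr i => e i end) }.

Definition sample (f0 : R -> R) (n : nat) (T : Type)
    (X e : 'I_n -> T -> R) (w : T) : n.-tuple (R * R) :=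
  [tuple (X i w, f0 (X i w) + e i w) | i < n].

End Model.

(* Main.v *)
Require Import Defs.
From HB Require Import structures.
From mathcomp Require Import all_boot all_order all_algebra.
From mathcomp Require Import all_classical all_reals all_analysis.
From mathcomp Require Import measurable_realfun ring lra.
Set Implicit Arguments.
Unset Strict Implicit.
Unset Printing Implicit Defensive.
Import Order.TTheory GRing.Theory Num.Theory.
Import numFieldNormedType.Exports.
Local Open Scope classical_set_scope.
Local Open Scope ring_scope.

(** The posterior of the k-th derivative is a Gaussian process whose mean is,
with probability tending to one, within [C * eps n] of the k-th derivative of
the truth.  It remains to bound the fluctuations of the process around its own
mean, uniformly over the interval, by a multiple of [M n * eps n].  These
fluctuations are governed by the posterior covariance, a function of the
design points alone.

Variance.  Number the eigenvalues from 1, and let a linear functional send the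
k-th derivative of the i-th eigenfunction to u_i.  In the eigenbasis its
posterior variance is a multiple of the residual of a regularised least
squares problem.  With the population second moments of the eigenfunctions,
which form the identity matrix, in place of the empirical ones, it would be
sigma^2 / n times the sum of the mu_i / (lambda + mu_i) u_i^2.  The
replacement costs a factor 2 as soon as the two matrices differ by at most 1/2
in the Hilbert-Schmidt norm regularised by lambda ([ridge_bound],
[post_cov_bound]).  The expected squared difference is at most the fourth
power of kappa_tilde over n, which tends to 0, so by Markov's inequality the
event is likely ([gap_exceeds_le]).

On that event, evaluation at a point has variance of order
kappa_tilde_k^2 / n, that is eps^2 / log n; and, because the k-th derivatives
of the eigenfunctions are Lipschitz with constants L i^(k+1), the increment
between x and y has variance of order kappa_hat_(k+1)^2 / n |x - y|^2, that is
|x - y|^2.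

Supremum.  A union bound handles the points of a dyadic grid of polynomially
many points: the logarithm in the pointwise variance turns the Gaussian tail
into an arbitrarily high power of 1 / n when M is large.  The grid being
that fine, chaining along the finer dyadic levels costs only O(1/n), both in
distance and in probability ([GP_sup_tail], [GP_contraction]).

Expanding the covariance needs the Mercer series differentiated k times in
each argument.  First, the eigenfunctions inherit the smoothness of the
kernel: every finite functional D satisfies
mu_i (D phi_i)^2 <= (D tensor D) K ([mercer_le]), so the divided differences of
phi_i oscillate no more than those of K ([eigenfunction_smooth]).  Second, the
finiteness of kappa_hat_(k+1) makes the mu_i i^(2k+2) summable, which allows
termwise differentiation ([nderiv01_series]).  All this is done at interior
points, where the relative derivative is the ordinary one; the end points are
reached by continuity of the paths and, for the mean square norm, are null.

Finally the event that the mean is accurate must be measurable, for its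
complement to be negligible.  The mean at a point is the median of a
probability kernel, hence measurable in the data ([measurable_GP_mean]), and
continuity in the point turns this into measurability of the norms
([measurable_norm01_le]). *)

(** * Derivatives at interior points *)
Section InteriorDerivative.
Variable R : realType.
Implicit Types (f g : R -> R) (x y : R).

Lemma nbhs_Ioo01 x : x \in `]0, 1[ -> nbhs x `]0, 1[%classic.
Proof. by move=> x01; apply: open_nbhs_nbhs; split=> //; exact: interval_open. Qed.

Lemma dnbhs_within01 x : x \in `]0, 1[ -> within `[0, 1] x^' = x^'.
Proof.
move=> x01; apply/seteqP; split=> A.
- rewrite /within /dnbhs /= => H.
  have N := nbhs_Ioo01 x01; apply: filterS2 N H => y y01 Hy yx; apply: Hy => //.
  exact: subset_itv_oo_cc y01.
- by rewrite /within /dnbhs /= => H; apply: filterS H => y Hy _; exact: Hy.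
Qed.

Lemma is_derive_diff_quotient f x l :
  is_derive x 1 f l <-> diff_quotient f x @ x^' --> l.
Proof.
have E : (fun h : R => h^-1 *: ((f \o shift x) (h *: 1) - f x)) =
         (fun h => diff_quotient f x (h + x)).
  by apply/funext => h /=; rewrite /diff_quotient /= addrK mulrC scaler1.
have S (F : R -> R) : F @ x^' = (fun h => F (h + x)) @ (0 : R)^'.
  apply/seteqP; split => A; rewrite /fmap /dnbhs /within /=.
  - move=> /nbhs_ballP[e e0 He]; apply/nbhs_ballP; exists e => // h.
    rewrite /ball /= sub0r normrN => he h0; apply: He; last first.
      by rewrite -subr_eq0 addrK.
    by rewrite /ball /= opprD addrCA subrr addr0 normrN.
  - move=> /nbhs_ballP[e e0 He]; apply/nbhs_ballP; exists e => // y.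
    rewrite /ball /= => he yx; have := He (y - x); rewrite /= subrK; apply.
      by rewrite /ball /= sub0r opprB.
    by rewrite subr_eq0.
split.
- move=> [+ <-]; rewrite /derivable /derive E S.
  exact.
- rewrite S -E => H; split; first exact: (cvgP l).
  exact: cvg_lim.
Qed.

Lemma derivable01_is_derive f x : x \in `]0, 1[ -> derivable01 f x ->
  is_derive x 1 f (deriv01 f x).
Proof.
move=> x01; rewrite /derivable01 /deriv01 (dnbhs_within01 x01) => H.
exact/is_derive_diff_quotient.
Qed.

End InteriorDerivative.

(** * Iterated finite differences *)
Section FiniteDifference.
Variable R : realType.
Implicit Types (s : seq (R * R)) (hs : seq R) (f : R -> R) (x h : R).

(** A finite linear functional f |-> sum of weight * f(node), kept as the list
of its (weight, node) pairs so that it can also be applied to either argument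
of a kernel. *)
Definition app s f : R := \sum_(p <- s) p.1 * f p.2.

Definition scale (c : R) s : seq (R * R) := [seq (c * p.1, p.2) | p <- s].

(** The iterated forward difference with steps [hs].  The steps may differ: one
of them is to stay fixed while the others shrink. *)
Fixpoint fdiff hs x : seq (R * R) :=
  if hs is h :: hs' then fdiff hs' (x + h) ++ scale (- 1) (fdiff hs' x)
  else [:: (1, x)].

Definition width hs : R := \sum_(h <- hs) h.
Definition volume hs : R := \prod_(h <- hs) h.

Definition inside hs x : Prop :=
  [/\ 0 < x, {in hs, forall h, 0 < h} & x + width hs < 1].

Lemma app_cat s s' f : app (s ++ s') f = app s f + app s' f.
Proof. by rewrite /app big_cat. Qed.

Lemma app_scale c s f : app (scale c s) f = c * app s f.
Proof.
by rewrite /app /scale big_map mulr_sumr; apply: eq_bigr => p _; rewrite mulrA.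
Qed.

Lemma app_fdiff_nil x f : app (fdiff [::] x) f = f x.
Proof. by rewrite /app /= big_seq1 mul1r. Qed.

Lemma app_fdiff_cons h hs x f :
  app (fdiff (h :: hs) x) f = app (fdiff hs (x + h)) f - app (fdiff hs x) f.
Proof. by rewrite /= app_cat app_scale mulN1r. Qed.

Lemma width_cons h hs : width (h :: hs) = h + width hs.
Proof. by rewrite /width big_cons. Qed.

Lemma volume_cons h hs : volume (h :: hs) = h * volume hs.
Proof. by rewrite /volume big_cons. Qed.

Lemma width_ge0 hs : {in hs, forall h, 0 < h} -> 0 <= width hs.
Proof.
by move=> H; rewrite /width big_seq; apply: sumr_ge0 => h /H /ltW.
Qed.

Lemma volume_gt0 hs : {in hs, forall h, 0 < h} -> 0 < volume hs.
Proof.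
by move=> H; rewrite /volume big_seq; apply: prodr_gt0 => h /H.
Qed.

Lemma width_nseq n h : width (nseq n h) = n%:R * h.
Proof. by rewrite /width big_nseq iter_addr_0 mulr_natl. Qed.

Lemma inside_cons h hs x : inside (h :: hs) x ->
  [/\ 0 < h, inside hs x, inside hs (x + h) & {in hs, forall h, 0 < h}].
Proof.
move=> [x0 hs0]; rewrite width_cons => x1.
have h0 : 0 < h by apply: hs0; rewrite inE eqxx.
have hs'0 : {in hs, forall h, 0 < h}.
  by move=> h' h'hs; apply: hs0; rewrite inE h'hs orbT.
split => //; split => //; first by lra.
- by rewrite addr_gt0.
- by lra.
Qed.

Lemma fdiff_nodes hs x p : inside hs x -> p \in fdiff hs x ->
  x <= p.2 <= x + width hs.
Proof.
elim: hs x p => [|h hs IH] x p.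
  by move=> _; rewrite /= inE => /eqP -> /=; rewrite /width big_nil addr0 lexx.
move=> /inside_cons[h0 i1 i2 hs0]; rewrite width_cons /= mem_cat => /orP[].
  by move=> /(IH _ _ i2) /andP[a b]; apply/andP; split; lra.
move=> /mapP[q /(IH _ _ i1) /andP[a b] ->] /=.
by have := width_ge0 hs0 => w; apply/andP; split; lra.
Qed.

Lemma fdiff_nodes01 hs x p : inside hs x -> p \in fdiff hs x ->
  p.2 \in `]0, 1[.
Proof.
move=> xi /(fdiff_nodes xi) /andP[a b].
by case: xi => x0 _ x1; rewrite in_itv /=; apply/andP; split; lra.
Qed.

Lemma is_derive_fdiff f g hs x :
  (forall y : R, y \in `]0, 1[ -> is_derive y 1 f (g y)) ->
  inside hs x ->
  is_derive x 1 (fun y => app (fdiff hs y) f) (app (fdiff hs x) g).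
Proof.
move=> fg; elim: hs x => [|h hs IH] x.
  move=> [x0 _]; rewrite /width big_nil addr0 => x1.
  rewrite app_fdiff_nil.
  have -> : (fun y => app (fdiff [::] y) f) = f.
    by apply/funext => y; rewrite app_fdiff_nil.
  by apply: fg; rewrite in_itv /= x0.
move=> /inside_cons[h0 i1 i2 hs0]; rewrite app_fdiff_cons.
have -> : (fun y => app (fdiff (h :: hs) y) f) =
   (fun y => app (fdiff hs y) f) \o (fun y => y + h) - (fun y => app (fdiff hs y) f).
  by apply/funext => y; rewrite app_fdiff_cons.
have D1 := IH _ i1; have D2 := IH _ i2.
apply: is_deriveB.
have -> : app (fdiff hs (x + h)) g = app (fdiff hs (x + h)) g *: (1 + 0) :> R.
  by rewrite addr0 /GRing.scale /= mulr1.
exact: is_derive1_comp.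
Qed.

(** The functions [F 0], [F 1], ... stand for the successive derivatives of
[F 0]; taking them as data lets the sections of a kernel and their
combinations be treated like a single function. *)
Definition chain (k : nat) (F : nat -> R -> R) : Prop :=
  forall j, (j < k)%N -> forall x : R, x \in `]0, 1[ -> is_derive x 1 (F j) (F j.+1 x).

(** Taking a difference commutes with differentiation, so the ordinary mean
value theorem removes one step at a time. *)
Lemma fdiff_mvt hs x F : inside hs x -> chain (size hs) F ->
  exists2 xi, x <= xi <= x + width hs &
    app (fdiff hs x) (F 0%N) = volume hs * F (size hs) xi.
Proof.
elim: hs x F => [|h hs IH] x F.
  exists x; first by rewrite /width big_nil addr0 lexx.
  by rewrite app_fdiff_nil /volume big_nil mul1r.
move=> /inside_cons[h0 i1 i2 hs0] FC.
have D y : y \in `[x, x + h] -> inside hs y.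
  rewrite in_itv /= => /andP[xy yh]; case: i1 => ? _ _; case: i2 => ? _ ?.
  by split => //; lra.
have G y : y \in `[x, x + h] -> is_derive y 1 (fun y => app (fdiff hs y) (F 0%N))
   (app (fdiff hs y) (F 1%N)).
  by move=> /D; apply: is_derive_fdiff => z; exact: FC.
have xh : x <= x + h by lra.
have G1 y : y \in `]x, x + h[ -> is_derive y 1 (fun y => app (fdiff hs y) (F 0%N))
   (app (fdiff hs y) (F 1%N)).
  by move=> yi; apply: G; exact: subset_itv_oo_cc yi.
have G2 : {within `[x, x + h], continuous (fun y => app (fdiff hs y) (F 0%N))}.
  apply: derivable_within_continuous => y yi.
  exact: (@ex_derive _ _ _ _ _ _ _ (G _ yi)).
have [c cxh E] := MVT_segment xh G1 G2.
have [] := IH c (fun j => F j.+1); first exact: D.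
  by move=> j jk; exact: FC.
move=> xi /andP[ci xic] E2; exists xi.
  move: cxh; rewrite in_itv /= => /andP[a b]; rewrite width_cons.
  by apply/andP; split; lra.
rewrite app_fdiff_cons E E2 volume_cons /=; ring.
Qed.

Lemma chain_app s k (G : R -> nat -> R -> R) :
  (forall p, p \in s -> chain k (G p.2)) ->
  chain k (fun j y => app s (fun t => G t j y)).
Proof.
elim: s => [|p s IH] H j jk x x01.
  rewrite /app big_nil.
  have -> : (fun y => \sum_(q <- [::]) q.1 * G q.2 j y) = cst 0.
    by apply/funext => y; rewrite big_nil.
  exact: is_derive_cst.
rewrite /app big_cons.
have -> : (fun y => \sum_(q <- p :: s) q.1 * G q.2 j y) =
   (p.1 *: (G p.2 j : R -> R)) + (fun y => \sum_(q <- s) q.1 * G q.2 j y).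
  by apply/funext => y; rewrite big_cons.
have D1 : is_derive x 1 (G p.2 j) (G p.2 j.+1 x).
  by apply: H; rewrite // inE eqxx.
have D2 := IH (fun q qs => H q (mem_behead (s := p :: s) qs)) j jk x x01.
exact: is_deriveD.
Qed.

Lemma cvg_sumr (I : eqType) (r : seq I) (F : I -> nat -> R) (l : I -> R) :
  (forall i, i \in r -> F i @ \oo --> l i) ->
  (fun N => \sum_(i <- r) F i N) @ \oo --> \sum_(i <- r) l i.
Proof.
elim: r => [|i r IH] H.
  have -> : (fun N => \sum_(j <- [::]) F j N) = cst 0.
    by apply/funext => N; rewrite big_nil.
  by rewrite big_nil; exact: cvg_cst.
have -> : (fun N => \sum_(j <- i :: r) F j N) =
    (F i) + (fun N => \sum_(j <- r) F j N).
  by apply/funext => N; rewrite big_cons.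
rewrite big_cons; apply: cvgD; first by apply: H; rewrite inE eqxx.
by apply: IH => j jr; apply: H; rewrite inE jr orbT.
Qed.

Lemma cvg_app s (F : nat -> R -> R) f :
  (forall p, p \in s -> F ^~ p.2 @ \oo --> f p.2) ->
  (fun N => app s (F N)) @ \oo --> app s f.
Proof.
move=> H; apply: cvg_sumr => p ps; apply: cvgM; first exact: cvg_cst.
exact: H.
Qed.

Lemma app_sum (I : Type) (r : seq I) s (F : I -> R -> R) (c : I -> R) :
  app s (fun x => \sum_(i <- r) c i * F i x) = \sum_(i <- r) c i * app s (F i).
Proof.
rewrite /app; under eq_bigr do rewrite mulr_sumr.
rewrite exchange_big; apply: eq_bigr => i _; rewrite mulr_sumr.
by apply: eq_bigr => p _; rewrite mulrCA.
Qed.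

End FiniteDifference.

(** * Differentiability from divided differences *)
Section Smoothness.
Variable R : realType.
Implicit Types (f : R -> R) (hs : seq R) (x y h e : R).

(** Restricting to the open interval makes the relative derivative two-sided
and keeps all the nodes of a small finite difference in the domain. *)
Definition smooth_inside (k : nat) f : Prop :=
  forall j, (j < k)%N -> forall x, x \in `]0, 1[ -> derivable01 (nderiv01 j f) x.

Definition ddiff hs x f : R := (volume hs)^-1 * app (fdiff hs x) f.

Definition slope f y h : R := (f (y + h) - f y) / h.

Lemma smooth_chain k f : smooth_inside k f -> chain k (fun j => nderiv01 j f).
Proof. by move=> H j jk x x01; apply: derivable01_is_derive => //; exact: H. Qed.

Lemma ddiff_mvt k f hs x : smooth_inside k f -> size hs = k -> inside hs x ->
  exists2 xi, x <= xi <= x + width hs & ddiff hs x f = nderiv01 k f xi.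
Proof.
move=> /smooth_chain sf hk xi; subst k; have v0 : 0 < volume hs.
  by case: (xi) => _ h0 _; exact: volume_gt0.
have [z zi E] := fdiff_mvt xi sf.
by exists z => //; rewrite /ddiff E mulrA mulVf ?mul1r // gt_eqF.
Qed.

Lemma ddiff_cons h hs x f :
  ddiff (h :: hs) x f = (ddiff hs (x + h) f - ddiff hs x f) / h.
Proof.
by rewrite /ddiff app_fdiff_cons volume_cons invfM -mulrBr [RHS]mulrC mulrA.
Qed.

Lemma inside_nseq j x d : x \in `]0, 1[ -> 0 < d ->
  exists2 d', 0 < d' & forall h, 0 < h -> h < d' ->
    inside (nseq j h) x /\ width (nseq j h) < d.
Proof.
rewrite in_itv /= => /andP[x0 x1] d0.
have j0 : 0 < j.+1%:R :> R by [].
have m0 : 0 < Num.min d (1 - x) by rewrite lt_min d0 subr_gt0.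
exists (Num.min d (1 - x) / j.+1%:R); first by rewrite divr_gt0.
move=> h h0; rewrite ltr_pdivlMr // => hd.
have W : width (nseq j h) < Num.min d (1 - x).
  rewrite width_nseq; apply: le_lt_trans hd.
  by rewrite mulrC ler_pM2l // ler_nat.
move: W; rewrite lt_min => /andP[Wd W1]; split => //.
split => //; first by move=> h' /nseqP[-> _].
lra.
Qed.

Lemma continuous_dist f x e : 0 < e -> {for x, continuous f} ->
  exists2 d, 0 < d & forall y, `|y - x| < d -> `|f y - f x| <= e.
Proof.
move=> e0 /cvgrPdist_le /(_ e e0) /nbhs_ballP[d d0 H]; exists d => // y yd.
by have := H y; rewrite /ball /= !(distrC x) !(distrC (f x)); exact.
Qed.

Lemma ddiff_lim j f x e : 0 < e -> x \in `]0, 1[ -> smooth_inside j f ->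
  {for x, continuous (nderiv01 j f)} ->
  exists2 d, 0 < d & forall h, 0 < h -> h < d ->
    inside (nseq j h) x /\ `|ddiff (nseq j h) x f - nderiv01 j f x| <= e.
Proof.
move=> e0 x01 sf /(continuous_dist e0)[d d0 H].
have [d' d'0 H'] := inside_nseq j x01 d0.
exists d' => // h h0 hd'; have [xi w] := H' _ h0 hd'; split => //.
have [z /andP[z1 z2] ->] := ddiff_mvt sf (size_nseq j h) xi.
by apply: H; rewrite ger0_norm; lra.
Qed.

(** One step [h] is kept and the other [j] steps shrink: the divided difference
of order [j.+1] then becomes a difference quotient of the [j]-th
derivative. *)
Lemma ddiff_slope_lim j f y h e : 0 < e -> 0 < h -> 0 < y -> y + h < 1 ->
  smooth_inside j f ->
  (forall x, x \in `]0, 1[ -> {for x, continuous (nderiv01 j f)}) ->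
  exists2 d, 0 < d & forall t, 0 < t -> t < d ->
    inside (h :: nseq j t) y /\
    `|ddiff (h :: nseq j t) y f - slope (nderiv01 j f) y h| <= e.
Proof.
move=> e0 h0 y0 yh1 sf cf.
have y01 : y \in `]0, 1[ by rewrite in_itv /= y0; lra.
have yh01 : y + h \in `]0, 1[ by rewrite in_itv /= yh1; lra.
have eh0 : 0 < e * h / 2 by rewrite divr_gt0 // mulr_gt0.
have [d1 d10 H1] := ddiff_lim eh0 y01 sf (cf _ y01).
have [d2 d20 H2] := ddiff_lim eh0 yh01 sf (cf _ yh01).
exists (Num.min d1 d2); first by rewrite lt_min d10.
move=> t t0; rewrite lt_min => /andP[td1 td2].
have [i1 {}H1] := H1 _ t0 td1; have [i2 {}H2] := H2 _ t0 td2.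
split.
  case: i1 => _ ht _; case: i2 => _ _ w; split => //.
    by move=> h'; rewrite inE => /orP[/eqP->//|/ht].
  by rewrite width_cons addrA.
rewrite ddiff_cons /slope -mulrBl normrM [`|h^-1|]gtr0_norm ?invr_gt0 //.
rewrite ler_pdivrMr // (_ : _ - _ = (ddiff (nseq j t) (y + h) f - nderiv01 j f (y + h))
   - (ddiff (nseq j t) y f - nderiv01 j f y)); last by ring.
apply: le_trans (ler_normB _ _) _; lra.
Qed.

Lemma slope_lim f x e : 0 < e -> x \in `]0, 1[ -> derivable01 f x ->
  exists2 d, 0 < d & forall h, 0 < h -> h < d ->
    x + h < 1 /\ `|slope f x h - deriv01 f x| <= e.
Proof.
move=> e0 x01 fx.
have := derivable01_is_derive x01 fx.
move=> /is_derive_diff_quotient /cvgrPdist_le /(_ _ e0).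
rewrite /dnbhs /within /= => /nbhs_ballP[d d0 H].
move: x01; rewrite in_itv /= => /andP[x0 x1].
exists (Num.min d (1 - x)); first by rewrite lt_min d0 subr_gt0.
move=> h h0; rewrite lt_min => /andP[hd h1]; split; first by lra.
have := H (x + h); rewrite /ball /= opprD addrA subrr sub0r normrN gtr0_norm //.
move=> /(_ hd); rewrite /diff_quotient /slope addrAC subrr add0r distrC; apply.
by rewrite -subr_eq0 addrAC subrr add0r gt_eqF.
Qed.

(** Divided differences of order [j] taken near a common point nearly agree,
whatever their steps.  For a function this amounts to having a continuous
[j]-th derivative inside the interval, but it involves values only, which is
what an estimate through the kernel can provide. *)
Definition local_osc (j : nat) f : Prop :=
  forall x0 e, x0 \in `]0, 1[ -> 0 < e -> exists2 d, 0 < d &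
    forall x hs x' hs', size hs = j -> size hs' = j ->
      inside hs x -> inside hs' x' ->
      x0 - d < x -> x + width hs < x0 + d ->
      x0 - d < x' -> x' + width hs' < x0 + d ->
      `|ddiff hs x f - ddiff hs' x' f| <= e.

Section Step.
Variables (f : R -> R) (j : nat).
Hypothesis sf : smooth_inside j f.
Hypothesis cf : forall x, x \in `]0, 1[ -> {for x, continuous (nderiv01 j f)}.
Hypothesis oscf : local_osc j.+1 f.

Let slope_osc x0 e : x0 \in `]0, 1[ -> 0 < e -> exists2 d, 0 < d &
  forall y h y' h', 0 < h -> 0 < h' -> 0 < y -> y + h < 1 -> 0 < y' -> y' + h' < 1 ->
    x0 - d < y -> y + h < x0 + d -> x0 - d < y' -> y' + h' < x0 + d ->
    `|slope (nderiv01 j f) y h - slope (nderiv01 j f) y' h'| <= e.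
Proof.
move=> x01 e0; have [d d0 H] := oscf x01 e0; exists d => // y h y' h'.
move=> h0 h'0 y0 y1 y'0 y'1 A B C D.
apply/ler_addgt0Pr => r r0; have r20 : 0 < r / 2 by rewrite divr_gt0.
have [d1 d10 H1] := ddiff_slope_lim r20 h0 y0 y1 sf cf.
have [d2 d20 H2] := ddiff_slope_lim r20 h'0 y'0 y'1 sf cf.
have yh01 : y + h \in `]0, 1[ by rewrite in_itv /= y1; lra.
have yh'01 : y' + h' \in `]0, 1[ by rewrite in_itv /= y'1; lra.
have [|d3 d30 H3] := @inside_nseq j (y + h) (x0 + d - (y + h)) yh01; first by lra.
have [|d4 d40 H4] := @inside_nseq j (y' + h') (x0 + d - (y' + h')) yh'01; first by lra.
pose m := Num.min (Num.min d1 d2) (Num.min d3 d4).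
have m0 : 0 < m by rewrite !lt_min d10 d20 d30 d40.
have t0 : 0 < m / 2 by rewrite divr_gt0.
have : m / 2 < m by rewrite ltr_pdivrMr // ltr_pMr // ltr1n.
rewrite {2}/m !lt_min => /andP[/andP[t1 t2] /andP[t3 t4]].
have [i1 {}H1] := H1 _ t0 t1; have [i2 {}H2] := H2 _ t0 t2.
have [_ {}H3] := H3 _ t0 t3; have [_ {}H4] := H4 _ t0 t4.
have := H _ _ _ _ _ _ i1 i2 A _ C _; rewrite !width_cons /= !size_nseq.
move=> /(_ erefl erefl) HH.
have {}HH : `|ddiff (h :: nseq j (m / 2)) y f - ddiff (h' :: nseq j (m / 2)) y' f| <= e.
  by apply: HH; lra.
move: H1 H2 HH; rewrite !ler_norml => /andP[? ?] /andP[? ?] /andP[? ?].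
by apply/andP; split; lra.
Qed.

Let diff_quotient_slope F x y : y != x ->
  diff_quotient F x y = if x < y then slope F x (y - x) else slope F y (x - y).
Proof.
move=> yx; rewrite /diff_quotient /slope; case: ifPn => _.
  by rewrite [x + _]addrC subrK.
rewrite (_ : y + (x - y) = x); last by ring.
by rewrite -[y - x]opprB invrN mulrN -mulNr opprB.
Qed.

(** By [slope_osc] the difference quotients of the [j]-th derivative form a
Cauchy family. *)
Lemma derivable_step x : x \in `]0, 1[ -> derivable01 (nderiv01 j f) x.
Proof.
move=> x01; rewrite /derivable01 (dnbhs_within01 x01).
apply/cauchy_cvgP/cauchy_exP => e e0.
have e20 : 0 < e / 2 by rewrite divr_gt0.
have [d d0 H] := slope_osc x01 e20.
move: (x01); rewrite in_itv /= => /andP[x0 x1].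
pose d' := Num.min d (Num.min x (1 - x)).
have d'0 : 0 < d' by rewrite !lt_min d0 x0 subr_gt0.
have [dd1 dd2 dd3] : [/\ d' <= d, d' <= x & d' <= 1 - x].
  by split; rewrite /d' !ge_min lexx ?orbT.
exists (slope (nderiv01 j f) x (d' / 2)).
rewrite /fmap /dnbhs /within /=; apply/nbhs_ballP; exists d' => // y.
rewrite /ball /= => yd yx; rewrite (diff_quotient_slope _ yx).
move: yd; rewrite ltr_distl => /andP[y1 y2].
have dh : d' / 2 < d' by rewrite ltr_pdivrMr // ltr_pMr // ltr1n.
have dh0 : 0 < d' / 2 by rewrite divr_gt0.
apply: (@le_lt_trans _ _ (e / 2)); last by rewrite ltr_pdivrMr // ltr_pMr // ltr1n.
by case: ltgtP yx => // xy _; apply: H; lra.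
Qed.

Lemma continuous_step x : x \in `]0, 1[ -> {for x, continuous (nderiv01 j.+1 f)}.
Proof.
move=> x01; apply/cvgrPdist_le => e e0.
have [d d0 H] := slope_osc x01 e0.
have N : nbhs x `]x - d, x + d[%classic.
  apply/nbhs_ballP; exists d => // y; rewrite /ball /= ltr_distl => /andP[a b].
  by rewrite in_itv /=; apply/andP; split; lra.
apply: filterS2 N (nbhs_Ioo01 x01) => y; rewrite /= in_itv /= => /andP[yd1 yd2] y01.
apply/ler_addgt0Pr => r r0; have r20 : 0 < r / 2 by rewrite divr_gt0.
have [d1 d10 H1] := slope_lim r20 x01 (derivable_step x01).
have [d2 d20 H2] := slope_lim r20 y01 (derivable_step y01).
pose m := Num.min (Num.min d1 d2) (Num.min d (x + d - y)).
have m0 : 0 < m by rewrite !lt_min d10 d20 d0 subr_gt0.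
have t0 : 0 < m / 2 by rewrite divr_gt0.
have : m / 2 < m by rewrite ltr_pdivrMr // ltr_pMr // ltr1n.
rewrite {2}/m !lt_min => /andP[/andP[t1 t2] /andP[t3 t4]].
have [i1 {}H1] := H1 _ t0 t1; have [i2 {}H2] := H2 _ t0 t2.
have HH : `|slope (nderiv01 j f) x (m / 2) - slope (nderiv01 j f) y (m / 2)| <= e.
  move: x01 y01; rewrite !in_itv /= => /andP[? ?] /andP[? ?].
  by apply: H; lra.
move: H1 H2 HH; rewrite !ler_norml => /andP[? ?] /andP[? ?] /andP[? ?].
by rewrite /nderiv01 /=; apply/andP; split; lra.
Qed.

End Step.

Lemma smooth_of_local_osc k f :
  (forall x, x \in `]0, 1[ -> {for x, continuous f}) ->
  (forall j, (0 < j <= k)%N -> local_osc j f) ->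
  smooth_inside k f /\
  forall x, x \in `]0, 1[ -> {for x, continuous (nderiv01 k f)}.
Proof.
move=> cf; elim: k => [|k IH] H; first by split.
have [s c] : smooth_inside k f /\
  forall x, x \in `]0, 1[ -> {for x, continuous (nderiv01 k f)}.
  by apply: IH => j /andP[j0 jk]; apply: H; rewrite j0 leqW.
have o : local_osc k.+1 f by apply: H; rewrite /= leqnn.
split; last exact: continuous_step.
move=> j; rewrite ltnS leq_eqVlt => /orP[/eqP ->|/s //].
exact: derivable_step.
Qed.

End Smoothness.

(** * Smoothness of eigenfunctions and termwise differentiation *)
Section MercerSmooth.
Variable R : realType.
Implicit Types (f : R -> R) (s : seq (R * R)) (hs : seq R) (x y h e : R).

Definition dnodes hs x := scale (volume hs)^-1 (fdiff hs x).

Lemma ddiffE hs x f : ddiff hs x f = app (dnodes hs x) f.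
Proof. by rewrite /dnodes app_scale. Qed.

Lemma dnodes01 hs x p : inside hs x -> p \in dnodes hs x -> p.2 \in `]0, 1[.
Proof. by move=> xi /mapP[q /(fdiff_nodes01 xi) ? ->]. Qed.

Lemma app_swap s s' (G : R -> R -> R) :
  app s (fun x => app s' (G x)) = app s' (fun y => app s (G ^~ y)).
Proof.
rewrite /app; under eq_bigr do rewrite mulr_sumr.
rewrite exchange_big; apply: eq_bigr => q _; rewrite mulr_sumr.
by apply: eq_bigr => p _; rewrite mulrCA.
Qed.

Lemma oo_cc01 x : x \in `]0, 1[ -> x \in `[0, 1].
Proof. exact: subset_itv_oo_cc. Qed.

Section Kernel.
Variables (K : R -> R -> R) (k : nat).
Hypothesis K_C2k : kernel_C2k k K.

(** The mean value theorem for differences is applied first in the second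
argument, to the combination of sections given by the first difference, and
then in the first argument. *)
Lemma kernel_ddiff j hs x hs' x' : (j <= k)%N -> size hs = j -> size hs' = j ->
  inside hs x -> inside hs' x' ->
  exists xi xi', [/\ x <= xi <= x + width hs, x' <= xi' <= x' + width hs' &
    ddiff hs x (fun u => ddiff hs' x' (K u)) = kderiv j j K xi xi'].
Proof.
move=> jk sj sj' ix ix'; have [K1 K2 _] := K_C2k jk.
have C : chain (size hs')
    (fun i y => app (dnodes hs x) (fun u => nderiv01 i (K u) y)).
  apply: chain_app => p ps i; rewrite sj' => ij y y01.
  apply: derivable01_is_derive => //; apply: K1 => //; last exact: oo_cc01.
  exact: oo_cc01 (dnodes01 ix ps).
have [xi' xi'r E] := fdiff_mvt ix' C.
have sm : smooth_inside j (fun u => nderiv01 j (K u) xi').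
  move=> i ij y y01; apply: K2 => //; first exact: oo_cc01.
  case: ix' => x'0 hs0 x'1; move: xi'r => /andP[? ?].
  by rewrite in_itv /=; apply/andP; split; lra.
have [xi xir E2] := ddiff_mvt sm sj ix.
exists xi, xi'; split=> //.
rewrite /kderiv -E2 (ddiffE hs x).
rewrite (_ : (fun u => _) = (fun u => app (dnodes hs' x') (K u))); last first.
  by apply/funext => u; rewrite ddiffE.
rewrite app_swap -ddiffE /ddiff E sj'.
rewrite mulrA mulVf ?mul1r ?app_scale //.
by rewrite gt_eqF //; case: ix' => _ ? _; exact: volume_gt0.
Qed.

End Kernel.

Section Mercer.
Variables (PX : probability R R) (K : R -> R -> R).
Variables (mu : nat -> R) (phi : nat -> R -> R).
Hypothesis mercer : mercer_decomposition PX K mu phi.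

Lemma mercer_app2 s s' : (forall p, p \in s -> p.2 \in `[0, 1]) ->
  (forall p, p \in s' -> p.2 \in `[0, 1]) ->
  (fun N => \sum_(i < N) mu i * (app s (phi i) * app s' (phi i))) @ \oo -->
    app s (fun x => app s' (K x)).
Proof.
move=> s01 s'01.
have -> : (fun N => \sum_(i < N) mu i * (app s (phi i) * app s' (phi i))) =
    (fun N => app s (fun x => app s' (fun x' => \sum_(i < N) mu i * phi i x * phi i x'))).
  apply/funext => N; under [in RHS]eq_fun do rewrite app_sum.
  rewrite (_ : (fun x => _) = (fun x => \sum_(i < N) (mu i * app s' (phi i)) * phi i x)).
    by rewrite app_sum; apply: eq_bigr => i _; rewrite -mulrA [app s _ * _]mulrC.
  by apply/funext => x; apply: eq_bigr => i _; rewrite mulrAC.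
apply: (@cvg_app _ _ (fun N x => _) (fun x => app s' (K x))) => p ps.
apply: (@cvg_app _ _ (fun N x' => _) (K p.2)) => q qs.
exact: (mercer_expansion mercer (s01 _ ps) (s'01 _ qs)).
Qed.

(** A functional applied to both arguments of the Mercer series gives a series
of nonnegative terms, and one term is at most the sum.  This is how the
regularity of the kernel passes to each eigenfunction. *)
Lemma mercer_le s i : (forall p, p \in s -> p.2 \in `[0, 1]) ->
  mu i * app s (phi i) ^+ 2 <= app s (fun x => app s (K x)).
Proof.
move=> s01; have C := mercer_app2 s01 s01.
have <- := cvg_lim (@Rhausdorff R) C.
apply: limr_ge; first exact: (cvgP _ C).
exists i.+1 => // N /= iN; rewrite (bigD1 (Ordinal iN)) //= expr2 lerDl.
apply: sumr_ge0 => l _; rewrite -expr2 mulr_ge0 ?sqr_ge0 //.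
exact/ltW/(mercer_gt0 mercer).
Qed.

Variable k : nat.
Hypothesis K_C2k : kernel_C2k k K.

Lemma kderiv_near j x0 e : (j <= k)%N -> x0 \in `]0, 1[ -> 0 < e ->
  exists2 d, 0 < d & forall y y', y \in `]0, 1[ -> y' \in `]0, 1[ ->
    `|y - x0| < d -> `|y' - x0| < d ->
    `|kderiv j j K y y' - kderiv j j K x0 x0| <= e.
Proof.
move=> jk x01 e0; have [_ _ /subspace_continuousP cK] := K_C2k jk.
have : (`[0, 1] `*` `[0, 1])%classic (x0, x0).
  by split => /=; exact: oo_cc01.
move=> /cK /cvgrPdist_le /(_ e e0) /nbhs_ballP[d d0 H]; exists d => // y y' y01 y'01.
move=> yd y'd; rewrite distrC; apply: (H (y, y')).
  by split; rewrite /ball /= distrC.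
by split => /=; exact: oo_cc01.
Qed.

(** [mercer_le] is applied to the difference of two divided differences.  On
the kernel side this gives four mixed divided differences with signs
+, -, -, +; each is close to the same value of the mixed derivative, so their
combination is small. *)
Lemma eigenfunction_osc i j : (j <= k)%N -> local_osc j (phi i).
Proof.
move=> jk x0 e x01 e0; have m0 := mercer_gt0 mercer i.
have e'0 : 0 < mu i * e ^+ 2 / 4 by rewrite divr_gt0 // mulr_gt0 // exprn_gt0.
have [d d0 H] := kderiv_near jk x01 e'0.
exists d => // x hs x' hs' sj sj' ix ix' a1 a2 b1 b2.
have N s hs1 hs2 x1 x2 : s = dnodes hs1 x1 ++ scale (- 1) (dnodes hs2 x2) ->
    inside hs1 x1 -> inside hs2 x2 -> forall p, p \in s -> p.2 \in `[0, 1].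
  move=> -> i1 i2 p; rewrite mem_cat => /orP[/(dnodes01 i1)/oo_cc01//|].
  by move=> /mapP[q /(dnodes01 i2)/oo_cc01 ? ->].
have B hs1 x1 hs2 x2 : size hs1 = j -> size hs2 = j -> inside hs1 x1 -> inside hs2 x2 ->
    x0 - d < x1 -> x1 + width hs1 < x0 + d ->
    x0 - d < x2 -> x2 + width hs2 < x0 + d ->
    `|app (dnodes hs1 x1) (fun u => app (dnodes hs2 x2) (K u)) - kderiv j j K x0 x0|
      <= mu i * e ^+ 2 / 4.
  move=> s1 s2 i1 i2 A1 A2 B1 B2.
  have [xi [xi' [/andP[? ?] /andP[? ?]]]] := kernel_ddiff K_C2k jk s1 s2 i1 i2.
  rewrite ddiffE (_ : (fun u => _) = (fun u => app (dnodes hs2 x2) (K u))); last first.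
    by apply/funext => t; rewrite ddiffE.
  move=> ->; case: i1 => ? _ ?; case: i2 => ? _ ?.
  by apply: H; rewrite ?in_itv /= ?ltr_distl; apply/andP; split; lra.
have := mercer_le i (N _ _ _ _ _ erefl ix ix').
set s := _ ++ _.
have -> : app s (phi i) = ddiff hs x (phi i) - ddiff hs' x' (phi i).
  by rewrite /s app_cat app_scale mulN1r !ddiffE.
have -> : app s (fun y => app s (K y)) =
    app (dnodes hs x) (fun y => app (dnodes hs x) (K y))
  - app (dnodes hs x) (fun y => app (dnodes hs' x') (K y))
  - app (dnodes hs' x') (fun y => app (dnodes hs x) (K y))
  + app (dnodes hs' x') (fun y => app (dnodes hs' x') (K y)).
  have E t : app t (fun y => app s (K y)) =
    app t (fun y => app (dnodes hs x) (K y)) - app t (fun y => app (dnodes hs' x') (K y)).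
    rewrite /app -sumrB; apply: eq_bigr => q _.
    by rewrite -mulrBr -/(app _ _) app_cat app_scale mulN1r.
  by rewrite {1}/s app_cat app_scale !E; ring.
have := B _ _ _ _ sj sj ix ix a1 a2 a1 a2.
have := B _ _ _ _ sj sj' ix ix' a1 a2 b1 b2.
have := B _ _ _ _ sj' sj ix' ix b1 b2 a1 a2.
have := B _ _ _ _ sj' sj' ix' ix' b1 b2 b1 b2.
rewrite !ler_norml => /andP[? ?] /andP[? ?] /andP[? ?] /andP[? ?] Q.
have {}Q : mu i * (ddiff hs x (phi i) - ddiff hs' x' (phi i)) ^+ 2 <= mu i * e ^+ 2.
  apply: le_trans Q _; lra.
rewrite -ler_norml; move: Q; rewrite ler_pM2l // -(@real_normK _ (_ - _)) ?num_real //.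
by rewrite ler_sqr // nnegrE ltW.
Qed.

Lemma continuous_inside f x : {within `[0, 1], continuous f} -> x \in `]0, 1[ ->
  {for x, continuous f}.
Proof.
move=> /subspace_continuousP /(_ x) cf x01.
have /cvgrPdist_le C := cf (oo_cc01 x01); apply/cvgrPdist_le => e e0.
have N := nbhs_Ioo01 x01; apply: filterS2 N (C _ e0) => y y01; apply; exact: oo_cc01 y01.
Qed.

Lemma eigenfunction_smooth i : smooth_inside k (phi i).
Proof.
apply: (proj1 (smooth_of_local_osc _ _)).
  by move=> x x01; exact: (continuous_inside (mercer_continuous (i:=i) mercer) x01).
by move=> j /andP[_ jk]; exact: eigenfunction_osc.
Qed.

End Mercer.

Lemma derivable01_continuous f x : x \in `]0, 1[ -> derivable01 f x ->
  {for x, continuous f}.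
Proof.
move=> x01 /(derivable01_is_derive x01) [D _].
exact/differentiable_continuous/derivable1_diffP.
Qed.

(** A divided difference is a finite functional, so it passes through the
series.  By the mean value theorem and the Lipschitz bound, replacing it by
the derivative changes the partial sums by at most 2 L B h, uniformly in
their length; and it changes the limit by little, by [slope_lim]. *)
Lemma nderiv01_series (k : nat) (phi : nat -> R -> R) (c : nat -> R) f (L B : R) :
  0 < L ->
  (forall i, smooth_inside k (phi i)) ->
  (forall i x x', x \in `]0, 1[ -> x' \in `]0, 1[ ->
    `|nderiv01 k (phi i) x - nderiv01 k (phi i) x'| <=
       L * i.+1%:R ^+ k.+1 * `|x - x'|) ->
  (forall N, \sum_(i < N) `|c i| * i.+1%:R ^+ k.+1 <= B) ->
  smooth_inside k f ->
  (forall x, x \in `]0, 1[ -> (fun N => \sum_(i < N) c i * phi i x) @ \oo --> f x) ->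
  forall x, x \in `]0, 1[ ->
    (fun N => \sum_(i < N) c i * nderiv01 k (phi i) x) @ \oo --> nderiv01 k f x.
Proof.
move=> L0 sphi lip cB sf F x x01; case: k sphi lip cB sf => [|j] sphi lip cB sf.
  exact: F.
have sfj : smooth_inside j f by move=> i ij; apply: sf; rewrite ltnW.
have cfj y : y \in `]0, 1[ -> {for y, continuous (nderiv01 j f)}.
  by move=> y01; apply: derivable01_continuous => //; exact: sf.
have B0 : 0 <= B by have := cB 0%N; rewrite big_ord0.
apply/cvgrPdist_le => e e0; have e50 : 0 < e / 5 by rewrite divr_gt0.
have [d d0 Hd] := slope_lim e50 x01 (sf _ (ltnSn j) _ x01).
(* small enough for the slope of f and for the uniform error 2 L B h *)
pose h := Num.min (d / 2) (e / 5 / (L * B + 1)).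
have LB0 : 0 < L * B + 1 by rewrite ltr_wpDl // mulr_ge0 // ltW.
have h0 : 0 < h by rewrite lt_min !divr_gt0.
have hd : h < d.
  by rewrite gt_min; apply/orP; left; rewrite ltr_pdivrMr // ltr_pMr // ltr1n.
have LBh : L * B * h <= e / 5.
  apply: (@le_trans _ _ ((L * B + 1) * h)); first by rewrite ler_pM2r // lerDl.
  by rewrite mulrC -ler_pdivlMr // ge_min lexx orbT.
have [xh1 {}Hd] := Hd _ h0 hd.
have x0 : 0 < x by move: x01; rewrite in_itv /= => /andP[].
have [d1 d10 H1] := ddiff_slope_lim e50 h0 x0 xh1 sfj cfj.
have [d2 d20 H2] := inside_nseq j x01 h0.
pose t := Num.min d1 d2 / 2.
have m0 : 0 < Num.min d1 d2 by rewrite lt_min d10.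
have t0 : 0 < t by rewrite divr_gt0.
have : t < Num.min d1 d2 by rewrite ltr_pdivrMr // ltr_pMr // ltr1n.
rewrite lt_min => /andP[t1 t2].
have [ix {}H1] := H1 _ t0 t1; have [_ w] := H2 _ t0 t2.
set hs := h :: _ in ix H1.
have sh : size hs = j.+1 by rewrite /= size_nseq.
have C : (fun N => \sum_(i < N) c i * ddiff hs x (phi i)) @ \oo --> ddiff hs x f.
  rewrite ddiffE (_ : (fun N => _) =
      (fun N => app (dnodes hs x) (fun y => \sum_(i < N) c i * phi i y))).
    apply: (@cvg_app _ _ (fun N y => _) f) => p ps; apply: F; exact: dnodes01 ix ps.
  by apply/funext => N; rewrite app_sum; apply: eq_bigr => i _; rewrite ddiffE.
move/cvgrPdist_le : C => /(_ _ e50); apply: filterS => N CN.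
have D : `|\sum_(i < N) c i * ddiff hs x (phi i) -
    \sum_(i < N) c i * nderiv01 j.+1 (phi i) x| <= 2 * (L * B * h).
  rewrite -sumrB; apply: le_trans (ler_norm_sum _ _ _) _.
  apply: (@le_trans _ _ (\sum_(i < N) (`|c i| * i.+1%:R ^+ j.+2) * (2 * L * h))).
    apply: ler_sum => i _; rewrite -mulrBr normrM -mulrA ler_wpM2l //.
    have [xi /andP[x1 x2] ->] := ddiff_mvt (sphi i) sh ix.
    have xi01 : xi \in `]0, 1[.
      by case: (ix) => ? _ ?; rewrite in_itv /=; apply/andP; split; lra.
    apply: le_trans (lip i _ _ xi01 x01) _.
    rewrite -mulrA mulrCA ler_wpM2l ?exprn_ge0 // [2 * L]mulrC -mulrA ler_pM2l //.
    by move: x2; rewrite /hs width_cons ger0_norm; lra.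
  rewrite -mulr_suml (_ : 2 * (L * B * h) = B * (2 * L * h)); last by ring.
  by rewrite ler_wpM2r // !mulr_ge0 // ltW.
move: Hd H1 CN D; rewrite !ler_norml.
rewrite (_ : deriv01 (nderiv01 j f) x = nderiv01 j.+1 f x) //.
by move=> /andP[? ?] /andP[? ?] /andP[? ?] /andP[? ?]; apply/andP; split; lra.
Qed.

End MercerSmooth.

(** * Regularised least squares on a well conditioned design *)
Section RidgeBound.
Variables (R : realType) (n : nat) (lam W : R) (mu u : nat -> R).
Variables (phix : nat -> 'I_n -> R).
Hypothesis n_gt0 : (0 < n)%N.
Hypothesis lam_gt0 : 0 < lam.
Hypothesis mu_gt0 : forall i, 0 < mu i.

Definition empirical_gap (i l : nat) : R :=
  n%:R^-1 * (\sum_(p < n) phix i p * phix l p) - (i == l)%:R.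

(** The squared Hilbert-Schmidt norm of
(S + lam)^(-1/2) (S_n - S) (S + lam)^(-1/2) compressed to the first [N]
eigenfunctions, where S is the integral operator of the kernel and S_n its
empirical version at the design points. *)
Definition hs_gap (N : nat) : R :=
  \sum_(i < N) \sum_(l < N)
     mu i / (lam + mu i) * (mu l / (lam + mu l)) * empirical_gap i l ^+ 2.

(** The empirical quadratic form is the population one plus a double sum
against [empirical_gap].  By the Cauchy-Schwarz inequality that sum is in
absolute value at most T times the square root of [hs_gap], hence at most half
of T. *)
Lemma le_half_of_hs_gap N (s : nat -> R) : hs_gap N <= 4^-1 ->
  2^-1 * (\sum_(i < N) mu i * (lam + mu i) * s i ^+ 2) <=
  lam * (\sum_(i < N) mu i * s i ^+ 2) +
  n%:R^-1 * \sum_(p < n) (\sum_(i < N) mu i * phix i p * s i) ^+ 2.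
Proof.
set T := \sum_(i < N) mu i * (lam + mu i) * s i ^+ 2 => H.
have mu0 i : 0 <= mu i by exact: ltW.
have lm0 i : 0 < lam + mu i by exact: addr_gt0.
have lm0' i : 0 <= lam + mu i by exact: ltW.
have Y0 i : 0 <= mu i * (lam + mu i) * s i ^+ 2.
  by rewrite mulr_ge0 ?sqr_ge0 // mulr_ge0.
have T0 : 0 <= T by exact: sumr_ge0.
have E : n%:R^-1 * (\sum_(p < n) (\sum_(i < N) mu i * phix i p * s i) ^+ 2) =
    \sum_(i < N) mu i ^+ 2 * s i ^+ 2 +
    \sum_(i < N) \sum_(l < N) (mu i * s i) * (mu l * s l) * empirical_gap i l.
  rewrite -big_split /=.
  transitivity (\sum_(i < N) \sum_(l < N) (mu i * s i) * (mu l * s l) *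
      (n%:R^-1 * (\sum_(p < n) phix i p * phix l p))).
    transitivity (n%:R^-1 * (\sum_(p < n) \sum_(i < N) \sum_(l < N)
        (mu i * s i) * (mu l * s l) * (phix i p * phix l p))).
      congr (_ * _); apply: eq_bigr => p _; rewrite expr2 mulr_suml.
      apply: eq_bigr => i _; rewrite mulr_sumr; apply: eq_bigr => l _; ring.
    rewrite exchange_big mulr_sumr; apply: eq_bigr => i _.
    rewrite exchange_big mulr_sumr; apply: eq_bigr => l _.
    by rewrite -mulr_sumr mulrCA.
  apply: eq_bigr => i _.
  rewrite (bigD1 i) //= [in RHS](bigD1 i) //= addrA; congr (_ + _).
    by rewrite /empirical_gap eqxx /=; ring.
  apply: eq_bigr => l li; rewrite /empirical_gap.
  rewrite (_ : (i == l :> nat) = false) ?subr0 //.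
  by apply/negbTE; rewrite eq_sym.
(* Young's inequality whose weights make both halves sum to T / 4 *)
have Z z A B : 0 < T -> 0 <= A -> 0 <= B -> z ^+ 2 = A * B -> - z <= A / (4 * T) + T * B.
  move=> Tp A0 B0 zAB.
  have m0 : 0 <= A / (4 * T) + T * B.
    by rewrite addr_ge0 // ?divr_ge0 ?mulr_ge0 // ltW.
  have : z ^+ 2 <= (A / (4 * T) + T * B) ^+ 2.
    rewrite zAB -subr_ge0 (_ : _ - _ = (A / (4 * T) - T * B) ^+ 2) ?sqr_ge0 //.
    by field; rewrite gt_eqF.
  rewrite -(@real_normK _ z) ?num_real // ler_sqr ?nnegrE // => zm.
  by apply: le_trans zm; rewrite -normrN ler_norm.
suff X : - (2^-1 * T) <=
    \sum_(i < N) \sum_(l < N) (mu i * s i) * (mu l * s l) * empirical_gap i l.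
  have D : lam * (\sum_(i < N) mu i * s i ^+ 2) + \sum_(i < N) mu i ^+ 2 * s i ^+ 2 = T.
    by rewrite mulr_sumr -big_split; apply: eq_bigr => i _ /=; ring.
  rewrite E addrA D; lra.
(* if T vanishes then so does s, and the weight 1 / T is not available *)
have [Tp|Tn] := ltP 0 T; last first.
  have T00 : T = 0 by apply/eqP; rewrite eq_le Tn.
  have s0 (i : 'I_N) : s i = 0.
    have := T00; rewrite /T => /psumr_eq0P => /(_ (fun i _ => Y0 i)) /(_ i isT) /eqP.
    by rewrite mulf_eq0 gt_eqF ?mulr_gt0 //= sqrf_eq0 => /eqP.
  rewrite T00 mulr0 oppr0 big1 // => i _; rewrite big1 // => l _.
  by rewrite s0 mulr0 !mul0r.
rewrite lerNl -sumrN.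
apply: (@le_trans _ _ (\sum_(i < N) \sum_(l < N)
   ((mu i * (lam + mu i) * s i ^+ 2) * (mu l * (lam + mu l) * s l ^+ 2) / (4 * T) +
    T * (mu i / (lam + mu i) * (mu l / (lam + mu l)) * empirical_gap i l ^+ 2)))).
  apply: ler_sum => i _; rewrite -sumrN; apply: ler_sum => l _; apply: Z => //.
  - exact: mulr_ge0.
  - by rewrite mulr_ge0 ?sqr_ge0 // mulr_ge0 // divr_ge0.
  - by field; rewrite !gt_eqF.
under eq_bigr do rewrite big_split -mulr_suml -mulr_sumr -mulr_sumr /=.
rewrite big_split -mulr_suml -mulr_suml -mulr_sumr -/T -/(hs_gap N).
apply: (@le_trans _ _ (T * T / (4 * T) + T * 4^-1)).
  by rewrite lerD2l ler_pM2l.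
rewrite invfM mulrACA divff ?gt_eqF // mulr1; lra.
Qed.

Variables (G : 'M[R]_n) (b c : 'I_n -> R) (w2 : R).
Hypothesis cvg_w2 : (fun N => \sum_(i < N) mu i * u i ^+ 2) @ \oo --> w2.
Hypothesis cvg_b : forall p,
  (fun N => \sum_(i < N) mu i * u i * phix i p) @ \oo --> b p.
Hypothesis cvg_G : forall p q,
  (fun N => \sum_(i < N) mu i * phix i p * phix i q) @ \oo --> G p q.
Hypothesis solve_c : forall p, \sum_q G p q * c q + n%:R * lam * c p = b p.
Hypothesis gap : forall N, hs_gap N <= 4^-1.
Hypothesis W_ub : forall N, \sum_(i < N) mu i / (lam + mu i) * u i ^+ 2 <= W.

(** Let s be the residual of u after regression on the design, so that the
quantity to bound is S, the sum of the mu_i s_i u_i.  The normal equations say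
that lam S equals the regularised empirical quadratic form at s, which is at
least half of the sum of the mu_i (lam + mu_i) s_i^2 by [le_half_of_hs_gap].
Young's inequality for mu_i s_i u_i with the weight lam + mu_i then gives
S <= S / 2 + lam W. *)
Lemma ridge_bound : w2 - \sum_p b p * c p <= 2 * lam * W.
Proof.
pose s i := u i - \sum_p c p * phix i p.
pose S := w2 - \sum_p b p * c p.
(* the normal equations: the residual has inner product n lam c with the design *)
have cB p : (fun N => \sum_(i < N) mu i * phix i p * s i) @ \oo -->
    n%:R * lam * c p.
  rewrite -[n%:R * lam * c p](addKr (\sum_q G p q * c q)) solve_c addrC.
  rewrite (_ : (fun N => _) = (fun N => \sum_(i < N) mu i * u i * phix i p) -
     (fun N => \sum_q (\sum_(i < N) mu i * phix i p * phix i q) * c q)).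
    apply: cvgB; first exact: cvg_b.
    apply: (@cvg_sumr _ _ _ (fun q N => _)) => q _; apply: cvgM; last exact: cvg_cst.
    exact: cvg_G.
  apply/funext => N; rewrite fctE.
  under [X in _ - X]eq_bigr do rewrite mulr_suml.
  rewrite [X in _ - X]exchange_big -sumrB; apply: eq_bigr => i _.
  rewrite /s mulrBr mulrAC; congr (_ - _); rewrite mulr_sumr; apply: eq_bigr => q _.
  ring.
have cS : (fun N => \sum_(i < N) mu i * s i * u i) @ \oo --> S.
  rewrite (_ : (fun N => _) = (fun N => \sum_(i < N) mu i * u i ^+ 2) -
     (fun N => \sum_q (\sum_(i < N) mu i * u i * phix i q) * c q)).
    apply: cvgB; first exact: cvg_w2.
    apply: (@cvg_sumr _ _ _ (fun q N => _)) => q _; apply: cvgM; last exact: cvg_cst.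
    exact: cvg_b.
  apply/funext => N; rewrite fctE.
  under [X in _ - X]eq_bigr do rewrite mulr_suml.
  rewrite [X in _ - X]exchange_big -sumrB; apply: eq_bigr => i _.
  rewrite /s mulrBr mulrBl expr2 mulrA; congr (_ - _).
  rewrite mulr_sumr mulr_suml; apply: eq_bigr => q _; ring.
have cA : (fun N => \sum_(i < N) mu i * s i ^+ 2) @ \oo -->
    S - \sum_p (n%:R * lam * c p) * c p.
  rewrite (_ : (fun N => _) = (fun N => \sum_(i < N) mu i * s i * u i) -
     (fun N => \sum_q (\sum_(i < N) mu i * phix i q * s i) * c q)).
    apply: cvgB; first exact: cS.
    apply: (@cvg_sumr _ _ _ (fun q N => _)) => q _; apply: cvgM; last exact: cvg_cst.
    exact: cB.
  apply/funext => N; rewrite fctE.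
  under [X in _ - X]eq_bigr do rewrite mulr_suml.
  rewrite [X in _ - X]exchange_big -sumrB; apply: eq_bigr => i _ /=.
  rewrite expr2 mulrA {2}/s mulrBr; congr (_ - _).
  rewrite mulr_sumr; apply: eq_bigr => q _; ring.
have n0 : n%:R != 0 :> R by rewrite pnatr_eq0 -lt0n.
pose rhs N := (2 * lam)^-1 * (lam * (\sum_(i < N) mu i * s i ^+ 2) +
  n%:R^-1 * \sum_(p < n) (\sum_(i < N) mu i * phix i p * s i) ^+ 2) + lam * W.
have cR : rhs @ \oo --> (2 * lam)^-1 * (lam * (S - \sum_p (n%:R * lam * c p) * c p) +
    n%:R^-1 * \sum_(p < n) (n%:R * lam * c p) ^+ 2) + lam * W.
  apply: cvgD; last exact: cvg_cst.
  apply: cvgM; first exact: cvg_cst.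
  apply: cvgD; first by apply: cvgM; [exact: cvg_cst|].
  apply: cvgM; first exact: cvg_cst.
  apply: (@cvg_sumr _ _ _ (fun p N => _)) => p _.
  by under eq_fun do rewrite expr2; rewrite expr2; apply: cvgM.
have E : (2 * lam)^-1 * (lam * (S - \sum_p (n%:R * lam * c p) * c p) +
    n%:R^-1 * \sum_(p < n) (n%:R * lam * c p) ^+ 2) + lam * W = S / 2 + lam * W.
  congr (_ + _).
  have -> : n%:R^-1 * (\sum_(p < n) (n%:R * lam * c p) ^+ 2) =
      lam * \sum_p (n%:R * lam * c p) * c p.
    rewrite !mulr_sumr; apply: eq_bigr => p _; field.
    exact: n0.
  by field; rewrite gt_eqF.
have SN N : \sum_(i < N) mu i * s i * u i <= rhs N.
  have := le_half_of_hs_gap s (gap N); set Q := _ + _ => HQ.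
  apply: (@le_trans _ _ ((2 * lam)^-1 *
      (2^-1 * \sum_(i < N) mu i * (lam + mu i) * s i ^+ 2) +
      lam * \sum_(i < N) mu i / (lam + mu i) * u i ^+ 2)); last first.
    rewrite /rhs -/Q lerD // ler_pM2l ?invr_gt0 ?mulr_gt0 //.
  rewrite !mulr_sumr -big_split /=; apply: ler_sum => i _.
  have l0 : lam != 0 by rewrite gt_eqF.
  have lm0 : 0 < lam + mu i by rewrite addr_gt0.
  have lm1 : lam + mu i != 0 by rewrite gt_eqF.
  rewrite -subr_ge0 (_ : _ - _ = mu i / (4 * lam * (lam + mu i)) *
     ((lam + mu i) * s i - 2 * lam * u i) ^+ 2); last by field; rewrite l0 lm1.
  by rewrite mulr_ge0 ?sqr_ge0 // divr_ge0 ?mulr_ge0 // ltW.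
have : S <= S / 2 + lam * W.
  by rewrite -E; apply: (ler_cvg_to cS cR); exact: nearW.
rewrite -/S; lra.
Qed.

End RidgeBound.

(** * Posterior covariance and mean in the eigenbasis *)
Section CvgBound.
Variable R : realType.

Lemma cvg_ge_bound (u : nat -> R) l a : u @ \oo --> l ->
  (\forall N \near \oo, a <= u N) -> a <= l.
Proof.
move=> cu H; rewrite -(cvg_lim (@Rhausdorff R) cu).
by apply: limr_ge => //; exact: cvgP cu.
Qed.

Lemma cvg_le_bound (u : nat -> R) l a : u @ \oo --> l ->
  (\forall N \near \oo, u N <= a) -> l <= a.
Proof.
move=> cu H; rewrite -(cvg_lim (@Rhausdorff R) cu).
by apply: limr_le => //; exact: cvgP cu.
Qed.

End CvgBound.

Section PosteriorVariance.
Variable R : realType.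

Lemma nderiv01_eq k (f g : R -> R) : (forall x, x \in `[0, 1] -> f x = g x) ->
  forall x, x \in `[0, 1] -> nderiv01 k f x = nderiv01 k g x.
Proof.
move=> fg; elim: k => [//|k IH] x x01.
rewrite /nderiv01 /= -!/(nderiv01 k _) /deriv01.
have E F G : (forall x, x \in `[0, 1] -> F x = G x) -> forall A : set R,
    (diff_quotient F x @ within `[0, 1] x^') A ->
    (diff_quotient G x @ within `[0, 1] x^') A.
  move=> FG A H; have D : within `[0, 1] x^' `[0, 1]%classic by exact: withinT.
  rewrite /fmap /=; apply: filterS2 D H => y y01.
  by rewrite /= /diff_quotient !FG.
by congr (lim _); apply/seteqP; split => A; apply: E => // y y01; rewrite IH.
Qed.

Variables (PX : probability R R) (K : R -> R -> R).
Variables (mu : nat -> R) (phi : nat -> R -> R).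
Hypothesis mercer : mercer_decomposition PX K mu phi.
Hypotheses (K_sym : symmetric_kernel K) (K_pd : positive_definite_kernel K).
Variable k : nat.
Hypothesis K_C2k : kernel_C2k k K.
Variables C L B : R.
Hypotheses (C_gt0 : 0 < C) (L_gt0 : 0 < L).
Hypothesis phi_bound : forall i x, x \in `[0, 1] ->
  `|nderiv01 k (phi i) x| <= C * i.+1%:R ^+ k.
Hypothesis phi_lipschitz : forall i x x', x \in `[0, 1] -> x' \in `[0, 1] ->
  `|nderiv01 k (phi i) x - nderiv01 k (phi i) x'| <= L * i.+1%:R ^+ k.+1 * `|x - x'|.
Hypothesis mu_summable : forall N, \sum_(i < N) mu i * i.+1%:R ^+ (2 * k.+1) <= B.

Let mu_gt0 := mercer_gt0 mercer.
Let mu_ge0 i : 0 <= mu i := ltW (mu_gt0 i).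

Let lip_inside i x x' : x \in `]0, 1[ -> x' \in `]0, 1[ ->
  `|nderiv01 k (phi i) x - nderiv01 k (phi i) x'| <= L * i.+1%:R ^+ k.+1 * `|x - x'|.
Proof. by move=> x01 x'01; apply: phi_lipschitz; exact: oo_cc01. Qed.

Lemma mercer_trace y N : y \in `[0, 1] -> \sum_(i < N) mu i * phi i y ^+ 2 <= K y y.
Proof.
move=> y01; apply: (cvg_ge_bound (mercer_expansion mercer y01 y01)).
exists N => // M /= NM.
rewrite -(big_mkord predT (fun i => mu i * phi i y ^+ 2)).
rewrite -(big_mkord predT (fun i => mu i * phi i y * phi i y)).
rewrite [leRHS](big_cat_nat (n := N)) //= -[leLHS]addr0.
rewrite lerD //; last by apply: sumr_ge0 => i _; rewrite -mulrA -expr2 mulr_ge0 ?sqr_ge0.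
by apply: ler_sum => i _; rewrite expr2 mulrA.
Qed.

(** Young's inequality between the trace sum, of total mass K(y, y), and the
weighted eigenvalue sum. *)
Lemma coef_summable y N : y \in `[0, 1] ->
  \sum_(i < N) `|mu i * phi i y| * i.+1%:R ^+ k.+1 <= (B + K y y) / 2.
Proof.
move=> y01; have A := mu_summable N; have D := mercer_trace N y01.
apply: (@le_trans _ _ ((\sum_(i < N) mu i * i.+1%:R ^+ (2 * k.+1) +
  \sum_(i < N) mu i * phi i y ^+ 2) / 2)); last by lra.
rewrite -big_split mulr_suml /=; apply: ler_sum => i _.
rewrite normrM (ger0_norm (mu_ge0 i)) -mulrDr -!mulrA ler_wpM2l //.
rewrite mulnC exprM -(@real_normK _ (phi i y)) ?num_real //.
set a := `|_|; set b := _ ^+ _.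
rewrite -subr_ge0 (_ : _ - _ = 2^-1 * (a - b) ^+ 2); last by field.
by rewrite mulr_ge0 ?sqr_ge0.
Qed.

Lemma kernel_section_smooth y : y \in `[0, 1] -> smooth_inside k (K y).
Proof.
move=> y01 j jk x x01; have [K1 _ _] := K_C2k (leqnn k).
by apply: K1 => //; exact: oo_cc01.
Qed.

Lemma kderiv0_series y x : y \in `[0, 1] -> x \in `]0, 1[ ->
  (fun N => \sum_(i < N) mu i * phi i y * nderiv01 k (phi i) x) @ \oo -->
    kderiv 0 k K y x.
Proof.
move=> y01 x01; rewrite /kderiv.
apply: (@nderiv01_series _ k phi (fun i => mu i * phi i y) (K y) L ((B + K y y) / 2) L_gt0
  (eigenfunction_smooth mercer K_C2k) lip_inside _ (kernel_section_smooth y01)) => //.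
  by move=> N; exact: coef_summable.
by move=> z z01; exact: (mercer_expansion mercer y01 (oo_cc01 z01)).
Qed.

Lemma kderivk0E x y : x \in `[0, 1] -> y \in `[0, 1] ->
  kderiv k 0 K x y = kderiv 0 k K y x.
Proof.
move=> x01 y01; apply: nderiv01_eq => // z z01; exact: K_sym.
Qed.

Lemma kderivkk_series x x' : x \in `]0, 1[ -> x' \in `]0, 1[ ->
  (fun N => \sum_(i < N) mu i * nderiv01 k (phi i) x' * nderiv01 k (phi i) x) @ \oo
    --> kderiv k k K x x'.
Proof.
move=> x01 x'01.
apply: (@nderiv01_series _ _ phi (fun i => mu i * nderiv01 k (phi i) x')
    (fun s => nderiv01 k (K s) x') L (C * B) L_gt0
    (eigenfunction_smooth mercer K_C2k) lip_inside) => //.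
- move=> N; apply: (@le_trans _ _ (\sum_(i < N) C * (mu i * i.+1%:R ^+ (2 * k.+1)))).
    apply: ler_sum => i _; rewrite normrM (ger0_norm (mu_ge0 i)).
    rewrite mulrCA -mulrA ler_wpM2l //.
    apply: (@le_trans _ _ (C * i.+1%:R ^+ k * i.+1%:R ^+ k.+1)).
      by rewrite ler_wpM2r ?exprn_ge0 //; apply: phi_bound; exact: oo_cc01.
    rewrite -mulrA -exprD ler_pM2l // ler_weXn2l ?ler1n //.
    by rewrite mul2n -addnn leq_add2r.
  by rewrite -mulr_sumr ler_pM2l.
- move=> j jk z z01; have [_ K2 _] := K_C2k (leqnn k).
  by apply: K2 => //; exact: oo_cc01.
- move=> z z01; have := kderiv0_series (oo_cc01 z01) x'01.
  rewrite (_ : (fun N => _) =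
    (fun N => \sum_(i < N) mu i * nderiv01 k (phi i) x' * phi i z)) //.
  by apply/funext => N; apply: eq_bigr => i _; rewrite mulrAC.
Qed.

Section Data.
Variables (n : nat) (D : n.-tuple (R * R)) (lam sigma : R).
Hypotheses (n_gt0 : (0 < n)%N) (lam_gt0 : 0 < lam).
Hypothesis D01 : forall i : 'I_n, dataX D i \in `[0, 1].

Lemma gram_reg_unit : gram_reg K lam D \in unitmx.
Proof.
have nl : 0 < n%:R * lam by rewrite mulr_gt0 // ltr0n.
rewrite -row_free_unit -kermx_eq0; apply/rowV0P => v /sub_kermxP vA.
(* the quadratic form of a kernel vector v is at least n lam |v|^2 *)
have Q : 0 = \sum_(i < n) \sum_(j < n) v 0 i * v 0 j * K (dataX D i) (dataX D j) +
    n%:R * lam * \sum_(i < n) v 0 i ^+ 2.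
  have Z : (v *m gram_reg K lam D *m v^T) 0 0 = 0 by rewrite vA mul0mx mxE.
  apply: etrans (esym Z) _.
  rewrite /gram_reg mulmxDr mulmxDl mxE; congr (_ + _).
    rewrite mxE exchange_big; apply: eq_bigr => j _.
    rewrite !mxE mulr_suml; apply: eq_bigr => i _.
    by rewrite !mxE; ring.
  rewrite mul_mx_scalar -scalemxAl mxE; congr (_ * _); rewrite mxE.
  by apply: eq_bigr => i _; rewrite !mxE expr2.
have P := @K_pd n (dataX D) (v 0) D01.
have S0 : 0 <= \sum_(i < n) v 0 i ^+ 2 by apply: sumr_ge0 => i _; exact: sqr_ge0.
have S00 : \sum_(i < n) v 0 i ^+ 2 = 0.
  apply/eqP; rewrite eq_le S0 andbT -(pmulr_rle0 _ nl); lra.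
apply/rowP => i; rewrite mxE; apply/eqP; rewrite -sqrf_eq0.
by move/psumr_eq0P : S00 => -> // j _; exact: sqr_ge0.
Qed.

(** [ridge_bound] for the functional with weights [a] and nodes [t]: its squared
prior norm, its covariances with the observations and the Gram matrix are the
three Mercer series to which that lemma applies, and the posterior covariance
is its left-hand side times sigma^2 / (n lam). *)
Lemma post_cov_bound (N : nat) (t a : 'I_N -> R) (W : R) :
  (forall i, t i \in `]0, 1[) ->
  (forall M, hs_gap lam mu (fun i p => phi i (dataX D p)) M <= 4^-1) ->
  (forall M, \sum_(i < M) mu i / (lam + mu i) *
     (\sum_(j < N) a j * nderiv01 k (phi i) (t j)) ^+ 2 <= W) ->
  \sum_(i < N) \sum_(j < N) a i * a j * post_cov K sigma lam k D (t i) (t j) <=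
    2 * sigma ^+ 2 / n%:R * W.
Proof.
move=> t01 gap HW.
pose u i := \sum_(j < N) a j * nderiv01 k (phi i) (t j).
pose b p := \sum_(j < N) a j * kderiv 0 k K (dataX D p) (t j).
pose bm : 'cV[R]_n := \col_p b p.
pose c p := (invmx (gram_reg K lam D) *m bm) p 0.
pose w2 := \sum_(i < N) \sum_(j < N) a i * a j * kderiv k k K (t i) (t j).
have cw2 : (fun M => \sum_(i < M) mu i * u i ^+ 2) @ \oo --> w2.
  rewrite (_ : (fun M => _) = (fun M => \sum_(i < N) \sum_(j < N) a i * a j *
     \sum_(l < M) mu l * nderiv01 k (phi l) (t j) * nderiv01 k (phi l) (t i))).
    apply: (@cvg_sumr _ _ _ (fun i M => _)) => i _.
    apply: (@cvg_sumr _ _ _ (fun j M => _)) => j _.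
    by apply: cvgM; [exact: cvg_cst|exact: kderivkk_series].
  apply/funext => M.
  under [RHS]eq_bigr do under eq_bigr do rewrite mulr_sumr.
  under [RHS]eq_bigr do rewrite exchange_big.
  rewrite [RHS]exchange_big; apply: eq_bigr => l _ /=.
  rewrite expr2 mulr_suml mulr_sumr; apply: eq_bigr => i _.
  rewrite /u !mulr_sumr; apply: eq_bigr => j _; ring.
have cb p : (fun M => \sum_(i < M) mu i * u i * phi i (dataX D p)) @ \oo --> b p.
  rewrite (_ : (fun M => _) = (fun M => \sum_(j < N) a j *
     \sum_(l < M) mu l * phi l (dataX D p) * nderiv01 k (phi l) (t j))).
    apply: (@cvg_sumr _ _ _ (fun i M => _)) => i _.
    by apply: cvgM; [exact: cvg_cst|exact: kderiv0_series].
  apply/funext => M; under [RHS]eq_bigr do rewrite mulr_sumr.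
  rewrite exchange_big; apply: eq_bigr => l _ /=.
  rewrite mulrAC /u mulr_sumr; apply: eq_bigr => j _; ring.
have sc p : \sum_q (\matrix_(i, j) K (dataX D i) (dataX D j)) p q * c q +
    n%:R * lam * c p = b p.
  have : gram_reg K lam D *m (invmx (gram_reg K lam D) *m bm) = bm.
    by rewrite mulmxA mulmxV ?gram_reg_unit // mul1mx.
  move=> /matrixP /(_ p 0); rewrite [in RHS]mxE => <-.
  rewrite /gram_reg mulmxDl mul_scalar_mx [RHS]mxE; congr (_ + _); last by rewrite mxE.
  by rewrite mxE.
have := @ridge_bound _ n lam W mu u (fun i p => phi i (dataX D p)) n_gt0 lam_gt0 mu_gt0
  _ b c w2 cw2 cb _ sc gap HW.
have cG p q : (fun M => \sum_(i < M) mu i * phi i (dataX D p) * phi i (dataX D q)) @ \oo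
   --> (\matrix_(i, j) K (dataX D i) (dataX D j)) p q.
  by rewrite mxE; exact: (mercer_expansion mercer (D01 p) (D01 q)).
move=> /(_ cG) RB.
have -> : \sum_(i < N) \sum_(j < N) a i * a j * post_cov K sigma lam k D (t i) (t j) =
   sigma ^+ 2 / (n%:R * lam) * (w2 - \sum_p b p * c p).
  have -> : \sum_p b p * c p = \sum_(i < N) \sum_(j < N) a i * a j *
     (K_k0 K k D (t i) *m invmx (gram_reg K lam D) *m K_0k K k D (t j)) ord0 ord0.
    have -> : \sum_p b p * c p = (bm^T *m (invmx (gram_reg K lam D) *m bm)) 0 0.
      by rewrite mxE; apply: eq_bigr => p _; rewrite !mxE /c !mxE.
    have E1 : bm^T = \sum_(i < N) a i *: K_k0 K k D (t i).
      apply/rowP => p; rewrite !mxE summxE; apply: eq_bigr => i _; rewrite !mxE.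
      by rewrite kderivk0E //; exact: oo_cc01.
    have E2 : bm = \sum_(j < N) a j *: K_0k K k D (t j).
      by apply/colP => p; rewrite !mxE summxE; apply: eq_bigr => i _; rewrite !mxE.
    rewrite E1 E2 mulmxA mulmx_suml mulmx_suml summxE; apply: eq_bigr => i _.
    rewrite mulmx_sumr summxE; apply: eq_bigr => j _.
    by rewrite -scalemxAr -!scalemxAl !mxE mulrA [a j * _]mulrC.
  rewrite /w2 -sumrB mulr_sumr; apply: eq_bigr => i _.
  rewrite -sumrB mulr_sumr; apply: eq_bigr => j _.
  rewrite /post_cov; ring.
have n0 : 0 < n%:R :> R by rewrite ltr0n.
have l0 := lam_gt0.
apply: (@le_trans _ _ (sigma ^+ 2 / (n%:R * lam) * (2 * lam * W))).
  by rewrite ler_wpM2l // divr_ge0 ?sqr_ge0 // mulr_ge0 // ltW.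
rewrite le_eqVlt; apply/orP; left; apply/eqP; field.
by rewrite !gt_eqF.
Qed.

(** The posterior mean is a combination of the n differentiated kernel sections
at the data, each Lipschitz by its series.  The constant depends on the data,
but continuity is enough to read norms off the dyadic points. *)
Lemma post_mean_lipschitz : exists2 A, 0 <= A & forall x x',
  x \in `]0, 1[ -> x' \in `]0, 1[ ->
  `|post_mean K lam k D x - post_mean K lam k D x'| <= A * `|x - x'|.
Proof.
have lipK p x x' : x \in `]0, 1[ -> x' \in `]0, 1[ ->
    `|kderiv k 0 K x (dataX D p) - kderiv k 0 K x' (dataX D p)| <=
    L * ((B + K (dataX D p) (dataX D p)) / 2) * `|x - x'|.
  move=> x01 x'01; rewrite !kderivk0E //; try exact: oo_cc01.
  have cv := cvg_norm (cvgB (kderiv0_series (D01 p) x01) (kderiv0_series (D01 p) x'01)).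
  apply: (cvg_le_bound (cv _ _)); apply: nearW => N; rewrite !fctE -sumrB.
  apply: le_trans (ler_norm_sum _ _ _) _.
  apply: (@le_trans _ _ (\sum_(i < N) (`|mu i * phi i (dataX D p)| * i.+1%:R ^+ k.+1) *
     (L * `|x - x'|))).
    apply: ler_sum => i _; rewrite -mulrBr normrM -mulrA ler_wpM2l //.
    by apply: le_trans (lip_inside _ x01 x'01) _; rewrite mulrCA mulrA.
  rewrite -mulr_suml mulrAC [leRHS]mulrC ler_wpM2r //.
    by rewrite mulr_ge0 // ltW.
  exact: coef_summable.
pose v := invmx (gram_reg K lam D) *m dataY D.
exists (\sum_p L * ((B + K (dataX D p) (dataX D p)) / 2) * `|v p 0|).
  apply: sumr_ge0 => p _; rewrite mulr_ge0 // mulr_ge0 //; first exact: ltW.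
  by apply: le_trans (coef_summable 0 (D01 p)); rewrite big_ord0.
move=> x x' x01 x'01; rewrite /post_mean -!mulmxA -/v !mxE -sumrB.
apply: le_trans (ler_norm_sum _ _ _) _; rewrite mulr_suml; apply: ler_sum => p _.
rewrite !mxE -mulrBl normrM mulrAC ler_wpM2r //; exact: lipK.
Qed.

End Data.

End PosteriorVariance.

(** * Gaussian tails *)
Section GaussianTail.
Variable R : realType.

Lemma measurable_dist_gt (c u : R) : measurable [set y : R | u < `|y - c|].
Proof.
rewrite (_ : [set _ | _] = (fun y => `|y - c|) @^-1` `]u, +oo[%classic); last first.
  by apply/seteqP; split => y /=; rewrite in_itv /= andbT.
rewrite -[X in measurable X]setTI; apply: measurableT_comp => //.
by apply: measurable_funD.
Qed.

Lemma expRN_le_inv (y : R) : 0 < y -> expR (- y) <= y^-1.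
Proof.
move=> y0; rewrite expRN lef_pV2 ?posrE ?expR_gt0 //.
by apply: le_trans (expR_ge1Dx y); rewrite lerDr.
Qed.

(** Away from the mean the density is dominated by an exponentially small
multiple of the density with twice the standard deviation, whose integral is
at most 1.  This gives the tail without computing any integral. *)
Lemma normal_pdf_widen (m s u x : R) : 0 < s -> 0 <= u -> u < `|x - m| ->
  normal_pdf m s x <= 2 * expR (- (3 * u ^+ 2 / (8 * s ^+ 2))) * normal_pdf m (2 * s) x.
Proof.
move=> s0 u0 ux; have s20 : 0 < 2 * s by rewrite mulr_gt0.
rewrite !normal_pdfE ?gt_eqF // /normal_peak /normal_fun.
have -> : Num.sqrt ((2 * s) ^+ 2 * pi *+ 2) = 2 * Num.sqrt (s ^+ 2 * pi *+ 2).
  rewrite exprMn -!mulrnAr -mulrA sqrtrM ?sqr_ge0 // sqrtr_sqr ger0_norm //.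
set q := Num.sqrt _.
have q0 : 0 < q.
  by rewrite sqrtr_gt0 -mulr_natr !mulr_gt0 ?exprn_gt0 ?pi_gt0.
have E (a b : R) : 2 * a * ((2 * q)^-1 * b) = q^-1 * (a * b).
  by field; rewrite gt_eqF.
rewrite E {E}.
rewrite ler_pM2l ?invr_gt0 // -expRD ler_expR.
have ux2 : u ^+ 2 <= (x - m) ^+ 2.
  by rewrite -[leRHS]real_normK ?num_real // ler_sqr ?nnegrE // ltW.
rewrite -subr_ge0 (_ : _ - _ = 3 / (8 * s ^+ 2) * ((x - m) ^+ 2 - u ^+ 2)).
  by rewrite mulr_ge0 ?subr_ge0 // divr_ge0 // mulr_ge0 // sqr_ge0.
by field; rewrite gt_eqF.
Qed.

Lemma normal_tail (m s u : R) : 0 < s -> 0 <= u ->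
  (normal_prob m s [set x | (u < `|x - m|)%R] <=
    (2 * expR (- (3 * u ^+ 2 / (8 * s ^+ 2))))%:E)%E.
Proof.
move=> s0 u0; set c := 2 * _; set A := [set x | _].
have c0 : 0 <= c by rewrite mulr_ge0 ?expR_ge0.
have mA : measurable A by exact: measurable_dist_gt.
rewrite /normal_prob; apply: (@le_trans _ _
    (\int[lebesgue_measure]_(x in A) (c%:E * (normal_pdf m (2 * s) x)%:E))%E).
  apply: ge0_le_integral => //.
  - by move=> x _; rewrite lee_fin normal_pdf_ge0.
  - apply/measurable_funTS/measurable_EFinP; exact: measurable_normal_pdf.
  - apply/measurable_funTS; apply: measurable_funeM.
    apply/measurable_EFinP; exact: measurable_normal_pdf.
  - move=> x Ax; rewrite -EFinM lee_fin; exact: normal_pdf_widen.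
rewrite ge0_integralZl_EFin //; last 2 first.
- by move=> x _; rewrite lee_fin normal_pdf_ge0.
- apply/measurable_funTS/measurable_EFinP; exact: measurable_normal_pdf.
rewrite -[leRHS]mule1; apply: lee_wpmul2l; first by rewrite lee_fin.
exact: (@probability_le1 _ _ _ (normal_prob m (2 * s))).
Qed.

(** A nonpositive variance gives a Dirac mass at [m], for which the event is
empty; the bound is then uniform in [v]. *)
Lemma gauss_law_tail (m v S u : R) : 0 < S -> v <= S -> 0 <= u ->
  (gauss_law m v [set x | (u < `|x - m|)%R] <=
    (2 * expR (- (u ^+ 2 / (4 * S))))%:E)%E.
Proof.
move=> S0 vS u0; rewrite /gauss_law; case: ifPn => [v0|_].
  have sv0 : 0 < Num.sqrt v by rewrite sqrtr_gt0.
  apply: le_trans (normal_tail m sv0 u0) _.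
  rewrite lee_fin ler_pM2l // ler_expR lerN2 sqr_sqrtr ?(ltW v0) //.
  rewrite -subr_ge0 (_ : _ - _ = u ^+ 2 * (3 * S - 2 * v) / (8 * v * S)).
    by rewrite divr_ge0 ?mulr_ge0 ?sqr_ge0 ?(ltW S0) ?(ltW v0) //; lra.
  by field; rewrite !gt_eqF.
rewrite diracE memNset /=; last by rewrite subrr normr0 ltNge u0.
by rewrite lee_fin mulr_ge0 ?expR_ge0.
Qed.

End GaussianTail.

(** * Suprema of Gaussian processes by dyadic chaining *)
Section PathSup.
Variable R : realType.
Notation path := (path_space R).

Lemma measurable_eval x : x \in `[0, 1] ->
  measurable_fun [set: path] (fun g : path => (g : C01 R) x).
Proof.
move=> x01 _ A mA; rewrite setTI; apply: sub_sigma_algebra.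
by exists x, A; split.
Qed.

Definition dyadic (l m : nat) : R := m%:R / 2 ^+ l.

Definition interior_index (l m : nat) : bool := (0 < m < 2 ^ l)%N.

Lemma dyadic_inside l m : interior_index l m -> dyadic l m \in `]0, 1[.
Proof.
move=> /andP[m0 ml]; rewrite in_itv /= /dyadic divr_gt0 ?ltr0n ?exprn_gt0 //=.
by rewrite ltr_pdivrMr ?exprn_gt0 // mul1r -natrX ltr_nat.
Qed.

Lemma dyadic_double l m : dyadic l.+1 m.*2 = dyadic l m.
Proof.
rewrite /dyadic -muln2 natrM exprS; field.
by rewrite expf_neq0.
Qed.

(** A point of level l that is not already of level l - 1 has two neighbours of
level l - 1; the left one is used unless it is the end point 0, where nothing
is controlled, and then the right one is used. *)
Lemma dyadic_chain (Z : R -> R) (u : R) (r : nat -> R) (l0 : nat) : (0 < l0)%N ->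
  (forall l, 0 <= r l) ->
  (forall m, interior_index l0 m -> `|Z (dyadic l0 m)| <= u) ->
  (forall l m, (l0 < l)%N -> interior_index l m -> interior_index l m.+1 ->
     `|Z (dyadic l m) - Z (dyadic l m.+1)| <= r l) ->
  forall j m, interior_index (l0 + j) m ->
    `|Z (dyadic (l0 + j) m)| <= u + \sum_(i < j) r (l0 + i.+1)%N.
Proof.
move=> l00 r0 H0 H; elim => [|j IH] m; first by rewrite addn0 big_ord0 addr0; exact: H0.
rewrite addnS => im; rewrite big_ord_recr /= addrA.
have [[m' Em']|[m' Em']] : (exists m', m = m'.*2) \/ (exists m', m = m'.*2.+1).
  have := odd_double_half m; case: (odd m) => /= E; [right|left]; exists m./2.
    by rewrite -[LHS]E add1n.
  by rewrite -[LHS]E add0n.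
- rewrite Em' dyadic_double; apply: le_trans (IH _ _) _; last by rewrite lerDl.
  move: im; rewrite Em' /interior_index double_gt0 expnS mul2n ltn_double.
  done.
- have [m'0|m'0] := posnP m'; last first.
    have i1 : interior_index (l0 + j) m'.
      move: im; rewrite Em' /interior_index /= expnS mul2n m'0 => im.
      by rewrite -ltn_double; apply: ltn_trans im.
    have i2 : interior_index (l0 + j).+1 m'.*2.
      move: i1 => /andP[a b]; rewrite /interior_index double_gt0 a expnS mul2n.
      by rewrite ltn_double.
    have A := IH _ i1; rewrite -dyadic_double in A.
    have D := H (l0 + j).+1 m'.*2 (leq_addr j l0) i2; rewrite -Em' in D.
    have {}D := D im; rewrite -addnS in D A *.
    apply: le_trans (_ : _ <= `|Z (dyadic (l0 + j.+1) m'.*2)| +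
      `|Z (dyadic (l0 + j.+1) m'.*2) - Z (dyadic (l0 + j.+1) m)|) _; last exact: lerD.
    by rewrite -[X in `|X| <= _](subKr (Z (dyadic (l0 + j.+1) m'.*2))) ler_normB.
  have m1 : m = 1%N by rewrite Em' m'0.
  have p2 : (1 < 2 ^ (l0 + j))%N.
    by rewrite -{1}(expn0 2) ltn_exp2l // addn_gt0 l00.
  have i1 : interior_index (l0 + j) 1 by rewrite /interior_index p2.
  have i2 : interior_index (l0 + j).+1 2.
    by rewrite /interior_index /= expnS -[X in (X < _)%N]muln1 ltn_pmul2l.
  have A := IH _ i1; rewrite -dyadic_double in A.
  have D := H (l0 + j).+1 1%N (leq_addr j l0) ; rewrite m1 in im *.
  have {}D := D im i2; rewrite -addnS in D A *.
  apply: le_trans (_ : _ <= `|Z (dyadic (l0 + j.+1) 2)| +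
      `|Z (dyadic (l0 + j.+1) 1) - Z (dyadic (l0 + j.+1) 2)|) _; last exact: lerD.
  by rewrite -[X in `|X| <= _](subrK (Z (dyadic (l0 + j.+1) 2))) addrC ler_normD.
Qed.

Lemma geometric_sum_le (q : R) (l j : nat) : 0 <= q -> q < 1 ->
  \sum_(i < j) q ^+ (l + i.+1) <= q ^+ l * (q / (1 - q)).
Proof.
move=> q0 q1; have q1' : 0 < 1 - q by rewrite subr_gt0.
rewrite (eq_bigr (fun i : 'I_j => q ^+ l * (q * q ^+ i))); last first.
  by move=> i _; rewrite exprD exprS.
rewrite -mulr_sumr -mulr_sumr ler_wpM2l ?exprn_ge0 // ler_wpM2l //.
rewrite -[leRHS]mul1r ler_pdivlMr // mulrC -opprB mulNr -subrX1 opprB.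
by rewrite lerBlDr lerDl exprn_ge0.
Qed.

Variables (Q : {measure set path -> \bar R}) (m : R -> R) (V : R -> R -> R).
Hypothesis GP : is_GP_law Q m V.

Lemma GP_point_tail x S u : x \in `[0, 1] -> 0 < S -> V x x <= S -> 0 <= u ->
  (Q [set g : path | (u < `|(g : C01 R) x - m x|)%R] <=
     (2 * expR (- (u ^+ 2 / (4 * S))))%:E)%E.
Proof.
move=> x01 S0 VS u0.
have mA := measurable_dist_gt (m x) u.
have := @GP 1 (fun=> x) (fun=> 1) (fun=> x01) _ mA.
rewrite (_ : [set g | _] = [set g : path | u < `|(g : C01 R) x - m x|]); last first.
  by apply/seteqP; split => g /=; rewrite big_ord1 mul1r.
move=> ->; rewrite !big_ord1 !mul1r; exact: gauss_law_tail.
Qed.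

Lemma GP_increment_tail x y S u : x \in `[0, 1] -> y \in `[0, 1] -> 0 < S ->
  V x x - V x y - V y x + V y y <= S -> 0 <= u ->
  (Q [set g : path | (u < `|((g : C01 R) x - m x) - ((g : C01 R) y - m y)|)%R] <=
     (2 * expR (- (u ^+ 2 / (4 * S))))%:E)%E.
Proof.
move=> x01 y01 S0 VS u0.
pose t (i : 'I_2) := if i == 0 then x else y.
pose a (i : 'I_2) : R := if i == 0 then 1 else -1.
have t01 i : t i \in `[0, 1] by rewrite /t; case: ifP.
have mA := measurable_dist_gt (m x - m y) u.
have E (b c d e : R) : b - c - (d - e) = b - d - (c - e) by ring.
have := @GP 2 t a t01 _ mA.
rewrite (_ : [set g | _] = [set g : path |
    u < `|((g : C01 R) x - m x) - ((g : C01 R) y - m y)|]); last first.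
  apply/seteqP; split => g /=;
    rewrite !big_ord_recl big_ord0 /a /t /= !mul1r !mulN1r addr0.
    by rewrite E.
  by rewrite E.
have -> : \sum_(i < 2) a i * m (t i) = m x - m y.
  by rewrite !big_ord_recl big_ord0 /a /t /=; ring.
have -> : \sum_(i < 2) \sum_(j < 2) a i * a j * V (t i) (t j) =
    V x x - V x y - V y x + V y y.
  by rewrite !big_ord_recl !big_ord0 /a /t /=; ring.
by move=> ->; exact: gauss_law_tail.
Qed.

Variables S0 S1 : R.
Hypotheses (S0_gt0 : 0 < S0) (S1_gt0 : 0 < S1).
Hypothesis V_point : forall x, x \in `]0, 1[ -> V x x <= S0.
Hypothesis V_increment : forall x y, x \in `]0, 1[ -> y \in `]0, 1[ ->
  V x x - V x y - V y x + V y y <= S1 * (x - y) ^+ 2.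

Let Z (g : path) (x : R) := (g : C01 R) x - m x.

Let point_event (u : R) l i : set path :=
  if interior_index l i then [set g | u < `|Z g (dyadic l i)|] else set0.

Let increment_event l i : set path :=
  if interior_index l i && interior_index l i.+1
  then [set g | (3 / 4) ^+ l < `|Z g (dyadic l i) - Z g (dyadic l i.+1)|] else set0.

Let measurable_Z x : x \in `]0, 1[ -> measurable_fun [set: path] (Z ^~ x).
Proof.
move=> /oo_cc01 x01; apply: measurable_funB; last exact: measurable_cst.
exact: measurable_eval.
Qed.

Let measurable_point_event u l i : measurable (point_event u l i).
Proof.
rewrite /point_event; case: ifPn => // li.
have := measurable_Z (dyadic_inside li) measurableT (measurable_dist_gt 0 u).
by rewrite setTI /preimage /=; under eq_set do rewrite subr0.
Qed.

Let measurable_increment_event l i : measurable (increment_event l i).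
Proof.
rewrite /increment_event; case: ifPn => // /andP[li li'].
have := measurable_funB (measurable_Z (dyadic_inside li)) (measurable_Z (dyadic_inside li')).
move=> /(_ measurableT _ (measurable_dist_gt 0 ((3 / 4) ^+ l))).
by rewrite setTI /preimage /=; under eq_set do rewrite subr0.
Qed.

Let point_event_le u l i : 0 <= u ->
  (Q (point_event u l i) <= (2 * expR (- (u ^+ 2 / (4 * S0))))%:E)%E.
Proof.
move=> u0; rewrite /point_event; case: ifPn => [/dyadic_inside li|_].
  by apply: GP_point_tail => //; [exact: oo_cc01|exact: V_point].
by rewrite measure0 lee_fin mulr_ge0 ?expR_ge0.
Qed.

Let increment_event_le l i :
  (Q (increment_event l i) <= (8 * S1 * (4 / 9) ^+ l)%:E)%E.
Proof.
rewrite /increment_event.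
case: ifPn => [/andP[/dyadic_inside li /dyadic_inside li']|_]; last first.
  by rewrite measure0 lee_fin !mulr_ge0 ?exprn_ge0 ?divr_ge0 // ltW.
have p4 : 0 < 4^-1 ^+ l :> R by rewrite exprn_gt0 ?invr_gt0.
have S : 0 < S1 * 4^-1 ^+ l by rewrite mulr_gt0.
have r0 : 0 < (3 / 4) ^+ l :> R by rewrite exprn_gt0 ?divr_gt0.
apply: le_trans (GP_increment_tail (oo_cc01 li) (oo_cc01 li') S _ (ltW r0)) _.
  apply: le_trans (V_increment li li') _; rewrite ler_pM2l //.
  have -> : dyadic l i - dyadic l i.+1 = - (2^-1 ^+ l).
    by rewrite /dyadic -mulrBl -natr1 opprD addrA subrr add0r mulN1r exprVn.
  by rewrite sqrrN -exprM mulnC exprM (_ : 2^-1 ^+ 2 = 4^-1) //; field.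
rewrite lee_fin (mulrA 4).
have -> : ((3 / 4) ^+ l) ^+ 2 / (4 * S1 * 4^-1 ^+ l) = (9 / 4) ^+ l / (4 * S1).
  have -> : ((3 / 4 : R) ^+ l) ^+ 2 = (9 / 4) ^+ l * 4^-1 ^+ l.
    by rewrite -exprM mulnC exprM -exprMn; congr (_ ^+ l); field.
  by field; rewrite !gt_eqF.
have a0 : 0 < (9 / 4) ^+ l / (4 * S1) by rewrite divr_gt0 ?exprn_gt0 ?mulr_gt0 ?divr_gt0.
apply: (@le_trans _ _ (2 * ((9 / 4) ^+ l / (4 * S1))^-1)).
  by rewrite ler_pM2l // expRN_le_inv.
rewrite le_eqVlt; apply/orP; left; apply/eqP.
have -> : (4 / 9 : R) ^+ l = ((9 / 4) ^+ l)^-1 by rewrite -exprVn invfM invrK mulrC.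
have n0 : (9 / 4 : R) ^+ l != 0 by rewrite expf_neq0.
by field; rewrite n0 gt_eqF.
Qed.

(** An increment at level l has standard deviation of order 2^(-l) and is
compared with (3/4)^l.  There are at most 2^l of them, each exceeding with
probability at most 8 S1 (4/9)^l, so the total failure probability decreases
like (8/9)^l, while the thresholds add up to 3 (3/4)^l0. *)
Lemma GP_sup_tail l0 u A : (0 < l0)%N -> 0 <= u -> measurable A ->
  A `<=` [set g : path | exists l i, interior_index l i /\
     u + 3 * (3 / 4) ^+ l0 < `|(g : C01 R) (dyadic l i) - m (dyadic l i)|] ->
  (Q A <= (2 ^+ l0 * (2 * expR (- (u ^+ 2 / (4 * S0)))) +
           64 * S1 * (8 / 9) ^+ l0)%:E)%E.
Proof.
move=> l00 u0 mA HA.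
(* the failures: F 0 on the starting grid, F n on the level l0 + n *)
pose F n := if n is 0%N then \bigcup_(i < 2 ^ l0) point_event u l0 i
  else \bigcup_(i < 2 ^ (l0 + n)) increment_event (l0 + n) i.
have mF n : measurable (F n).
  by case: n => [|n] /=; apply: bigcup_measurable => i _.
have AF : A `<=` \bigcup_n F n.
  move=> g /HA [l [i [li]]]; apply: contraPP => gF.
  apply/negP; rewrite -leNgt.
  have N n : ~ F n g by move=> Fg; apply: gF; exists n.
  have H0 j : interior_index l0 j -> `|Z g (dyadic l0 j)| <= u.
    move=> lj; rewrite leNgt; apply/negP => lt; apply: (N 0%N).
    by exists j; [case/andP: lj|rewrite /point_event lj].
  have H1 l' j : (l0 < l')%N -> interior_index l' j -> interior_index l' j.+1 ->
     `|Z g (dyadic l' j) - Z g (dyadic l' j.+1)| <= (3 / 4) ^+ l'.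
    move=> ll lj lj'; rewrite leNgt; apply/negP => lt; apply: (N (l' - l0)%N).
    rewrite -(prednK (_ : 0 < l' - l0)%N) ?subn_gt0 //= prednK ?subn_gt0 //.
    rewrite subnKC ?(ltnW ll) //.
    by exists j; [case/andP: lj|rewrite /increment_event lj lj'].
  have C := @dyadic_chain (Z g) u (fun l => (3 / 4) ^+ l) l0 l00 _ H0 H1.
  have {}C j p : interior_index (l0 + j) p ->
      `|Z g (dyadic (l0 + j) p)| <= u + 3 * (3 / 4) ^+ l0.
    move=> jp; apply: le_trans (C _ _ _ jp) _.
      by move=> ?; rewrite exprn_ge0 ?divr_ge0.
    rewrite lerD2l; apply: le_trans (geometric_sum_le _ _ _ _) _.
      by rewrite divr_ge0.
      by rewrite ltr_pdivrMr // mul1r ltr_nat.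
    by rewrite mulrC (_ : 3 / 4 / (1 - 3 / 4) = 3) //; field.
  (* the point is also a point of the level l + l0, which is at least l0 *)
  have up j : exists2 p, interior_index (l + j) p & dyadic (l + j) p = dyadic l i.
    elim: j => [|j [p p1 p2]]; first by exists i; rewrite addn0.
    exists p.*2; last by rewrite addnS dyadic_double.
    move: p1 => /andP[a b]; rewrite /interior_index double_gt0 a addnS expnS mul2n.
    by rewrite ltn_double.
  have [p p1 <-] := up l0; rewrite addnC in p1 *; exact: C.
apply: le_trans (measure_sigma_subadditive Q mF mA AF) _.
pose b n : R := if n is 0%N then 2 ^+ l0 * (2 * expR (- (u ^+ 2 / (4 * S0))))
  else 8 * S1 * (8 / 9) ^+ (l0 + n).
have Fb n : (Q (F n) <= (b n)%:E)%E.
  have BI (E : nat -> set path) M (c : R) : (forall i, measurable (E i)) ->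
      (forall i, (Q (E i) <= c%:E)%E) -> (Q (\bigcup_(i < M) E i) <= (M%:R * c)%:E)%E.
    move=> mE Ec; rewrite bigcup_mkord; apply: le_trans (Boole_inequality Q _) _ => //.
    apply: (@le_trans _ _ (\sum_(i < M) c%:E)%E).
      by apply: lee_sum => i _; exact: Ec.
    by rewrite sumEFin lee_fin sumr_const card_ord mulr_natl.
  case: n => [|n] /=.
    by rewrite -natrX; apply: BI => // i; exact: point_event_le.
  apply: le_trans (BI _ _ _ _ (increment_event_le _)) _ => //.
  rewrite lee_fin natrX mulrCA -exprMn (_ : 2 * (4 / 9) = 8 / 9) //; by field.
have bsum n : \sum_(0 <= i < n) b i <= 2 ^+ l0 * (2 * expR (- (u ^+ 2 / (4 * S0)))) +
           64 * S1 * (8 / 9) ^+ l0.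
  have b0 i : 0 <= b i.
    by case: i => [|i] /=; rewrite !mulr_ge0 ?exprn_ge0 ?expR_ge0 ?divr_ge0 // ltW.
  apply: (@le_trans _ _ (\sum_(0 <= i < n.+1) b i)).
    by rewrite big_nat_recr //= lerDl.
  rewrite big_nat_recl //= lerD2l -mulr_sumr big_mkord.
  rewrite (_ : 64 * S1 * (8 / 9) ^+ l0 = 8 * S1 * ((8 / 9) ^+ l0 * 8)); last by ring.
  rewrite ler_pM2l ?mulr_gt0 //; apply: le_trans (geometric_sum_le _ _ _ _) _.
  - by rewrite divr_ge0.
  - by rewrite ltr_pdivrMr // mul1r ltr_nat.
  - by rewrite (_ : 8 / 9 / (1 - 8 / 9) = 8) //; field.
apply: lime_le; first by apply: is_cvg_nneseries => i _ _; exact: measure_ge0.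
apply: nearW => n; apply: (@le_trans _ _ (\sum_(0 <= i < n) (b i)%:E)%E).
  by apply: lee_sum => i _; exact: Fb.
by rewrite sumEFin lee_fin.
Qed.

End PathSup.

(** * Measurability of the posterior mean and of its error *)
Section Dyadic.
Variable R : realType.

Lemma dyadic_dense_inside (x e : R) : x \in `]0, 1[ -> 0 < e ->
  exists l m, interior_index l m /\ `|dyadic R l m - x| < e.
Proof.
rewrite in_itv /= => /andP[x0 x1] e0.
pose d := Num.min e (1 - x).
have d0 : 0 < d by rewrite lt_min e0 subr_gt0.
have [de dx] : d <= e /\ d <= 1 - x by split; rewrite /d ge_min lexx ?orbT.
pose l := (Num.truncn d^-1).+1.
have p0 : 0 < 2 ^+ l :> R by rewrite exprn_gt0.
have ld : 1 < d * 2 ^+ l.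
  rewrite -ltr_pdivrMl // mulr1; apply: lt_le_trans (truncnS_gt _) _.
  by rewrite -natrX ler_nat ltnW // ltn_expl.
have xp0 : 0 <= x * 2 ^+ l by rewrite mulr_ge0 // ltW.
have /andP[t1 t2] := truncn_itv xp0.
pose m := (Num.truncn (x * 2 ^+ l)).+1.
have m1 : m%:R <= x * 2 ^+ l + 1 by rewrite /m -natr1 lerD2r.
have mx : x < dyadic R l m by rewrite /dyadic ltr_pdivlMr.
have mx2 : dyadic R l m < x + d.
  rewrite /dyadic ltr_pdivrMr //; apply: le_lt_trans m1 _.
  by rewrite mulrDl ltrD2l.
exists l, m; split; last by rewrite gtr0_norm ?subr_gt0 //; lra.
rewrite /interior_index /= -(ltr_nat R) natrX -[X in _ < X]mul1r -ltr_pdivrMr //.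
by apply: lt_le_trans mx2 _; lra.
Qed.

Lemma dyadic_dense (x e : R) : x \in `[0, 1] -> 0 < e ->
  exists l m, interior_index l m /\ `|dyadic R l m - x| < e.
Proof.
rewrite in_itv /= => /andP[x0 x1] e0.
pose c := Num.min (e / 2) 1.
have c0 : 0 < c by rewrite lt_min divr_gt0 //=.
have [ce c1] : c <= e / 2 /\ c <= 1 by split; rewrite /c ge_min lexx ?orbT.
(* x is first moved towards 1/2, so as to leave the end points *)
pose y := x + c * (2^-1 - x).
have y01 : y \in `]0, 1[.
  rewrite /y in_itv /=; apply/andP; split.
    have -> : x + c * (2^-1 - x) = (1 - c) * x + c / 2 by ring.
    by rewrite ltr_wpDl ?mulr_ge0 ?subr_ge0 ?divr_gt0.
  rewrite -subr_gt0; have -> : 1 - (x + c * (2^-1 - x)) = (1 - c) * (1 - x) + c / 2 by field.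
  by rewrite ltr_wpDl ?mulr_ge0 ?subr_ge0 ?divr_gt0.
have e20 : 0 < e / 2 by rewrite divr_gt0.
have [l [m [lm lme]]] := dyadic_dense_inside y01 e20.
exists l, m; split => //.
have -> : dyadic R l m - x = (dyadic R l m - y) + c * (2^-1 - x) by rewrite /y; ring.
apply: le_lt_trans (ler_normD _ _) _; rewrite [e]splitr ltr_leD //.
rewrite normrM gtr0_norm //; apply: le_trans _ ce; rewrite ler_piMr ?(ltW c0) //.
by rewrite ler_norml; apply/andP; split; lra.
Qed.

Lemma inside_le_of_dyadic (f : R -> R) (B : R) :
  (forall x, x \in `]0, 1[ -> {for x, continuous f}) ->
  (forall l m, interior_index l m -> `|f (dyadic R l m)| <= B) ->
  forall x, x \in `]0, 1[ -> `|f x| <= B.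
Proof.
move=> cf H x x01; apply/ler_addgt0Pr => e e0.
have [d d0 D] := continuous_dist e0 (cf x x01).
have [l [m [lm lmd]]] := dyadic_dense_inside x01 d0.
have := D _ lmd; have := H _ _ lm; rewrite !ler_norml => /andP[? ?] /andP[? ?].
by apply/andP; split; lra.
Qed.

Lemma unit_le_of_dyadic (f : R -> R) (B : R) :
  {within `[0, 1], continuous f} ->
  (forall l m, interior_index l m -> `|f (dyadic R l m)| <= B) ->
  forall x, x \in `[0, 1] -> `|f x| <= B.
Proof.
move=> /subspace_continuousP cf H x x01; apply/ler_addgt0Pr => e e0.
have := cf x x01 => /cvgrPdist_le /(_ _ e0) /nbhs_ballP[d d0 D].
have [l [m [lm lmd]]] := dyadic_dense x01 d0.
have := D (dyadic R l m); rewrite /ball /= distrC => /(_ lmd).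
move=> /(_ (oo_cc01 (dyadic_inside R lm))).
have := H _ _ lm; rewrite /from_subspace !ler_norml => /andP[? ?] /andP[? ?].
by apply/andP; split; lra.
Qed.

End Dyadic.

Section Median.
Variable R : realType.

Let normal_fine (m s : R) A : measurable A ->
  normal_prob m s A = (fine (normal_prob m s A))%:E.
Proof. by move=> mA; rewrite fineK // fin_num_measure. Qed.

(** The reflection x |-> 2 m - x exchanges the two half-lines and preserves the
density. *)
Lemma normal_reflect (m s : R) : 0 < s ->
  normal_prob m s `]-oo, m]%classic = normal_prob m s `[m, +oo[%classic.
Proof.
move=> s0; rewrite /normal_prob.
pose F (x : R) := 2 * m - x.
have DF (x : R) : is_derive x 1 F (-1).
  rewrite (_ : F = cst (2 * m) - id) // -[-1]sub0r; exact: is_deriveB.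
have F'E : F^`()%classic = cst (-1).
  by apply/funext => x; rewrite derive1E; case: (DF x).
have Fm : F m = m by rewrite /F; ring.
have cF : continuous F.
  by move=> x; apply/differentiable_continuous/derivable1_diffP; case: (DF x).
rewrite -[X in `]-oo, X]]Fm decreasing_ge0_integration_by_substitutiony //.
- apply: eq_integral => x _; rewrite F'E !fctE /= opprK mulr1; congr EFin.
  have E : F x - m = - (x - m) by rewrite /F; ring.
  by rewrite !normal_pdfE ?gt_eqF // /normal_fun E sqrrN.
- by move=> x y _ _ xy; rewrite /F ltrD2l ltrN2.
- by move=> x _; rewrite F'E; exact: cst_continuous.
- by rewrite F'E; exact: is_cvg_cst.
- by rewrite F'E; exact: is_cvg_cst.
- split; first by move=> x _; case: (DF x).
  by apply: cvg_at_right_filter; exact: cF.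
- apply/cvgrNyPle => A; near=> x; rewrite /F lerBlDr -lerBlDl; near: x.
  by apply: nbhs_pinfty_ge; exact: num_real.
- by apply: continuous_subspaceT => x; apply: continuous_normal_pdf; rewrite gt_eqF.
- by move=> x _; exact: normal_pdf_ge0.
Unshelve. all: end_near. Qed.

Lemma normal_interval_gt0 (m s a : R) : 0 < s -> a < m ->
  (0 < normal_prob m s `]a, m]%classic)%E.
Proof.
move=> s0 am; have sn0 : s != 0 by rewrite gt_eqF.
have c0 : 0 < normal_pdf m s a.
  by rewrite normal_pdfE // mulr_gt0 ?expR_gt0 // normal_peak_gt0.
apply: (@lt_le_trans _ _ (\int[lebesgue_measure]_(x in `]a, m]) (normal_pdf m s a)%:E)%E).
  rewrite integral_cst //= lebesgue_measure_itv /= lte_fin am -EFinB -EFinM lte_fin.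
  by rewrite mulr_gt0 // subr_gt0.
apply: ge0_le_integral => //.
- by move=> x _; rewrite lee_fin ltW.
- by apply/measurable_funTS/measurable_EFinP; exact: measurable_normal_pdf.
- move=> x /=; rewrite in_itv /= => /andP[ax xm].
  rewrite lee_fin !normal_pdfE // ler_pM2l ?normal_peak_gt0 // ler_expR !mulNr lerN2.
  rewrite ler_wpM2r ?invr_ge0 ?mulrn_wge0 ?sqr_ge0 //.
  rewrite -[leLHS]sqrrN -[leRHS]sqrrN !opprB ler_sqr ?nnegrE; lra.
Qed.

Lemma normal_median (m s a : R) : 0 < s ->
  (2^-1%:E <= normal_prob m s `]-oo, a]%classic)%E = (m <= a).
Proof.
move=> s0.
have half : normal_prob m s `]-oo, m]%classic = 2^-1%:E.
  have E : normal_prob m s `[m, +oo[%classic = normal_prob m s `]m, +oo[%classic.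
    rewrite /normal_prob integral_itv_obnd_cbnd //.
    by apply/measurable_funTS/measurable_EFinP; exact: measurable_normal_pdf.
  have := probability_setT (normal_prob m s).
  rewrite -(setUv `]-oo, m]%classic) setCitvl measureU //; last first.
    by rewrite -setCitvl setICr.
  move=> H; have {}H : (normal_prob m s `]-oo, m]%classic +
      normal_prob m s `]m, +oo[%classic = 1)%E := H.
  move: H; rewrite -E -normal_reflect // normal_fine // -EFinD => -[H].
  by congr EFin; lra.
have [ma|am] := leP m a.
  by rewrite -half le_measure ?inE // => x /=; rewrite !in_itv /= => /le_trans; apply.
apply/negbTE; rewrite -ltNge -half.
have -> : `]-oo, m]%classic = `]-oo, a] `|` `]a, m] :> set R.
  by rewrite -itv_bndbnd_setU // bnd_simp ltW.
rewrite measureU //.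
  by rewrite lteDl ?normal_interval_gt0 // fin_num_measure.
apply/seteqP; split => x //= [] ; rewrite !in_itv /= => xa /andP[ax _].
by move: (lt_le_trans ax xa); rewrite ltxx.
Qed.

(** The mean of a Gaussian law, degenerate or not, is its unique median. *)
Lemma gauss_law_median (m v a : R) :
  (2^-1%:E <= gauss_law m v `]-oo, a]%classic)%E = (m <= a).
Proof.
rewrite /gauss_law; case: ifPn => [v0|_]; first by rewrite normal_median // sqrtr_gt0.
have [ma|am] := leP m a.
  by rewrite diracE mem_set /= ?in_itv //= lee_fin invf_le1 // ler1n.
have N : ~ `]-oo, a]%classic m by rewrite /= in_itv /= leNgt am.
rewrite diracE memNset //=.
by rewrite lee_fin leNgt invr_gt0 ltr0n.
Qed.

(** The set where the mean is at most a is the set where the kernel gives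
(-oo, a] mass at least 1/2, by [gauss_law_median]; a kernel is measurable in
its parameter. *)
Lemma measurable_GP_mean d d' (W : measurableType d) (T : measurableType d')
    (Pi : R.-pker T ~> path_space R) (S : W -> T) (mean var : W -> R) (x : R) :
  x \in `[0, 1] -> measurable_fun [set: W] S ->
  (forall w (A : set R), measurable A ->
    Pi (S w) [set g : path_space R | A ((g : C01 R) x)] = gauss_law (mean w) (var w) A) ->
  measurable_fun [set: W] mean.
Proof.
move=> x01 mS H; apply: (measurability _ (RGenOInfty.measurableE R)) => _ [_ [a ->] <-].
rewrite setTI (_ : _ @^-1` _ = ~` [set w | (2^-1%:E <=
    Pi (S w) [set g : path_space R | `]-oo, a]%classic ((g : C01 R) x)])%E]).
  apply: measurableC; rewrite -[X in measurable X]setTI.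
  have mA : measurable [set g : path_space R | `]-oo, a]%classic ((g : C01 R) x)].
    by rewrite -[X in measurable X]setTI; apply: (measurable_eval x01).
  apply: emeasurable_fun_c_infty => //.
  exact: (measurableT_comp (measurable_kernel Pi _ mA) mS).
have M w : (2^-1%:E <= Pi (S w) [set g : path_space R |
    `]-oo, a]%classic ((g : C01 R) x)])%E = (mean w <= a).
  by rewrite H // gauss_law_median.
apply/funext => w; apply/propext.
by rewrite /setC /mkset M /preimage /= in_itv /= andbT ltNge; split => /negP.
Qed.

End Median.

Section NormMeasurable.
Variable R : realType.

Let cell (l i : nat) : set R :=
  `[(dyadic R l i), (dyadic R l i.+1)[%classic `&` `]0, 1[%classic.

Let mid (l i : nat) : R := dyadic R l.+1 i.*2.+1.

Let mid_inside l i : (i < 2 ^ l)%N -> mid l i \in `]0, 1[.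
Proof.
move=> il; apply: dyadic_inside; rewrite /interior_index /= expnS mul2n.
by rewrite ltn_Sdouble.
Qed.

Let cell_index l x : x \in `]0, 1[ ->
  exists2 i, (i < 2 ^ l)%N & cell l i x /\ forall j, cell l j x -> j = i.
Proof.
move=> x01; move: (x01); rewrite in_itv /= => /andP[x0 x1].
have p0 : 0 < 2 ^+ l :> R by rewrite exprn_gt0.
have xp0 : 0 <= x * 2 ^+ l by rewrite mulr_ge0 // ltW.
have /andP[t1 t2] := truncn_itv xp0.
exists (Num.truncn (x * 2 ^+ l)).
  rewrite -(ltr_nat R) natrX; apply: le_lt_trans t1 _.
  by rewrite -[ltRHS]mul1r ltr_pM2r.
split.
  split; last by [].
  by rewrite /= in_itv /= /dyadic ler_pdivrMr // ltr_pdivlMr // t1.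
move=> j [/=]; rewrite in_itv /= /dyadic ler_pdivrMr // ltr_pdivlMr // => /andP[a b] _.
by apply/esym/truncn_def; rewrite a.
Qed.

Let mid_close l i x : cell l i x -> `|mid l i - x| <= 2^-1 ^+ l.
Proof.
move=> [/= + _]; rewrite in_itv /= => /andP[a b].
have E : dyadic R l i.+1 = dyadic R l i + 2^-1 ^+ l.
  by rewrite /dyadic -natr1 mulrDl mul1r exprVn.
have E2 : mid l i = dyadic R l i + 2^-1 ^+ l / 2.
  rewrite /mid /dyadic -natr1 -muln2 natrM exprS exprVn; field.
  by rewrite expf_neq0.
have p0 : 0 < 2^-1 ^+ l :> R by rewrite exprn_gt0 ?invr_gt0.
rewrite E2 ler_norml; rewrite E in b; apply/andP; split; lra.
Qed.

(** A function measurable in [t] and continuous in [x] is the limit of the step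
functions that freeze [x] at the middle of its dyadic cell.  Continuity is
known inside the interval only, so the two end points get terms of their
own. *)
Lemma measurable_caratheodory d (T : measurableType d) (F : T -> R -> R) :
  (forall t x, x \in `]0, 1[ -> {for x, continuous (F t)}) ->
  (forall x, x \in `[0, 1] -> measurable_fun [set: T] (F ^~ x)) ->
  measurable_fun [set: T * R] (fun z => (F z.1 \_ `[0, 1]) z.2).
Proof.
move=> cF mF.
(* the cells of a level partition the open interval *)
pose G l (z : T * R) := \sum_(i < 2 ^ l) F z.1 (mid l i) * \1_(cell l i) z.2 +
  F z.1 0 * \1_[set (0 : R)] z.2 + F z.1 1 * \1_[set (1 : R)] z.2.
have m0 : (0 : R) \in `[0, 1] by rewrite in_itv /= lexx ler01.
have m1 : (1 : R) \in `[0, 1] by rewrite in_itv /= lexx ler01.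
have ind1 (a b : R) : \1_[set a] b = (b == a)%:R :> R.
  rewrite indicE; congr (nat_of_bool _)%:R; apply/idP/eqP => [/set_mem //|->].
  exact: mem_set.
have mcell l i : measurable (cell l i) by exact: measurableI.
have mprod y A : y \in `[0, 1] -> measurable A ->
    measurable_fun [set: T * R] (fun z => F z.1 y * \1_A z.2).
  move=> y01 mA; apply: measurable_funM.
    exact: (measurableT_comp (mF _ y01) measurable_fst).
  have mI : measurable_fun [set: R] (\1_A : R -> R) by exact: measurable_indic.
  exact: (measurableT_comp mI measurable_snd).
apply: (@measurable_fun_cvg _ _ _ _ G) => [l|[t x] _].
  apply: measurable_funD; last exact: mprod.
  apply: measurable_funD; last exact: mprod.
  apply: measurable_sum => i; apply: mprod => //.
  by apply/oo_cc01/mid_inside.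
have [x01|x01] := boolP (x \in `]0, 1[); last first.
  have c0 l i : \1_(cell l i) x = 0 :> R.
    by rewrite indicE memNset // => -[_ /=] x01'; move: x01; rewrite x01'.
  have E l : G l (t, x) = (F t \_ `[0, 1]) x.
    rewrite /G /= big1 ?add0r; last by move=> i _; rewrite c0 mulr0.
    rewrite !ind1 patchE.
    have [x0|x0] := eqVneq x 0.
      rewrite x0.
      by rewrite mem_set //= eq_sym oner_eq0 mulr1 mulr0 addr0.
    have [x1|x1] := eqVneq x 1.
      rewrite x1.
      by rewrite mem_set //= mulr1 mulr0 add0r.
    rewrite memNset /= ?mulr0 ?addr0 // in_itv /= => /andP[a b].
    move: x01; rewrite in_itv /= => /negP; apply.
    by rewrite !lt_neqAle a b x1 eq_sym x0.
  by under eq_fun do rewrite E; exact: cvg_cst.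
have -> : (F t \_ `[0, 1]) x = F t x.
  by rewrite patchE mem_set //; exact: oo_cc01.
apply/cvgrPdist_le => e e0.
have [d0 d00 H] := continuous_dist e0 (cF t x x01).
have : \forall l \near \oo, `|(0 : R) - 2^-1 ^+ l| < d0.
  have := @cvg_expr R 2^-1; rewrite ger0_norm ?invr_ge0 // invf_lt1 // ltr1n => /(_ isT).
  by move/cvgrPdist_lt; exact.
apply: filterS => l; rewrite sub0r normrN => ld.
have [i il [ci ui]] := cell_index l x01.
have -> : G l (t, x) = F t (mid l i).
  have [x0 x1] : x != 0 /\ x != 1.
    move: x01; rewrite in_itv /= => /andP[a b].
    by rewrite gt_eqF // lt_eqF.
  rewrite /G /= !ind1 (negbTE x0) (negbTE x1) !mulr0 !addr0.
  rewrite (bigD1 (Ordinal il)) //= indicE mem_set // mulr1 big1 ?addr0 // => j ji.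
  rewrite indicE memNset ?mulr0 // => /ui jE; move/eqP: ji; apply.
  exact: val_inj.
rewrite distrC; apply: H; apply: le_lt_trans (mid_close ci) _.
by apply: le_lt_trans ld; exact: ler_norm.
Qed.

(** The supremum over (0, 1) is a supremum over dyadic points, and the square
integral is a measurable function of the parameter by Fubini's theorem. *)
Lemma measurable_norm01_le (PX : probability R R) d (T : measurableType d)
    (F : T -> R -> R) (p : \bar R) (c : R) :
  p = 2%:E \/ p = +oo%E ->
  (forall t x, x \in `]0, 1[ -> {for x, continuous (F t)}) ->
  (forall x, x \in `[0, 1] -> measurable_fun [set: T] (F ^~ x)) ->
  measurable [set t | (norm01 PX p (F t) <= c%:E)%E].
Proof.
move=> pE cF mF; case: pE => ->; rewrite /norm01 /=.
  have mJ := measurable_caratheodory cF mF.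
  rewrite -[X in measurable X]setTI; apply: emeasurable_fun_infty_c => //.
  rewrite unlock; apply: (measurableT_comp (measurable_poweR _)).
  pose J (z : T * R) : R := (F z.1 \_ `[0, 1]) z.2.
  pose h (z : T * R) : \bar R := (abse (J z)%:E `^ 2)%E.
  apply: (@measurable_fun_fubini_tonelli_F _ _ _ _ _ PX h).
    apply: (measurableT_comp (measurable_poweR _)).
    by apply/measurable_EFinP; apply: (measurableT_comp (@normr_measurable _ _) mJ).
  by move=> z; exact: poweR_ge0.
pose A x := [set t | `|F t x| <= c].
have mA x : x \in `[0, 1] -> measurable (A x).
  move=> x01; rewrite /A (_ : [set _ | _] = setT `&` [set t | (`|F t x|%:E <= c%:E)%E]).
    apply: emeasurable_fun_infty_c => //; apply/measurable_EFinP.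
    exact: (measurableT_comp (@normr_measurable _ _) (mF _ x01)).
  by rewrite setTI.
pose B l m := if interior_index l m then A (dyadic R l m) else setT.
have mB l m : measurable (B l m).
  by rewrite /B; case: ifPn => // /(dyadic_inside R) /oo_cc01 /mA.
have i0 : (0 : R) \in `[0, 1] by rewrite in_itv /= lexx ler01.
have i1 : (1 : R) \in `[0, 1] by rewrite in_itv /= lexx ler01.
rewrite (_ : [set _ | _] = A 0 `&` A 1 `&` \bigcap_l \bigcap_m B l m).
  apply: measurableI; first by apply: measurableI; exact: mA.
  by apply: bigcapT_measurable => l; exact: bigcapT_measurable.
apply/seteqP; split => t.
  move=> H; have S x : x \in `[0, 1] -> A x t.
    move=> x01; rewrite /A /= -lee_fin; apply: le_trans H.
    by apply: ereal_sup_ubound; exists x.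
  split; first by split; exact: S.
  move=> l _ m _; rewrite /B; case: ifPn => // /(dyadic_inside R) /oo_cc01; exact: S.
move=> [[A0 A1] H]; apply: ge_ereal_sup => _ [x x01 <-]; rewrite lee_fin.
move: x01; rewrite /= in_itv /= => /andP[a b].
have [->|x0] := eqVneq x 0; first exact: A0.
have [->|x1] := eqVneq x 1; first exact: A1.
apply: (inside_le_of_dyadic (cF t)); last by rewrite in_itv /= !lt_neqAle a b x1 eq_sym x0.
by move=> l m lm; have := H l I m I; rewrite /B lm.
Qed.

End NormMeasurable.

(** * Concentration of the empirical Gram matrix of the eigenfunctions *)
Section BoundedMeasurable.
Variables (R : realType).

(** These functions form an algebra and are integrable for every probability,
so the moment computations below raise no integrability question. *)
Definition bmeas d (T : measurableType d) (f : T -> R) : Prop :=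
  measurable_fun [set: T] f /\ exists M, forall x, `|f x| <= M.

Section Closure.
Context d (T : measurableType d).
Implicit Types f g : T -> R.

Lemma bmeas_cst c : bmeas (fun _ : T => c).
Proof. by split; [exact: measurable_cst|exists `|c|]. Qed.

Lemma bmeasD f g : bmeas f -> bmeas g -> bmeas (fun x => f x + g x).
Proof.
move=> [mf [M fM]] [mg [N gN]]; split; first exact: measurable_funD.
by exists (M + N) => x; apply: le_trans (ler_normD _ _) _; exact: lerD.
Qed.

Lemma bmeasM f g : bmeas f -> bmeas g -> bmeas (fun x => f x * g x).
Proof.
move=> [mf [M fM]] [mg [N gN]]; split; first exact: measurable_funM.
by exists (M * N) => x; rewrite normrM; exact: ler_pM.
Qed.

Lemma bmeas_sum I (r : seq I) (F : I -> T -> R) : (forall i, bmeas (F i)) ->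
  bmeas (fun x => \sum_(i <- r) F i x).
Proof.
move=> bF; elim: r => [|i r IH].
  by under eq_fun do rewrite big_nil; exact: bmeas_cst.
by under eq_fun do rewrite big_cons; exact: bmeasD.
Qed.

Lemma bmeas_comp d' (T' : measurableType d') (f : T' -> R) (g : T -> T') :
  bmeas f -> measurable_fun [set: T] g -> bmeas (fun x => f (g x)).
Proof.
move=> [mf [M fM]] mg; split; first exact: (measurableT_comp mf mg).
by exists M => x.
Qed.

Variable P : probability T R.

Lemma bmeas_integrable f : bmeas f -> P.-integrable [set: T] (EFin \o f).
Proof.
move=> [mf [M fM]]; apply: measurable_bounded_integrable => //.
  by rewrite (le_lt_trans (probability_le1 _ _)) // ltry.
exists M; split; first exact: num_real.
by move=> N MN x _; apply: le_trans (fM x) (ltW MN).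
Qed.

Lemma expect_cst c : \int[P]_x c = c.
Proof. by rewrite Rintegral_cst //= probability_setT mulr1. Qed.

Lemma expectZl c f : bmeas f -> \int[P]_x (c * f x) = c * \int[P]_x f x.
Proof. by move=> bf; apply: RintegralZl => //; exact: bmeas_integrable. Qed.

Lemma expect_sum I (r : seq I) (F : I -> T -> R) : (forall i, bmeas (F i)) ->
  \int[P]_x (\sum_(i <- r) F i x) = \sum_(i <- r) \int[P]_x F i x.
Proof.
move=> bF; elim: r => [|i r IH].
  by under eq_Rintegral do rewrite big_nil; rewrite big_nil expect_cst.
under eq_Rintegral do rewrite big_cons.
rewrite RintegralD // ?IH ?big_cons //; apply: bmeas_integrable => //.
exact: bmeas_sum.
Qed.

Lemma expect_markov f c : bmeas f -> (forall x, 0 <= f x) -> 0 < c ->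
  (P [set x | (c < f x)%R] <= (c^-1 * \int[P]_x f x)%:E)%E.
Proof.
move=> bf f0 c0; set A := [set x | _].
have mA : measurable A.
  rewrite /A (_ : [set _ | _] = setT `&` [set x | (c%:E < (f x)%:E)%E]).
    by apply: emeasurable_fun_o_infty => //; apply/measurable_EFinP; case: bf.
  by rewrite setTI.
rewrite -expectZl //.
have bcf : bmeas (fun x => c^-1 * f x) by apply: bmeasM => //; exact: bmeas_cst.
rewrite /Rintegral fineK; last first.
  by apply: integrable_fin_num => //; exact: bmeas_integrable.
rewrite -[A]setIT -integral_indic //; apply: ge0_le_integral => //.
- by apply/measurable_EFinP; exact: measurable_indic.
- by apply/measurable_EFinP; case: bcf.
- move=> x _; rewrite lee_fin indicE; have [Ax|nAx] := pselect (A x).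
    by rewrite mem_set // ler_pdivlMl // mulr1 ltW.
  by rewrite memNset // mulr_ge0 // invr_ge0 ltW.
Qed.

End Closure.

End BoundedMeasurable.

Section Independence.
Variables (R : realType) (PX : probability R R) (sigma : R) (n : nat).
Context d (T : measurableType d) (P : probability T R).
Variables (X e : 'I_n -> {RV P >-> R}).
Hypothesis design : regression_design PX sigma X e.

Lemma expect_design i (h : R -> R) : bmeas h ->
  \int[P]_w h (X i w) = \int[PX]_x h x.
Proof.
move=> bh; rewrite /Rintegral; congr fine.
have E : (\int[pushforward P (X i)]_x (h x)%:E = \int[P]_w (h (X i w))%:E)%E.
  rewrite integral_pushforward //.
  - by apply/measurable_EFinP; case: bh.
  - by apply: bmeas_integrable; exact: bmeas_comp.
rewrite -E; apply: eq_measure_integral => A mA _.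
exact: (design_law design i mA).
Qed.

(** Independence gives the law of the pair on rectangles, hence the product
law; Fubini's theorem concludes. *)
Lemma expect_design_mul i j (f g : R -> R) : i != j -> bmeas f -> bmeas g ->
  \int[P]_w (f (X i w) * g (X j w)) = (\int[PX]_x f x) * (\int[PX]_x g x).
Proof.
move=> ij bf bg; pose Z w := (X i w, X j w).
have mZ : measurable_fun [set: T] Z by exact: measurable_fun_pair.
have rect (A B : set R) : measurable A -> measurable B ->
    pushforward P Z (A `*` B) = (PX A * PX B)%E.
  move=> mA mB.
  pose F (c : 'I_n + 'I_n) : set R := if c == inl i then A else B.
  have mF c : measurable (F c) by rewrite /F; case: ifP.
  have := design_noise_indep design [set inl i; inl j]%SET mF.
  have ij' : (inl j == inl i :> 'I_n + 'I_n) = false.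
    by apply/negbTE; rewrite eq_sym; apply: contra ij => /eqP[->].
  rewrite big_setU1 /= ?big_set1; last by rewrite inE eq_sym ij'.
  rewrite /F eqxx ij' -(design_law design i mA) -(design_law design j mB) => <-.
  congr (P _); apply/seteqP; split => w /=.
    by move=> [Aw Bw] c /=; rewrite !inE => /orP[]/eqP -> /=; rewrite ?eqxx ?ij'.
  move=> H; have := H (inl i); have := H (inl j).
  by rewrite /= !inE !eqxx ij' orbT => /(_ isT) ? /(_ isT).
pose h (z : R * R) := f z.1 * g z.2.
have bh : bmeas h.
  by apply: bmeasM; [exact: bmeas_comp measurable_fst|exact: bmeas_comp measurable_snd].
have mh : measurable_fun [set: R * R] (EFin \o h) by apply/measurable_EFinP; case: bh.
have E : (\int[pushforward P Z]_z (h z)%:E = \int[P]_w (h (Z w))%:E)%E.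
  by rewrite integral_pushforward //; apply: bmeas_integrable; exact: bmeas_comp.
rewrite {1}/Rintegral -E.
have <- : (\int[(PX \x PX)%E]_z (h z)%:E = \int[pushforward P Z]_z (h z)%:E)%E.
  apply: eq_measure_integral => A mA _.
  exact: (@product_measure_unique _ _ _ _ _ PX PX (pushforward P Z) rect A mA).
have hi : (PX \x PX)%E.-integrable [set: R * R] (EFin \o h).
  exact: (@bmeas_integrable _ _ _ (PX \x PX)%E).
rewrite -integral12_prod_meas1 //.
have -> : (\int[PX]_x fubini_F PX (EFin \o h) x)%E =
    (\int[PX]_x ((\int[PX]_x g x) * f x)%:E)%E.
  apply: eq_integral => x _; rewrite /fubini_F /=.
  have -> : (\int[PX]_y (h (x, y))%:E = (\int[PX]_y (f x * g y))%:E)%E.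
    rewrite /Rintegral fineK //; apply: integrable_fin_num => //.
    by apply: bmeas_integrable; apply: bmeasM => //; exact: bmeas_cst.
  by rewrite expectZl // [in RHS]mulrC.
rewrite [RHS]mulrC -expectZl //.
Qed.

Lemma expect_square_sum (h : R -> R) : bmeas h -> \int[PX]_x h x = 0 ->
  \int[P]_w (\sum_(p < n) h (X p w)) ^+ 2 = n%:R * \int[PX]_x (h x ^+ 2).
Proof.
move=> bh h0.
have bX p : bmeas (fun w => h (X p w)) by exact: bmeas_comp.
transitivity (\int[P]_w \sum_(p < n) \sum_(q < n) (h (X p w) * h (X q w))).
  apply: eq_Rintegral => w _; rewrite expr2 mulr_suml; apply: eq_bigr => p _.
  by rewrite mulr_sumr.
have bXX p q : bmeas (fun w => h (X p w) * h (X q w)) by exact: bmeasM.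
rewrite expect_sum; last by move=> p; exact: bmeas_sum.
rewrite (eq_bigr (fun=> \int[PX]_x (h x ^+ 2))).
  by rewrite sumr_const card_ord mulr_natl.
move=> p _; rewrite expect_sum // (bigD1 p) //= big1 ?addr0.
  have bh2 : bmeas (fun x => h x ^+ 2).
    by under eq_fun do rewrite expr2; exact: bmeasM.
  by rewrite -(expect_design p bh2); apply: eq_Rintegral => w _; rewrite expr2.
by move=> q qp; rewrite expect_design_mul // ?h0 ?mul0r // eq_sym.
Qed.

End Independence.

Section Concentration.
Variables (R : realType) (PX : probability R R) (sigma : R) (n : nat).
Context d (T : measurableType d) (P : probability T R).
Variables (X e : 'I_n -> {RV P >-> R}).
Hypothesis design : regression_design PX sigma X e.
Variables (K : R -> R -> R) (mu : nat -> R) (phi : nat -> R -> R).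
Hypothesis mercer : mercer_decomposition PX K mu phi.
Variables (lam kap : R).
Hypotheses (n_gt0 : (0 < n)%N) (lam_gt0 : 0 < lam).
Hypothesis kap_ub : forall N x, x \in `[0, 1] ->
  \sum_(i < N) mu i / (lam + mu i) * phi i x ^+ 2 <= kap.

Let gap N w := hs_gap lam mu (fun i p => phi i (X p w)) N.

Let psi i : R -> R := phi i \_ `[0, 1].

Let alpha i : R := mu i / (lam + mu i).

Let alpha_ge0 i : 0 <= alpha i.
Proof.
by rewrite /alpha divr_ge0 ?addr_ge0 ?(ltW lam_gt0) ?(ltW (mercer_gt0 mercer i)).
Qed.

Let bmeas_psi i : bmeas (psi i).
Proof.
have ci := mercer_continuous (i := i) mercer.
split.
  apply: (measurable_restrictT (phi i) (measurable_itv `[0, 1])).1.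
  by apply: subspace_continuous_measurable_fun => //; exact: ci.
have [c c01 Hc] := EVT_max ler01 ci; have [b b01 Hb] := EVT_min ler01 ci.
exists (Num.max `|phi i c| `|phi i b|) => x; rewrite /psi patchE.
case: ifPn => [/set_mem x01|_]; last by rewrite normr0 le_max normr_ge0.
have A := Hc _ x01; have B := Hb _ x01.
rewrite le_max; have [x0|x0] := leP 0 (phi i x).
  by apply/orP; left; rewrite !ger0_norm // (le_trans x0).
apply/orP; right; rewrite !ltr0_norm ?lerN2 //; exact: le_lt_trans x0.
Qed.

Let psiE i x : x \in `[0, 1] -> psi i x = phi i x.
Proof. by move=> x01; rewrite /psi patchE mem_set. Qed.

Let h i l x := psi i x * psi l x - (i == l)%:R.

Let bmeas_h i l : bmeas (h i l).
Proof. by apply: bmeasD; [exact: bmeasM|exact: bmeas_cst]. Qed.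

Let expect_psi i l : \int[PX]_x (psi i x * psi l x) = (i == l)%:R.
Proof.
rewrite -(mercer_orthonormal mercer) [RHS]Rintegral_mkcond; apply: eq_Rintegral => x _.
by rewrite /psi !patchE; case: ifP => // _; rewrite mulr0.
Qed.

Let expect_h i l : \int[PX]_x h i l x = 0.
Proof.
rewrite /h RintegralB //; first by rewrite expect_psi expect_cst subrr.
  by apply: bmeas_integrable; exact: bmeasM.
by apply: bmeas_integrable; exact: bmeas_cst.
Qed.

Let gapE N w : gap N w = \sum_(i < N) \sum_(l < N)
  alpha i * alpha l * (n%:R^-1 ^+ 2) * (\sum_(p < n) h i l (X p w)) ^+ 2.
Proof.
rewrite /gap /hs_gap; apply: eq_bigr => i _; apply: eq_bigr => l _.
rewrite -[RHS]mulrA -exprMn; congr (_ * _ ^+ 2); rewrite /empirical_gap /h.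
rewrite sumrB sumr_const card_ord mulrBr -[X in _ = _ - _ * X]mulr_natl mulrA.
rewrite mulVf ?mul1r ?pnatr_eq0 -?lt0n //; congr (_ * _ - _).
by apply: eq_bigr => p _; rewrite !psiE //; exact: design_in01 design p w.
Qed.

Let bmeas_hX i l : bmeas (fun w => (\sum_(p < n) h i l (X p w)) ^+ 2).
Proof.
have b : bmeas (fun w => \sum_(p < n) h i l (X p w)).
  by apply: bmeas_sum => p; exact: bmeas_comp.
by under eq_fun do rewrite expr2; exact: bmeasM.
Qed.

Let bmeas_gap_term i l : bmeas (fun w =>
  alpha i * alpha l * (n%:R^-1 ^+ 2) * (\sum_(p < n) h i l (X p w)) ^+ 2).
Proof. by apply: bmeasM => //; exact: bmeas_cst. Qed.

Let bmeas_gap N : bmeas (gap N).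
Proof.
rewrite (funext (gapE N)).
by apply: bmeas_sum => i; exact: bmeas_sum.
Qed.

(** Each entry of the gap is an average of n independent centred variables, so
its second moment is at most the one of phi_i phi_l over n.  Summed with the
weights, these give the integral of the square of the sum of the
mu_i / (lam + mu_i) phi_i^2, which is at most [kap] everywhere. *)
Lemma expect_gap_le N : \int[P]_w gap N w <= kap ^+ 2 / n%:R.
Proof.
have n0 : n%:R != 0 :> R by rewrite pnatr_eq0 -lt0n.
have bpp i l : bmeas (fun x => psi i x * psi l x) by exact: bmeasM.
have bpp2 i l : bmeas (fun x => (psi i x * psi l x) ^+ 2).
  by under eq_fun do rewrite expr2; exact: bmeasM.
have -> : \int[P]_w gap N w = \int[P]_w (\sum_(i < N) \sum_(l < N)
    alpha i * alpha l * (n%:R^-1 ^+ 2) * (\sum_(p < n) h i l (X p w)) ^+ 2).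
  by apply: eq_Rintegral => w _; exact: gapE.
rewrite expect_sum; last by move=> i; exact: bmeas_sum.
rewrite (eq_bigr (fun i : 'I_N => \sum_(l < N) alpha i * alpha l * (n%:R^-1 ^+ 2) *
    (n%:R * \int[PX]_x (h i l x ^+ 2)))); last first.
  move=> i _; rewrite expect_sum //; apply: eq_bigr => l _.
  by rewrite expectZl // (expect_square_sum design).
(* the variance is at most the second moment *)
have hh i l : \int[PX]_x (h i l x ^+ 2) <= \int[PX]_x ((psi i x * psi l x) ^+ 2).
  have -> : \int[PX]_x ((psi i x * psi l x) ^+ 2) =
     \int[PX]_x (h i l x ^+ 2 + (2 * (i == l)%:R * h i l x + (i == l)%:R ^+ 2)).
    by apply: eq_Rintegral => x _; rewrite /h; ring.
  have bh2 : bmeas (fun x => h i l x ^+ 2).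
    by under eq_fun do rewrite expr2; exact: bmeasM.
  have bc : bmeas (fun x => 2 * (i == l)%:R * h i l x).
    by apply: bmeasM => //; exact: bmeas_cst.
  rewrite RintegralD //; try apply: bmeas_integrable => //.
    rewrite RintegralD //; try apply: bmeas_integrable => //; last exact: bmeas_cst.
    by rewrite expectZl // expect_h mulr0 add0r expect_cst lerDl sqr_ge0.
  by apply: bmeasD => //; exact: bmeas_cst.
apply: (@le_trans _ _ (\sum_(i < N) \sum_(l < N) n%:R^-1 *
    \int[PX]_x (alpha i * alpha l * (psi i x * psi l x) ^+ 2))).
  apply: ler_sum => i _; apply: ler_sum => l _; rewrite expectZl //.
  have -> : alpha i * alpha l * n%:R^-1 ^+ 2 * (n%:R * \int[PX]_x h i l x ^+ 2) =
     n%:R^-1 * (alpha i * alpha l * \int[PX]_x h i l x ^+ 2).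
    by field; exact: n0.
  rewrite ler_wpM2l ?invr_ge0 // ler_wpM2l //; exact: mulr_ge0.
have bt i l : bmeas (fun x => alpha i * alpha l * (psi i x * psi l x) ^+ 2).
  by apply: bmeasM => //; exact: bmeas_cst.
under eq_bigr do rewrite -mulr_sumr -expect_sum //.
rewrite -mulr_sumr -expect_sum; last by move=> i; exact: bmeas_sum.
rewrite mulrC ler_wpM2r ?invr_ge0 //.
rewrite -[leRHS](expect_cst PX); apply: le_Rintegral => //.
- by apply: bmeas_integrable; apply: bmeas_sum => i; exact: bmeas_sum.
- by apply: bmeas_integrable; exact: bmeas_cst.
move=> x _.
have -> : \sum_(i < N) \sum_(l < N) alpha i * alpha l * (psi i x * psi l x) ^+ 2 =
    (\sum_(i < N) alpha i * psi i x ^+ 2) ^+ 2.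
  rewrite expr2 mulr_suml; apply: eq_bigr => i _; rewrite mulr_sumr.
  by apply: eq_bigr => l _; ring.
have S0 : 0 <= \sum_(i < N) alpha i * psi i x ^+ 2.
  by apply: sumr_ge0 => i _; rewrite mulr_ge0 // sqr_ge0.
have k0 : 0 <= kap.
  apply: le_trans (kap_ub 0 (_ : 0 \in `[0, 1])); rewrite ?big_ord0 //.
  by rewrite in_itv /= lexx ler01.
rewrite ler_sqr ?nnegrE //.
have [x01|x01] := boolP (x \in `[0, 1]).
  by apply: le_trans (kap_ub N x01); apply: ler_sum => i _; rewrite psiE.
rewrite big1 // => i _; rewrite /psi patchE memNset ?expr0n ?mulr0 //.
by move=> /= H; move: x01; rewrite H.
Qed.

Let measurable_gap_gt N : measurable [set w | 4^-1 < gap N w].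
Proof.
rewrite (_ : [set _ | _] = setT `&` [set w | ((4^-1)%:E < (gap N w)%:E)%E]).
  by apply: emeasurable_fun_o_infty => //; apply/measurable_EFinP; case: (bmeas_gap N).
by rewrite setTI.
Qed.

Lemma measurable_gap_exceeds : measurable [set w | exists N, 4^-1 < gap N w].
Proof.
rewrite (_ : [set w | _] = \bigcup_N [set w | 4^-1 < gap N w]); last first.
  by apply/seteqP; split => w /= [N]; [exists N|move=> _; exists N].
exact: bigcupT_measurable.
Qed.

Let gap_le N w : gap N w <= gap N.+1 w.
Proof.
have p0 i l : 0 <= mu i / (lam + mu i) * (mu l / (lam + mu l)) *
    empirical_gap (fun i p => phi i (X p w)) i l ^+ 2.
  by rewrite mulr_ge0 ?sqr_ge0 // mulr_ge0 //; exact: alpha_ge0.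
rewrite /gap /hs_gap big_ord_recr /=.
apply: ler_wpDr; first by apply: sumr_ge0 => l _.
by apply: ler_sum => i _; rewrite big_ord_recr /= lerDl.
Qed.

(** The gaps increase with [N], so the events increase to their union and the
bound of Markov's inequality, uniform in [N], passes to the limit. *)
Lemma gap_exceeds_le :
  (P [set w | exists N, (4^-1 < gap N w)%R] <= (4 * kap ^+ 2 / n%:R)%:E)%E.
Proof.
pose A N := [set w | 4^-1 < gap N w].
have E : [set w | exists N, 4^-1 < gap N w] = \bigcup_N A N.
  by apply/seteqP; split => w /= [N]; [exists N|move=> _; exists N].
have mA N : measurable (A N) := measurable_gap_gt N.
have hA : {homo A : N M / (N <= M)%N >-> (N <= M)%O}.
  apply/nondecreasing_seqP => N.
  by rewrite subsetEset => w /= H; exact: lt_le_trans (gap_le N w).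
have mU : measurable (\bigcup_N A N) by exact: bigcupT_measurable.
have C := nondecreasing_cvg_mu (mu := P) mA mU hA.
rewrite E -(cvg_lim _ C) //; apply: lime_le; first exact: cvgP C.
apply: nearW => N /=.
have g0 w : 0 <= gap N w.
  apply: sumr_ge0 => i _; apply: sumr_ge0 => l _.
  by rewrite mulr_ge0 ?sqr_ge0 // mulr_ge0 //; exact: alpha_ge0.
have q0 : 0 < 4^-1 :> R by rewrite invr_gt0.
apply: le_trans (expect_markov P (bmeas_gap N) g0 q0) _.
by rewrite lee_fin invrK -mulrA ler_pM2l // expect_gap_le.
Qed.

End Concentration.

(** * The supremum and mean square norms *)
Section Norms.
Variables (R : realType) (PX : probability R R).

Lemma norm01_ge0 (p : \bar R) (g : R -> R) : p = 2%:E \/ p = +oo%E ->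
  (0 <= norm01 PX p g)%E.
Proof.
case=> ->; rewrite /norm01 /=; first exact: Lnorm_ge0.
apply: (@le_trans _ _ (`|g 0|)%:E); first by rewrite lee_fin.
by apply: ereal_sup_ubound; exists 0 => //=; rewrite in_itv /= lexx ler01.
Qed.

Lemma Lnorm2_le (h : R -> R) (B : R) : measurable_fun [set: R] h -> 0 <= B ->
  (forall x, `|h x| <= B) -> ('N[PX]_2%:E[EFin \o h] <= B%:E)%E.
Proof.
move=> mh B0 hB; rewrite unlock.
have -> : B%:E = ((B%:E `^ 2) `^ 2^-1)%E.
  by rewrite -poweRrM divff // poweRe1 // lee_fin.
have I0 (f : R -> \bar R) : (forall x, 0 <= f x)%E ->
    (\int[PX]_x f x)%E \in `[0%E, +oo%E].
  by move=> f0; rewrite in_itv /= leey andbT; apply: integral_ge0.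
apply: gt0_ler_poweR; first by rewrite invr_ge0.
- by apply: I0 => x; exact: poweR_ge0.
- by rewrite in_itv /= leey andbT lee_fin powR_ge0.
have -> : (B%:E `^ 2)%E = (\int[PX]_x (cst (B%:E `^ 2) x))%E.
  by rewrite integral_cst //= [X in (_ * X)%E]probability_setT mule1.
apply: ge0_le_integral => //.
- by move=> x _; exact: poweR_ge0.
- apply: (measurableT_comp (measurable_poweR _)).
  by apply/measurable_EFinP; apply: (measurableT_comp (@normr_measurable _ _) mh).
move=> x _; apply: gt0_ler_poweR => //; rewrite ?in_itv /= ?leey ?andbT ?lee_fin //.
Qed.

Variable pX : R -> R.
Hypothesis hPX : has_density01 PX pX.

Lemma density_set1 (a : R) : PX [set a] = 0%E.
Proof.
have [_ _ H] := hPX; rewrite H //; have [a01|a01] := pselect (`[0%R, 1%R]%classic a).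
  have -> : [set a] `&` `[0, 1] = [set a].
    by apply/seteqP; split => x /= => [[->]|->].
  exact: integral_set1.
have -> : [set a] `&` `[0, 1] = set0.
  by apply/seteqP; split => x //= [->].
by rewrite integral_set0.
Qed.

Lemma measurable_restrict_inside (h : R -> R) :
  (forall x, x \in `]0, 1[ -> {for x, continuous h}) ->
  measurable_fun [set: R] (h \_ `]0, 1[).
Proof.
move=> ch; apply: (measurable_restrictT h (measurable_itv `]0, 1[)).1.
apply: open_continuous_measurable_fun; first exact: interval_open.
by move=> x; rewrite inE => x01; exact: ch.
Qed.

Lemma restrict_unitE (u : R -> R) : u \_ `[0, 1] =
  (fun x => (u \_ `]0, 1[) x + u 0 * \1_[set 0] x + u 1 * \1_[set 1] x).
Proof.
have ind1 (a b : R) : \1_[set a] b = (b == a)%:R :> R.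
  rewrite indicE; congr (nat_of_bool _)%:R; apply/idP/eqP => [/set_mem //|->].
  exact: mem_set.
apply/funext => x; rewrite !ind1 !patchE.
have [->|x0] := eqVneq x 0.
  rewrite mem_set /= ?in_itv /= ?lexx ?ler01 // memNset /= ?in_itv /= ?ltxx //.
  by rewrite eq_sym oner_eq0 mulr1 mulr0 add0r addr0.
have [->|x1] := eqVneq x 1.
  rewrite mem_set /= ?in_itv /= ?lexx ?ler01 // memNset /= ?in_itv /= ?ltxx ?andbF //.
  by rewrite mulr1 mulr0 !add0r.
rewrite !mulr0 !addr0; congr (if _ then _ else _).
apply/idP/idP => /set_mem /= H; apply: mem_set => /=; last exact: oo_cc01.
move: H; rewrite !in_itv /= => /andP[a b].
by rewrite !lt_neqAle a b x1 eq_sym x0.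
Qed.

Lemma measurable_restrict_unit (u : R -> R) : measurable_fun [set: R] (u \_ `]0, 1[) ->
  measurable_fun [set: R] (u \_ `[0, 1]).
Proof.
move=> mu; rewrite restrict_unitE.
have mi (a : R) : measurable_fun [set: R] (\1_[set a] : R -> R) by exact: measurable_indic.
apply: measurable_funD; last exact: measurable_funM.
by apply: measurable_funD => //; exact: measurable_funM.
Qed.

Lemma Lnorm2_unit (u : R -> R) : measurable_fun [set: R] (u \_ `]0, 1[) ->
  ('N[PX]_2%:E[EFin \o (u \_ `[0%R, 1%R])] =
   'N[PX]_2%:E[EFin \o (u \_ `]0%R, 1%R[)])%E.
Proof.
move=> mu; have mu' := measurable_restrict_unit mu.
have mP (h : R -> R) : measurable_fun [set: R] h ->
    measurable_fun [set: R] (fun x => (abse ((EFin \o h) x) `^ 2)%E).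
  move=> mh; apply: (measurableT_comp (measurable_poweR _)).
  by apply/measurable_EFinP; apply: (measurableT_comp (@normr_measurable _ _) mh).
rewrite unlock; congr (_ `^ _)%E; apply: ae_eq_integral => //; try exact: mP.
exists ([set 0] `|` [set 1]); split.
- exact: measurableU.
- rewrite measureU0 //; exact: density_set1.
- move=> x /=; apply: contra_notP => /not_orP[x0 x1] _; rewrite restrict_unitE !indicE.
  by rewrite !memNset // !mulr0 !addr0.
Qed.

(** The mean [m] is controlled inside the interval only.  For the supremum norm
the dyadic points suffice because [g] and [f] are continuous up to the end
points; for the mean square norm the end points are null because [PX] has a
density. *)
Lemma norm01_triangle (p : \bar R) (f g m : R -> R) (B c : R) :
  p = 2%:E \/ p = +oo%E -> 0 <= B ->
  {within `[0, 1], continuous f} -> {within `[0, 1], continuous g} ->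
  (forall x, x \in `]0, 1[ -> {for x, continuous m}) ->
  (forall l i, interior_index l i -> `|g (dyadic R l i) - m (dyadic R l i)| <= B) ->
  (norm01 PX p (fun x => (m x - f x)%R) <= c%:E)%E ->
  (norm01 PX p (fun x => (g x - f x)%R) <= (B + c)%:E)%E.
Proof.
move=> pE B0 cf cg cm gm; have cf' x := continuous_inside (x := x) cf.
have cg' x := continuous_inside (x := x) cg.
have gm' x : x \in `]0, 1[ -> `|g x - m x| <= B.
  apply: (inside_le_of_dyadic (f := fun x => g x - m x)) => // y y01.
  by apply: (@cvgB _ _ _ _ _ g m); [exact: cg'|exact: cm].
case: pE => ->; rewrite /norm01 /=; last first.
  move=> mf; apply: ge_ereal_sup => _ [x x01 <-]; rewrite lee_fin.
  apply: (unit_le_of_dyadic (f := fun x => g x - f x)) => //.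
    move=> y; apply: (@cvgB _ _ _ _ _ (g : subspace `[0 : R, 1] -> R) f).
      exact: cg.
    exact: cf.
  move=> l i li; set y := dyadic R l i.
  have := gm _ _ li; have : `|m y - f y| <= c.
    rewrite -lee_fin; apply: le_trans mf; apply: ereal_sup_ubound.
    by exists y => //; exact: oo_cc01 (dyadic_inside R li).
  rewrite -/y !ler_norml => /andP[? ?] /andP[? ?]; apply/andP; split; lra.
move=> mf.
pose a := (fun x => g x - m x) \_ `]0, 1[.
pose b := (fun x => m x - f x) \_ `]0, 1[.
have ma : measurable_fun setT a.
  apply: measurable_restrict_inside => y y01.
  by apply: (@cvgB _ _ _ _ _ g m); [exact: cg'|exact: cm].
have mb : measurable_fun setT b.
  apply: measurable_restrict_inside => y y01.
  by apply: (@cvgB _ _ _ _ _ m f); [exact: cm|exact: cf'].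
have gf : measurable_fun setT ((fun x => g x - f x) \_ `]0, 1[).
  apply: measurable_restrict_inside => y y01.
  by apply: (@cvgB _ _ _ _ _ g f); [exact: cg'|exact: cf'].
rewrite (Lnorm2_unit gf); rewrite (Lnorm2_unit mb) in mf.
have -> : (fun x => g x - f x) \_ `]0, 1[ = (a \+ b)%R.
  apply/funext => x; rewrite /a /b /= !patchE; case: ifP => _; last by rewrite addr0.
  by rewrite subrKA.
apply: le_trans (minkowski_EFin PX ma mb (ler1n _ 2)) _.
have A : ('N[PX]_2%:E[EFin \o a] <= B%:E)%E.
  apply: Lnorm2_le => // x.
  rewrite /a patchE; case: ifPn => [/set_mem x01|_]; first exact: gm'.
  by rewrite normr0.
rewrite EFinD; exact: (leeD A mf).
Qed.

End Norms.

(** * Contraction of one Gaussian law *)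
Section EffectiveDimension.
Variables (R : realType) (mu : nat -> R) (phi : nat -> R -> R) (lam : R).
Hypotheses (mu_gt0 : forall i, 0 < mu i) (lam_gt0 : 0 < lam).

Lemma kappa_tilde2_partial m c N x : (kappa_tilde2 mu phi lam m <= c%:E)%E ->
  x \in `[0, 1] ->
  \sum_(i < N) mu i / (lam + mu i) * nderiv01 m (phi i) x ^+ 2 <= c.
Proof.
move=> kc x01; rewrite -lee_fin; apply: le_trans kc.
apply: le_trans (ereal_sup_ubound _); last by exists x.
rewrite -sumEFin -(big_mkord predT (fun i => (mu i / (lam + mu i) *
  nderiv01 m (phi i) x ^+ 2)%:E)).
apply: nneseries_lim_ge => i _ _; rewrite lee_fin mulr_ge0 ?sqr_ge0 //.
by rewrite divr_ge0 ?(ltW (mu_gt0 _)) // ltW // addr_gt0.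
Qed.

Lemma kappa_hat2_partial m c N : (kappa_hat2 mu lam m <= c%:E)%E ->
  \sum_(i < N) i.+1%:R ^+ (2 * m) * mu i / (lam + mu i) <= c.
Proof.
move=> kc; rewrite -lee_fin; apply: le_trans kc.
rewrite -sumEFin -(big_mkord predT (fun i => (i.+1%:R ^+ (2 * m) * mu i / (lam + mu i))%:E)).
apply: nneseries_lim_ge => i _ _; rewrite lee_fin -mulrA mulr_ge0 ?exprn_ge0 //.
by rewrite divr_ge0 ?(ltW (mu_gt0 _)) // ltW // addr_gt0.
Qed.

(** The eigenvalues being bounded by the first one, mu_i is at most
(lam + mu_0) mu_i / (lam + mu_i). *)
Lemma eigenvalues_summable m c N : (forall i, mu i.+1 <= mu i) ->
  (kappa_hat2 mu lam m <= c%:E)%E ->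
  \sum_(i < N) mu i * i.+1%:R ^+ (2 * m) <= (lam + mu 0%N) * c.
Proof.
move=> mu_dec kc.
have m0 i : mu i <= mu 0%N by elim: i => // i; exact: le_trans.
apply: le_trans (_ : _ <= (lam + mu 0%N) *
  (\sum_(i < N) i.+1%:R ^+ (2 * m) * mu i / (lam + mu i))) _.
  rewrite mulr_sumr; apply: ler_sum => i _.
  have lm : 0 < lam + mu i by rewrite addr_gt0.
  rewrite mulrCA mulrC -mulrA ler_wpM2l ?exprn_ge0 //.
  by rewrite ler_peMr ?(ltW (mu_gt0 _)) // ler_pdivlMr // mul1r lerD2l.
by rewrite ler_wpM2l ?kappa_hat2_partial // ltW // addr_gt0.
Qed.

End EffectiveDimension.

Section Contraction.
Variable R : realType.

(** The factor 8 makes q^l at most 1 / n at this level for both ratios of the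
chaining, since (3/4)^8 and (8/9)^8 are at most 1/2, while the grid has at
most 256 n^8 points. *)
Definition start_level (n : nat) : nat := 8 * (trunc_log 2 n).+1.

Lemma start_level_ub n : (0 < n)%N -> 2 ^+ start_level n <= 256 * n%:R ^+ 8 :> R.
Proof.
move=> n0; rewrite /start_level mulnC exprM (exprS 2 (trunc_log 2 n)) exprMn.
have -> : 256 = 2 ^+ 8 :> R by rewrite -natrX.
rewrite ler_pM2l ?exprn_gt0 // lerXn2r ?nnegrE ?exprn_ge0 //.
by rewrite -natrX ler_nat trunc_logP.
Qed.

Lemma start_level_lb n (q : R) : (0 < n)%N -> 0 <= q -> q ^+ 8 <= 2^-1 ->
  q ^+ start_level n <= n%:R^-1.
Proof.
move=> n0 q0 q8; rewrite /start_level exprM.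
apply: (@le_trans _ _ (2^-1 ^+ (trunc_log 2 n).+1)).
  by rewrite lerXn2r ?nnegrE ?exprn_ge0 ?invr_ge0.
rewrite exprVn lef_pV2 ?posrE ?exprn_gt0 ?ltr0n // -natrX ler_nat ltnW //.
exact: trunc_log_ltn.
Qed.

(** The deviation M eps is split into M eps / 4 for the starting grid, 3 / n for
the chaining, where 1 / n <= eps, and C eps for the mean; the condition
4 + 2 C <= M leaves room for the three.  With 576 C1 <= M^2, the Gaussian tail
at a grid point is at most 2 n^(-9), and there are at most 256 n^8 points. *)
Lemma GP_contraction (PX : probability R R) (pX : R -> R) (p : \bar R)
    (Q : {measure set (path_space R) -> \bar R}) (m f : R -> R) (V : R -> R -> R)
    (n : nat) (eps M C C1 S1 : R) :
  has_density01 PX pX -> p = 2%:E \/ p = +oo%E -> is_GP_law Q m V ->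
  (1 < n)%N -> 0 < eps -> 1 <= n%:R * eps ^+ 2 -> 0 < C1 -> 0 < S1 ->
  4 + 2 * C <= M -> 0 < C -> 576 * C1 <= M ^+ 2 ->
  (forall x, x \in `]0, 1[ -> V x x <= C1 * eps ^+ 2 / ln n%:R) ->
  (forall x y, x \in `]0, 1[ -> y \in `]0, 1[ ->
    V x x - V x y - V y x + V y y <= S1 * (x - y) ^+ 2) ->
  {within `[0, 1], continuous f} ->
  (forall x, x \in `]0, 1[ -> {for x, continuous m}) ->
  (norm01 PX p (fun x => (m x - f x)%R) <= (C * eps)%:E)%E ->
  let A := [set g : path_space R | ((M * eps)%:E <
     norm01 PX p (fun x => ((g : C01 R) x - f x)%R))%E] in
  measurable A -> (Q A <= ((512 + 64 * S1) / n%:R)%:E)%E.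
Proof.
move=> dPX pE GP n1 e0 ne C10 S10 MC C0 MC1 Vp Vi cf cm mf A mA.
have n0 : (0 < n)%N by rewrite ltnW.
have nR : 0 < n%:R :> R by rewrite ltr0n.
have ln0 : 0 < ln n%:R :> R by rewrite ln_gt0 // ltr1n.
have S00 : 0 < C1 * eps ^+ 2 / ln n%:R by rewrite divr_gt0 // mulr_gt0 // exprn_gt0.
have M0 : 0 < M by apply: lt_le_trans MC; rewrite addr_gt0 // mulr_gt0.
have u0 : 0 <= M * eps / 4 by rewrite divr_ge0 // mulr_ge0 // ltW.
have ninv : n%:R^-1 <= eps.
  have : n%:R^-1 ^+ 2 <= eps ^+ 2.
    apply: (@le_trans _ _ n%:R^-1).
      by rewrite expr2 ler_piMr ?invr_ge0 // invf_le1 // ler1n.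
    by rewrite -[leLHS]mulr1 ler_pdivrMl.
  by rewrite ler_sqr ?nnegrE ?invr_ge0 // ltW.
have q34 : (3 / 4) ^+ start_level n <= n%:R^-1 :> R.
  by apply: start_level_lb => //; lra.
have q89 : (8 / 9) ^+ start_level n <= n%:R^-1 :> R.
  by apply: start_level_lb => //; lra.
have sub : A `<=` [set g : path_space R | exists l i, interior_index l i /\
    M * eps / 4 + 3 * (3 / 4) ^+ start_level n <
      `|(g : C01 R) (dyadic R l i) - m (dyadic R l i)|].
  move=> g /= gA; apply: contrapT => N.
  have cg : {within `[0, 1], continuous (g : C01 R)} by exact: (@cts_fun _ _ (g : C01 R)).
  have B0 : 0 <= M * eps / 4 + 3 * (3 / 4) ^+ start_level n.
    by rewrite addr_ge0 // mulr_ge0 // exprn_ge0 // divr_ge0.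
  have := norm01_triangle dPX pE B0 cf cg cm _ mf.
  have H l i : interior_index l i -> `|(g : C01 R) (dyadic R l i) - m (dyadic R l i)| <=
      M * eps / 4 + 3 * (3 / 4) ^+ start_level n.
    by move=> li; rewrite leNgt; apply/negP => lt; apply: N; exists l, i.
  move=> /(_ H) /(lt_le_trans gA); rewrite lte_fin; apply/negP; rewrite -leNgt.
  apply: (@le_trans _ _ (M * eps / 4 + 3 * eps + C * eps)).
    by rewrite lerD2r lerD2l ler_pM2l // (le_trans q34).
  have : 0 <= eps * (M - (4 + 2 * C)) by rewrite mulr_ge0 ?subr_ge0 // ltW.
  have : 0 < eps * C by rewrite mulr_gt0.
  lra.
apply: le_trans (GP_sup_tail GP S00 S10 Vp Vi (l0 := start_level n) isT u0 mA sub) _.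
rewrite lee_fin [leRHS]mulrDl; apply: lerD; last first.
  by rewrite ler_wpM2l // mulr_ge0 // ltW.
have -> : (M * eps / 4) ^+ 2 / (4 * (C1 * eps ^+ 2 / ln n%:R)) =
    M ^+ 2 / (64 * C1) * ln n%:R.
  by field; rewrite !gt_eqF.
apply: (@le_trans _ _ (256 * n%:R ^+ 8 * (2 * n%:R^-1 ^+ 9))).
  apply: ler_pM; rewrite ?exprn_ge0 ?mulr_ge0 ?expR_ge0 //; first exact: start_level_ub.
  rewrite ler_pM2l // -[n%:R in leRHS]lnK ?posrE // -expRN -expRM_natl ler_expR.
  rewrite mulrN lerN2 ler_wpM2r ?(ltW ln0) // ler_pdivlMr ?mulr_gt0 //; lra.
rewrite le_eqVlt; apply/orP; left; apply/eqP; field; exact: lt0r_neq0.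
Qed.

End Contraction.

(** * Contraction of the posterior *)
Section Assembly.
Variable R : realType.

Lemma Ck01_continuous_inside k (f : R -> R) x : Ck01 k f -> x \in `]0, 1[ ->
  {for x, continuous f}.
Proof.
case: k => [|k] [df cf] x01; first exact: (continuous_inside cf x01).
by apply: derivable01_continuous => //; apply: (df 0%N) => //; exact: oo_cc01.
Qed.

Lemma measurable_sample d (T : measurableType d) (P : probability T R) n
    (X e : 'I_n -> {RV P >-> R}) (f : R -> R) :
  (forall i w, X i w \in `[0, 1]) ->
  (forall x, x \in `]0, 1[ -> {for x, continuous f}) ->
  measurable_fun [set: T] (sample f X e).
Proof.
move=> X01 cf; apply/measurable_fun_tnthP => i.
have -> : (@tnth n (R * R)%type)^~ i \o sample f X e =
    (fun w => (X i w, (f \_ `[0, 1]) (X i w) + e i w)).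
  by apply/funext => w /=; rewrite tnth_mktuple patchE mem_set //; exact: X01.
apply: measurable_fun_pair => //; apply: measurable_funD => //.
apply: (measurableT_comp _ (measurable_funPT (X i))).
by apply: measurable_restrict_unit; apply: measurable_restrict_inside => x; exact: cf.
Qed.

Lemma dataX_sample (f : R -> R) n (T : Type) (X e : 'I_n -> T -> R) w i :
  dataX (sample f X e w) i = X i w.
Proof. by rewrite /dataX tnth_mktuple. Qed.

Lemma cvg0_of_measure_le (u : nat -> \bar R) :
  (forall n, (0 <= u n)%E /\ u n \is a fin_num) ->
  (forall e, 0 < e -> \forall n \near \oo, (u n <= e%:E)%E) ->
  u @ \oo --> 0%E.
Proof.
move=> u0 H; apply/fine_cvgP; split; first by apply: nearW => n; case: (u0 n).
apply/cvgrPdist_le => e e0; apply: filterS (H e e0) => n un /=.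
have [un0 unf] := u0 n; rewrite sub0r normrN ger0_norm ?fine_ge0 //.
by rewrite -lee_fin fineK.
Qed.

Lemma le_sqr_of_addr1_le (a M : R) : 0 <= a -> a + 1 <= M -> a <= M ^+ 2.
Proof. by move=> a0 aM; nra. Qed.

End Assembly.

Unset Implicit Arguments.

Theorem theorem1 (R : realType)
  (k : nat) (sigma : R) (sigma_gt0 : 0 < sigma)
  (PX : probability R R) (pX : R -> R) (hPX : has_density01 PX pX)
  (f0 : R -> R) (hf0 : Ck01 k f0)
  (K : R -> R -> R) (K_cont : continuous_kernel K)
  (K_sym : symmetric_kernel K) (K_pd : positive_definite_kernel K)
  (K_C2k : kernel_C2k k K)
  (mu : nat -> R) (phi : nat -> R -> R)
  (mercer : mercer_decomposition PX K mu phi)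
  (d : nat -> measure_display) (T : forall n : nat, measurableType (d n))
  (P : forall n : nat, probability (T n) R)
  (X e : forall n : nat, 'I_n -> {RV (P n) >-> R})
  (model : forall n : nat, regression_design PX sigma (@X n) (@e n))
  (lambda : nat -> R) (lambda_gt0 : forall n : nat, 0 < lambda n)
  (Pi : forall n : nat, R.-pker (n.-tuple (R * R)) ~> path_space R)
  (hPi : forall (n : nat) (D : n.-tuple (R * R)), (0 < n)%N ->
     (forall i : 'I_n, dataX D i \in `[0, 1]) ->
     is_GP_law (Pi n D) (post_mean K (lambda n) k D)
       (post_cov K sigma (lambda n) k D))
  (eps : nat -> R) (eps_cvg0 : eps @ \oo --> (0 : R))
  (neps2_cvgy : (fun n : nat => n%:R * eps n ^+ 2) @ \oo --> +oo)
  (p : \bar R) (hp : p = 2%:E \/ p = +oo%E)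
  (hA : exists2 C : R, 0 < C & forall (i : nat) (x : R), x \in `[0, 1] ->
     `|nderiv01 k (phi i) x| <= C * i.+1%:R ^+ k)
  (hB : exists2 L : R, 0 < L & forall (i : nat) (x x' : R),
     x \in `[0, 1] -> x' \in `[0, 1] ->
     `|nderiv01 k (phi i) x - nderiv01 k (phi i) x'| <=
       L * i.+1%:R ^+ k.+1 * `|x - x'|)
  (hC0 : elittleo (fun n : nat => kappa_tilde2 mu phi (lambda n) 0)
     (fun n : nat => Num.sqrt (n%:R / ln n%:R)))
  (hCk : ebigO (fun n : nat => kappa_tilde2 mu phi (lambda n) k)
     (fun n : nat => n%:R * eps n ^+ 2 / ln n%:R))
  (hChat : ebigO (fun n : nat => kappa_hat2 mu (lambda n) k.+1)
     (fun n : nat => n%:R))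
  (hD : exists2 C : R, 0 < C &
     (fun n : nat => P n [set w : T n |
        (norm01 PX p (fun x : R =>
           (post_mean K (lambda n) k (sample f0 (@X n) (@e n) w) x
            - nderiv01 k f0 x)%R)
         <= (C * eps n)%:E)%E]) @ \oo --> 1%E) :
  forall M : nat -> R, M @ \oo --> +oo ->
  forall delta : R, 0 < delta ->
    (fun n : nat => P n [set w : T n |
       (delta%:E < Pi n (sample f0 (@X n) (@e n) w)
          [set g : path_space R |
            ((M n * eps n)%:E <
              norm01 PX p (fun x : R => ((g : C01 R) x - nderiv01 k f0 x)%R))%E])%E])
      @ \oo --> 0%E.
Proof.
move=> M My delta delta0.
have [Cphi Cphi0 phi_bound] := hA.
have [L L0 phi_lip] := hB.
have [Ck Ck0 hk] := hCk.
have [Ch Ch0 hh] := hChat.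
have [C C0 hH] := hD.
have mu_gt0 := mercer_gt0 mercer.
(* a single index N at which kappa_hat is finite makes the series summable *)
have [B HB] : exists B, forall N, \sum_(i < N) mu i * i.+1%:R ^+ (2 * k.+1) <= B.
  have [N _ /(_ N (leqnn N)) HN] := hh.
  exists ((lambda N + mu 0%N) * (Ch * N%:R)) => j.
  exact: (eigenvalues_summable mu_gt0 (lambda_gt0 N) j (mercer_noninc mercer) HN).
have in01 n (i : 'I_n) (w : T n) : @X n i w \in `[0, 1] := design_in01 (model n) i w.
have D01 n w (i : 'I_n) : dataX (sample f0 (@X n) (@e n) w) i \in `[0, 1].
  by rewrite dataX_sample.
have msample n : measurable_fun [set: T n] (sample f0 (@X n) (@e n)).
  apply: measurable_sample => // x; exact: Ck01_continuous_inside hf0.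
have cf := hf0.2.
have cf' x := continuous_inside (x := x) cf.
have cmean n w x : (0 < n)%N -> x \in `]0, 1[ ->
    {for x, continuous (post_mean K (lambda n) k (sample f0 (@X n) (@e n) w))}.
  move=> n0 x01.
  have [a a0 lip] := post_mean_lipschitz mercer K_sym K_C2k L0 phi_lip HB
    (lambda n) (D01 n w).
  apply/cvgrPdist_le => r r0.
  have ra : 0 < r / (a + 1) by rewrite divr_gt0 // ltr_wpDl.
  have N : nbhs x (ball x (r / (a + 1))) by exact: nbhsx_ballx.
  apply: filterS2 N (nbhs_Ioo01 x01) => y yr y01.
  apply: le_trans (lip _ _ x01 y01) _.
  apply: (@le_trans _ _ (a * (r / (a + 1)))); first by rewrite ler_wpM2l // ltW.
  by rewrite mulrA ler_pdivrMr ?ltr_wpDl // mulrC ler_pM2l // lerDl.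
(* H: the mean is accurate; A: the paths are not; G: the design is badly
   conditioned *)
pose H n := [set w : T n | (norm01 PX p (fun x : R =>
  (post_mean K (lambda n) k (sample f0 (@X n) (@e n) w) x - nderiv01 k f0 x)%R)
  <= (C * eps n)%:E)%E].
pose A n := [set g : path_space R | ((M n * eps n)%:E <
  norm01 PX p (fun x : R => ((g : C01 R) x - nderiv01 k f0 x)%R))%E].
have mA n : measurable (A n).
  have -> : A n = ~` [set g : path_space R |
      (norm01 PX p (fun x : R => ((g : C01 R) x - nderiv01 k f0 x)%R)
       <= (M n * eps n)%:E)%E].
    by apply/seteqP; split => g; rewrite /A /= ltNge; [move/negP|move=> ?; apply/negP].
  apply: measurableC; apply: measurable_norm01_le => // [g x x01|x x01].
    apply: (@cvgB _ _ _ _ _ (g : C01 R) (nderiv01 k f0)); last exact: cf'.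
    exact: (continuous_inside (@cts_fun _ _ (g : C01 R)) x01).
  by apply: measurable_funB; [exact: measurable_eval|exact: measurable_cst].
have mH n : (0 < n)%N -> measurable (H n).
  move=> n0; apply: measurable_norm01_le => // [w x x01|x x01].
    apply: (@cvgB _ _ _ _ _ (post_mean K (lambda n) k (sample f0 (@X n) (@e n) w))
      (nderiv01 k f0)); [exact: cmean|exact: cf'].
  apply: measurable_funB; last exact: measurable_cst.
  apply: (@measurable_GP_mean _ _ _ _ _ (Pi n) (sample f0 (@X n) (@e n)) _
    (fun w => post_cov K sigma (lambda n) k (sample f0 (@X n) (@e n) w) x x) x x01
    (msample n)) => w E mE.
  have := hPi n _ n0 (D01 n w) 1%N (fun=> x) (fun=> 1) (fun=> x01) _ mE.
  rewrite !big_ord1 !mul1r => <-; congr (Pi n _ _).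
  by apply/seteqP; split => g /=; rewrite big_ord1 mul1r.
pose G n := [set w : T n | exists N, 4^-1 <
   hs_gap (lambda n) mu (fun i q => phi i (@X n q w)) N].
have mbad n : measurable [set w | (delta%:E < Pi n (sample f0 (@X n) (@e n) w) (A n))%E].
  rewrite -[X in measurable X]setTI; apply: emeasurable_fun_o_infty => //.
  exact: (measurableT_comp (measurable_kernel (Pi n) _ (mA n)) (msample n)).
(* the constants of the pointwise and of the increment variance outside G *)
pose C1 := 2 * sigma ^+ 2 * Ck; pose S1 := 2 * sigma ^+ 2 * (Ch * L ^+ 2).
have s20 : 0 < 2 * sigma ^+ 2 by rewrite mulr_gt0 // exprn_gt0.
have C10 : 0 < C1 by rewrite mulr_gt0.
have S10 : 0 < S1 by rewrite mulr_gt0 // mulr_gt0 // exprn_gt0.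
apply: cvg0_of_measure_le => [n|r r0].
  by split; [exact: measure_ge0|exact: fin_num_measure].
(* Markov's inequality bounds P (G n) by 4 c^2 *)
pose c := Num.min 1 (r / 8).
have c0 : 0 < c by rewrite lt_min ltr01 divr_gt0.
have c4 : 4 * c ^+ 2 <= r / 2.
  have : c ^+ 2 <= 1 * (r / 8).
    by rewrite expr2 ler_pM ?(ltW c0) // /c ge_min lexx ?orbT.
  lra.
have [_ /cvgrPdist_le Hfine] := (fine_cvgP _ _).1 hH.
have r20 : 0 < r / 2 by rewrite divr_gt0.
have hH1 : \forall n \near \oo, `|1 - fine (P n (H n))| <= r / 2 by exact: Hfine.
have hH2 : \forall n \near \oo, `|1 - fine (P n (H n))| <= 2^-1.
  by apply: Hfine; rewrite invr_gt0.
have ne1 : \forall n \near \oo, 1 <= n%:R * eps n ^+ 2 by exact: (cvgryPge _).1 neps2_cvgy 1.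
have M1 : \forall n \near \oo, 4 + 2 * C <= M n by exact: (cvgryPge _).1 My _.
have M2 : \forall n \near \oo, 576 * C1 + 1 <= M n by exact: (cvgryPge _).1 My _.
have n1 : \forall n \near \oo, Num.max (expR 1) ((512 + 64 * S1) / delta) <= n%:R :> R.
  exact: nbhs_infty_ger.
have hc := hC0 c c0.
near=> n.
have nbig : Num.max (expR 1) ((512 + 64 * S1) / delta) <= n%:R :> R by near: n.
move: nbig; rewrite ge_max => /andP[nexp ndelta].
have n1' : (1 < n)%N.
  rewrite -(ltr_nat R); apply: lt_le_trans nexp; exact: pexpR_gt1.
have n0 : (0 < n)%N by exact: ltnW.
have nR : 0 < n%:R :> R by rewrite ltr0n.
have ln1 : 1 <= ln n%:R :> R by rewrite -[leLHS]expRK ler_ln ?posrE ?expR_gt0.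
have ln0 : 0 < ln n%:R :> R by exact: lt_le_trans ln1.
have neps : 1 <= n%:R * eps n ^+ 2 by near: n.
have MC : 4 + 2 * C <= M n by near: n.
have MC1 : 576 * C1 <= M n ^+ 2.
  have : 576 * C1 + 1 <= M n by near: n.
  by apply: le_sqr_of_addr1_le; rewrite mulr_ge0 ?ler0n // ltW.
have PH : `|1 - fine (P n (H n))| <= r / 2 by near: n.
have PH2 : `|1 - fine (P n (H n))| <= 2^-1 by near: n.
have kn : (kappa_tilde2 mu phi (lambda n) k <=
    (Ck * (n%:R * eps n ^+ 2 / ln n%:R))%:E)%E by near: n.
have hn : (kappa_hat2 mu (lambda n) k.+1 <= (Ch * n%:R)%:E)%E by near: n.
have cn : (kappa_tilde2 mu phi (lambda n) 0 <=
    (c * Num.sqrt (n%:R / ln n%:R))%:E)%E by near: n.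
(* a negative eps n would make H n empty, against its probability being at
   least 1/2; and eps n = 0 contradicts neps *)
have epos : 0 < eps n.
  have [w Hw] : H n !=set0.
    apply/set0P/negP => /eqP H0; move: PH2; rewrite H0 measure0 /= subr0 normr1.
    by rewrite leNgt invf_lt1 // ltr1n.
  have : 0 <= C * eps n by rewrite -lee_fin; apply: le_trans (norm01_ge0 _ _ hp) Hw.
  rewrite pmulr_rge0 // le_eqVlt => /orP[/eqP e00|//].
  by move: neps; rewrite -e00 expr0n mulr0 ler10.
have PHr : (P n (~` H n) <= (r / 2)%:E)%E.
  rewrite probability_setC; last exact: mH.
  rewrite -[P n (H n)]fineK ?fin_num_measure //; last exact: mH.
  rewrite -EFinB lee_fin; exact: le_trans (ler_norm _) PH.
have PG : (P n (G n) <= (r / 2)%:E)%E.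
  apply: le_trans (gap_exceeds_le (model n) mercer n0 (lambda_gt0 n)
    (kap := c * Num.sqrt (n%:R / ln n%:R)) _) _.
    move=> N x x01; exact: (kappa_tilde2_partial mu_gt0 (lambda_gt0 n) N cn x01).
  rewrite lee_fin; apply: le_trans c4.
  rewrite exprMn sqr_sqrtr ?divr_ge0 ?(ltW ln0) //.
  have -> : 4 * (c ^+ 2 * (n%:R / ln n%:R)) / n%:R = 4 * c ^+ 2 / ln n%:R.
    by field; rewrite !gt_eqF.
  by rewrite ler_pdivrMr // ler_peMr // mulr_ge0 // sqr_ge0.
have mG : measurable (G n).
  exact: (measurable_gap_exceeds (model n) mercer (lambda n) n0).
(* outside the complement of H and outside G, the posterior mass of A is at
   most (512 + 64 S1) / n, hence at most delta *)
apply: (@le_trans _ _ (P n (~` H n `|` G n))).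
  apply: le_measure; rewrite ?inE //; first exact: measurableU (measurableC (mH n n0)) mG.
  move=> w /= bad; apply: contrapT => /not_orP[/contrapT Hw nG].
  move: bad; apply/negP; rewrite -leNgt.
  have gap N : hs_gap (lambda n) mu
      (fun i q => phi i (dataX (sample f0 (@X n) (@e n) w) q)) N <= 4^-1.
    rewrite leNgt; apply/negP => lt; apply: nG; exists N.
    move: lt; congr (_ < hs_gap _ _ _ _).
    by apply/funext => i; apply/funext => q; rewrite dataX_sample.
  have pv Nt (t a : 'I_Nt -> R) W t01 := @post_cov_bound R PX K mu phi mercer K_sym K_pd k
    K_C2k Cphi L B Cphi0 L0 phi_bound phi_lip HB n (sample f0 (@X n) (@e n) w)
    (lambda n) sigma n0 (lambda_gt0 n) (D01 n w) Nt t a W t01 gap.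
  apply: le_trans (GP_contraction hPX hp (hPi n _ n0 (D01 n w)) n1' epos neps
    C10 S10 MC C0 MC1 _ _ cf (fun x => cmean n w x n0) Hw (mA n)) _.
  - (* one node: evaluation at x *)
    move=> x x01.
    have := pv 1%N (fun=> x) (fun=> 1) (Ck * (n%:R * eps n ^+ 2 / ln n%:R)) (fun=> x01).
    rewrite !big_ord1 !mul1r => /(_ _)/le_trans; apply.
      move=> N; under eq_bigr do rewrite big_ord1 mul1r.
      exact: (kappa_tilde2_partial mu_gt0 (lambda_gt0 n) N kn (oo_cc01 x01)).
    rewrite le_eqVlt; apply/orP; left; apply/eqP; rewrite /C1.
    by field; rewrite !gt_eqF.
  - (* two nodes with weights 1 and -1: the increment from y to x *)
    move=> x y x01 y01.
    pose t (i : 'I_2) := if i == 0 then x else y.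
    pose a (i : 'I_2) : R := if i == 0 then 1 else -1.
    have t01 i : t i \in `]0, 1[ by rewrite /t; case: ifP.
    have := pv 2%N t a (Ch * n%:R * L ^+ 2 * (x - y) ^+ 2) t01.
    have -> : \sum_(i < 2) \sum_(j < 2) a i * a j * post_cov K sigma (lambda n) k
        (sample f0 (@X n) (@e n) w) (t i) (t j) =
      post_cov K sigma (lambda n) k (sample f0 (@X n) (@e n) w) x x -
      post_cov K sigma (lambda n) k (sample f0 (@X n) (@e n) w) x y -
      post_cov K sigma (lambda n) k (sample f0 (@X n) (@e n) w) y x +
      post_cov K sigma (lambda n) k (sample f0 (@X n) (@e n) w) y y.
      by rewrite !big_ord_recl !big_ord0 /a /t /=; ring.
    move=> /(_ _)/le_trans; apply.
      move=> N; apply: (@le_trans _ _ (\sum_(i < N) i.+1%:R ^+ (2 * k.+1) * mu i /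
          (lambda n + mu i) * (L ^+ 2 * (x - y) ^+ 2))).
        apply: ler_sum => i _.
        have -> : \sum_(j < 2) a j * nderiv01 k (phi i) (t j) =
            nderiv01 k (phi i) x - nderiv01 k (phi i) y.
          by rewrite !big_ord_recl big_ord0 /a /t /=; ring.
        have wpos : 0 <= mu i / (lambda n + mu i).
          by rewrite divr_ge0 ?(ltW (mu_gt0 _)) // ltW // addr_gt0.
        pose b : R := i.+1%:R ^+ k.+1.
        have -> : i.+1%:R ^+ (2 * k.+1) * mu i / (lambda n + mu i) *
            (L ^+ 2 * (x - y) ^+ 2) =
            mu i / (lambda n + mu i) * (L * b * `|x - y|) ^+ 2.
          by rewrite mulnC exprM -/b !exprMn (real_normK (num_real _)); ring.
        rewrite ler_wpM2l // -[X in X <= _]real_normK ?num_real // ler_sqr ?nnegrE //.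
          exact: phi_lip (oo_cc01 x01) (oo_cc01 y01).
        by rewrite !mulr_ge0 ?exprn_ge0 // ltW.
      rewrite -mulr_suml -mulrA ler_wpM2r //.
        by rewrite mulr_ge0 // sqr_ge0.
      exact: (kappa_hat2_partial mu_gt0 (lambda_gt0 n) N hn).
    rewrite le_eqVlt; apply/orP; left; apply/eqP; rewrite /S1.
    by field; rewrite !gt_eqF.
  by rewrite lee_fin ler_pdivrMr // [leRHS]mulrC -ler_pdivrMr.
have := @measureU2 _ _ _ (P n) _ _ (measurableC (mH n n0)) mG.
move=> /le_trans; apply.
rewrite [leRHS](_ : _ = (r / 2)%:E + (r / 2)%:E)%E; last by rewrite -EFinD -splitr.
exact: (leeD PHr PG).
Unshelve. all: end_near.
Qed.
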